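(* Let $\mathcal{X}$ be an infinite-dimensional complex Banach space and let $\phi:\mathcal{B}(\mathcal{X})\to\mathcal{B}(\mathcal{X})$ be a map (not assumed linear, additive or continuous) whose range contains the set $\mathcal{I}^{\pm}(\mathcal{X})$. Suppose that $$A\circ B\in\mathcal{I}(\mathcal{X})\quad\Longleftrightarrow\quad \phi(A)\circ\phi(B)\in\mathcal{I}(\mathcal{X})$$ for every $A,B\in\mathcal{B}(\mathcal{X})$. Then either there exist a bounded invertible linear or conjugate-linear operator $T:\mathcal{X}\to\mathcal{X}$ and $\lambda\in\{-1,1\}$ such that $$\phi(X)=\lambda TXT^{-1}\qquad\text{for every }X\in\mathcal{B}(\mathcal{X}),$$ or (this being possible only if $\mathcal{X}$ is reflexive) there exist a bounded invertible linear or conjugate-linear operator $T:\mathcal{X}'\to\mathcal{X}$ and $\lambda\in\{-1,1\}$ such that $$\phi(X)=\lambda TX'T^{-1}\qquad\text{for every }X\in\mathcal{B}(\mathcal{X}).$$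
   Context: $\mathcal{B}(\mathcal{X})$ is the algebra of all bounded linear operators on $\mathcal{X}$; $\mathcal{X}'$ is the topological dual of $\mathcal{X}$ and $X'$ is the adjoint operator on $\mathcal{X}'$ of $X\in\mathcal{B}(\mathcal{X})$. The Jordan product is $A\circ B=\frac12(AB+BA)$. $\mathcal{I}(\mathcal{X})=\{P\in\mathcal{B}(\mathcal{X}):P^2=P\}$ is the set of all idempotents (including $0$). An operator $P$ is anti-idempotent if $P^2=-P$ and $P\neq 0$. $\mathcal{I}^{\pm}(\mathcal{X})$ is the union of the set of all nonzero idempotents and the set of all anti-idempotents in $\mathcal{B}(\mathcal{X})$. *)

(* Defs.v *)
From HB Require Import structures.
From mathcomp Require Import all_boot all_order all_algebra.
From mathcomp Require Import all_classical all_reals all_analysis.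
From mathcomp.real_closed Require Import complex.

Set Implicit Arguments.
Unset Strict Implicit.
Unset Printing Implicit Defensive.

Import Order.TTheory GRing.Theory Num.Theory.
Import numFieldNormedType.Exports.

Local Open Scope classical_set_scope.
Local Open Scope ring_scope.
Local Open Scope complex_scope.

Lemma ge0_complexE (R : realType) (z : R[i]) : 0 <= z -> (complex.Re z)%:C = z.
Proof. by case: z => a b; rewrite lecE /= => /andP[/eqP ->]. Qed.

Section real_norm.
Context {R : realType} {V : normedModType R[i]}.

(* The norm of V takes values in R[i]; rnorm is the same number in R. *)
Definition rnorm (x : V) : R := complex.Re `|x|.

Lemma rnormE (x : V) : (rnorm x)%:C = `|x|.
Proof. by rewrite /rnorm ge0_complexE ?normr_ge0. Qed.

Lemma rnorm_ge0 (x : V) : 0 <= rnorm x.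
Proof. by rewrite -lecR rnormE normr_ge0. Qed.

End real_norm.

(* Applied to linear and to conjugate-linear maps. *)
Definition bounded_operator {R : realType} {U V : normedModType R[i]}
    (T : U -> V) : Prop :=
  exists M : R[i], forall x, `|T x| <= M * `|x|.

Section bounded_op_def.
Context {R : realType} {U V : normedModType R[i]}.

Definition bounded_linear : {pred U -> V} :=
  [pred f : U -> V | `[< linear f /\ bounded_operator f >]].

Lemma bounded_linearP (f : U -> V) :
  reflect (linear f /\ bounded_operator f) (f \in bounded_linear).
Proof. exact: asboolP. Qed.

Lemma bounded_operator_pos (f : U -> V) : bounded_operator f ->
  exists2 M : R[i], 0 <= M & forall x, `|f x| <= M * `|x|.
Proof.
move=> [M fM]; have [M0|M0] := boolP (0 <= M); first by exists M.
exists 0 => // x; have := fM x; have [->|x0] := eqVneq x 0.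
  by rewrite normr0 !mulr0.
move=> h; have : 0 <= M * `|x| by apply: le_trans h.
by rewrite pmulr_lge0 ?normr_gt0// (negbTE M0).
Qed.

Lemma bounded_linear_submod : submod_closed bounded_linear.
Proof.
split.
  apply/bounded_linearP; split; first by move=> a x y /=; rewrite scaler0 addr0.
  by exists 0 => x; rewrite normr0 mul0r.
move=> a f g /bounded_linearP[lf bf] /bounded_linearP[lg bg].
have [M M0 fM] := bounded_operator_pos bf.
have [N N0 gN] := bounded_operator_pos bg.
apply/bounded_linearP; split.
  move=> b x y /=.
  have -> z : (a *: f + g) z = a *: f z + g z by [].
  rewrite lf lg !scalerDr !scalerA (mulrC b a) -!addrA; congr (_ + _).
  by rewrite addrCA.
exists (`|a| * M + N) => x.
have -> : (a *: f + g) x = a *: f x + g x by [].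
rewrite (le_trans (ler_normD _ _))// mulrDl lerD// normrZ -mulrA.
by rewrite ler_wpM2l.
Qed.

HB.instance Definition _ :=
  GRing.isSubmodClosed.Build R[i] (U -> V) bounded_linear bounded_linear_submod.

End bounded_op_def.

Record bounded_op {R : realType} (U V : normedModType R[i]) := BoundedOp {
  bounded_op_fun :> U -> V;
  bounded_op_subproof : bounded_op_fun \in bounded_linear
}.

Section bounded_op_lmod.
Context {R : realType} (U V : normedModType R[i]).

HB.instance Definition _ := [isSub for @bounded_op_fun R U V].
HB.instance Definition _ := [Choice of bounded_op U V by <:].
HB.instance Definition _ := [SubChoice_isSubLmodule of bounded_op U V by <:].

Lemma bounded_op_ext (f g : bounded_op U V) : (forall x, f x = g x) -> f = g.
Proof. by move=> fg; apply/val_inj/funext. Qed.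

Lemma bounded_op_linear (f : bounded_op U V) : linear f.
Proof. by have /bounded_linearP[] := bounded_op_subproof f. Qed.

HB.instance Definition _ (f : bounded_op U V) :=
  GRing.isLinear.Build R[i] U V *:%R f (bounded_op_linear f).

Lemma bounded_opP (f : bounded_op U V) : bounded_operator f.
Proof. by have /bounded_linearP[] := bounded_op_subproof f. Qed.

Lemma bounded_op0E x : (0 : bounded_op U V) x = 0. Proof. by []. Qed.
Lemma bounded_opDE (f g : bounded_op U V) x : (f + g) x = f x + g x.
Proof. by []. Qed.
Lemma bounded_opNE (f : bounded_op U V) x : (- f) x = - f x.
Proof. by []. Qed.
Lemma bounded_opZE a (f : bounded_op U V) x : (a *: f) x = a *: f x.
Proof. by []. Qed.

End bounded_op_lmod.

Section operator_norm.
Context {R : realType} (U V : normedModType R[i]).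
Implicit Types f g : bounded_op U V.

Definition opnorm f : R[i] :=
  (sup [set rnorm (f x) | x in [set x | `|x| <= 1]])%:C.

Lemma opnorm_has_sup f :
  has_sup [set rnorm (f x) | x in [set x | `|x| <= 1]].
Proof.
split; first by exists (rnorm (f 0)), 0 => //=; rewrite normr0.
have [M M0 fM] := bounded_operator_pos (bounded_opP f).
have rM : M = (complex.Re M)%:C by rewrite ge0_complexE.
exists (complex.Re M) => _ [x x1 <-].
by rewrite -lecR rnormE -rM (le_trans (fM x))// ler_piMr.
Qed.

Lemma opnorm_ge0 f : 0 <= opnorm f.
Proof.
rewrite /opnorm lecR.
have := sup_upper_bound (opnorm_has_sup f) => /(_ (rnorm (f 0))) h.
rewrite (le_trans (rnorm_ge0 (f 0)))//; apply: h.
by exists 0 => //=; rewrite normr0.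
Qed.

Lemma opnorm_bound f x : `|f x| <= opnorm f * `|x|.
Proof.
have [->|x0] := eqVneq x 0; first by rewrite linear0 !normr0 mulr0.
have n0 : 0 < `|x| by rewrite normr_gt0.
rewrite -ler_pdivrMr// mulrC.
have -> : `|x|^-1 * `|f x| = `|f (`|x|^-1 *: x)|.
  by rewrite linearZ normrZ ger0_norm// invr_ge0.
rewrite -rnormE /opnorm lecR.
apply: (sup_upper_bound (opnorm_has_sup f)); exists (`|x|^-1 *: x) => //=.
by rewrite normrZ ger0_norm ?invr_ge0// mulVf// gt_eqF.
Qed.

Lemma opnorm_le f M : 0 <= M -> (forall x, `|f x| <= M * `|x|) ->
  opnorm f <= M.
Proof.
move=> M0 fM.
have rM : M = (complex.Re M)%:C by rewrite ge0_complexE.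
rewrite /opnorm rM lecR; apply: ge_sup; first by have [] := opnorm_has_sup f.
move=> _ [x x1 <-].
by rewrite -lecR rnormE -rM (le_trans (fM x))// ler_piMr.
Qed.

Lemma opnormD f g : opnorm (f + g) <= opnorm f + opnorm g.
Proof.
apply: opnorm_le => [|x]; first by rewrite addr_ge0// opnorm_ge0.
by rewrite mulrDl bounded_opDE (le_trans (ler_normD _ _))// lerD// opnorm_bound.
Qed.

Lemma opnormZ_le a f : opnorm (a *: f) <= `|a| * opnorm f.
Proof.
apply: opnorm_le => [|x]; first by rewrite mulr_ge0// opnorm_ge0.
by rewrite bounded_opZE normrZ -mulrA ler_wpM2l// opnorm_bound.
Qed.

Lemma opnormZ a f : opnorm (a *: f) = `|a| * opnorm f.
Proof.
apply/eqP; rewrite eq_le opnormZ_le /=.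
have [->|a0] := eqVneq a 0; first by rewrite normr0 mul0r opnorm_ge0.
have := opnormZ_le a^-1 (a *: f).
by rewrite scalerA mulVf// scale1r normfV mulrC ler_pdivlMr ?normr_gt0// mulrC.
Qed.

Lemma opnorm_eq0 f : opnorm f = 0 -> f = 0.
Proof.
move=> f0; apply: bounded_op_ext => x; apply/eqP.
have := opnorm_bound f x.
by rewrite f0 mul0r normr_le0.
Qed.

HB.instance Definition _ := Lmodule_isNormed.Build R[i] (bounded_op U V)
  opnormD opnormZ opnorm_eq0.

Lemma opnormE f : `|f| = opnorm f. Proof. by []. Qed.

End operator_norm.

Section composition.
Context {R : realType} {U V W : normedModType R[i]}.

Lemma bounded_comp_subproof (f : bounded_op V W) (g : bounded_op U V) :
  (fun x => f (g x)) \in bounded_linear.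
Proof.
apply/bounded_linearP; split; first by move=> a x y; rewrite !linearP.
exists (opnorm f * opnorm g) => x.
rewrite (le_trans (opnorm_bound _ _))// -mulrA ler_wpM2l ?opnorm_ge0//.
exact: opnorm_bound.
Qed.

Definition bounded_comp (f : bounded_op V W) (g : bounded_op U V)
  : bounded_op U W := BoundedOp (bounded_comp_subproof f g).

End composition.

(* The product of B(X) is composition. It is only a pzRing since X may be 0. *)
Section algebra_of_operators.
Context {R : realType} (X : normedModType R[i]).

Lemma bounded_id_subproof : (@idfun X) \in bounded_linear.
Proof.
by apply/bounded_linearP; split=> //; exists 1 => x; rewrite mul1r.
Qed.

Definition bounded_id : bounded_op X X := BoundedOp bounded_id_subproof.

Let compA : associative (@bounded_comp R X X X).
Proof. by move=> f g h; apply: bounded_op_ext. Qed.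
Let comp1 : left_id bounded_id (@bounded_comp R X X X).
Proof. by move=> f; apply: bounded_op_ext. Qed.
Let compr1 : right_id bounded_id (@bounded_comp R X X X).
Proof. by move=> f; apply: bounded_op_ext. Qed.
Let compDl : left_distributive (@bounded_comp R X X X) +%R.
Proof. by move=> f g h; apply: bounded_op_ext. Qed.
Let compDr : right_distributive (@bounded_comp R X X X) +%R.
Proof.
by move=> f g h; apply: bounded_op_ext => x; exact: (linearD f (g x) (h x)).
Qed.

HB.instance Definition _ := GRing.Zmodule_isPzRing.Build (bounded_op X X)
  compA comp1 compr1 compDl compDr.

Lemma bounded_opME (f g : bounded_op X X) x : (f * g) x = f (g x).
Proof. by []. Qed.

End algebra_of_operators.

Notation "''B' ( X )" := (bounded_op X X) (format "''B' ( X )") : type_scope.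

Section operator_sets.
Context {R : realType} {X : normedModType R[i]}.
Implicit Types A B P : 'B(X).

Definition jordan A B : 'B(X) := (2%:R : R[i])^-1 *: (A * B + B * A).

Definition idempotents : set 'B(X) := [set P | P * P = P].

Definition anti_idempotents : set 'B(X) := [set P | P * P = - P /\ P != 0].

Definition pm_idempotents : set 'B(X) :=
  [set P | idempotents P /\ P != 0] `|` anti_idempotents.

End operator_sets.

Section duality.
Context {R : realType}.
Implicit Types X : normedModType R[i].

Definition topdual X : normedModType R[i] := bounded_op X R[i]^o.

Lemma adjoint_subproof X (A : 'B(X)) :
  (fun f : topdual X => bounded_comp f A : topdual X) \in bounded_linear.
Proof.
apply/bounded_linearP; split; first by move=> a f g; apply: bounded_op_ext.
exists (opnorm A) => f; rewrite !opnormE; apply: opnorm_le => [|x].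
  by rewrite mulr_ge0// opnorm_ge0.
rewrite (le_trans (opnorm_bound f (A x)))// (mulrC (opnorm A)) -mulrA.
by rewrite ler_wpM2l ?opnorm_ge0// opnorm_bound.
Qed.

Definition adjoint X (A : 'B(X)) : 'B(topdual X) := BoundedOp (adjoint_subproof A).

Lemma evaluation_subproof X (x : X) :
  (fun f : topdual X => (f : bounded_op X R[i]^o) x) \in bounded_linear.
Proof.
apply/bounded_linearP; split; first by [].
by exists `|x| => f; rewrite mulrC; apply: opnorm_bound.
Qed.

Definition evaluation X (x : X) : topdual (topdual X) :=
  BoundedOp (evaluation_subproof x).

Definition reflexive_space X : Prop :=
  forall F : topdual (topdual X), exists x : X, evaluation x = F.

End duality.

Definition infinite_dimensional {K : pzRingType} (X : lmodType K) : Prop :=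
  ~ exists (n : nat) (v : 'I_n -> X),
      forall x, exists c : 'I_n -> K, x = \sum_(i < n) c i *: v i.

Section invertible_operators.
Context {R : realType} {U V : normedModType R[i]}.

Definition conj_linear (T : U -> V) : Prop :=
  forall (a : R[i]) x y, T (a *: x + y) = Num.conj a *: T x + T y.

(* Tinv is named so that T^-1 can be applied; it is determined by T. *)
Definition bounded_invertible (T : U -> V) (Tinv : V -> U) : Prop :=
  [/\ linear T \/ conj_linear T,
      bounded_operator T,
      cancel T Tinv,
      cancel Tinv T &
      bounded_operator Tinv].

End invertible_operators.

(* Main.v *)
(* Write A ~ B when A o B is idempotent. The operators 1 and -1 are the only J
   with J ~ J such that J ~ B implies B ~ B, so phi maps {1, -1} onto itself, and
   up to a sign phi fixes 1 and -1; then phi preserves idempotents both ways.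
   For idempotents P and S, PS = SP = 0 iff P ~ -S; hence phi preserves
   orthogonality, rank one idempotents, and the relation "same range or same
   kernel" between these. Globally it either preserves or exchanges the two
   halves of this relation, so it induces a collineation from the lines of X, or
   from those of X', to the lines of X, which the fundamental theorem of
   projective geometry lifts to a semilinear bijection T. A convergent series in
   X shows that the field automorphism is bounded, hence the identity or the
   conjugation, and uniform boundedness shows that T and its inverse are bounded.
   It remains to see that a map Phi preserving ~ both ways and fixing all P and
   -P, P a rank one idempotent, is the identity. Such a Phi fixes all rank one
   operators and all M with M (M - r1) (M - r2) = 0, where r1, r2 and 0 are
   distinct, so A and B = Phi A are related by ~ to the same operators of these
   two kinds. If z, Az, ..., A^4 z are independent for some z, this gives A = B
   using rank one operators only. Otherwise A is algebraic by a theorem of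
   Kaplansky, and A and B are compared on the Jordan chains of A. *)

(* Neither injectivity nor surjectivity of [phi] is given, and the orthogonality test P ~ -S
   involves [phi (- S)], which is not known to be [- phi S]. So [phi] is studied together with its
   twist S |-> - phi (- S), and the two are shown to agree on rank one idempotents. In the final
   comparison a nilpotent rank one tester built on x determines B x only modulo x and A^2 x. Two
   overlapping windows of four vectors of an orbit remove this ambiguity, whence the five
   independent vectors. Short orbits do not; on a Jordan chain of length two with nonzero
   eigenvalue, A x even lies in the span of x and A^2 x. Testers of higher rank are therefore
   needed. Those with spectrum in {0, r1, r2} are available because their eigenvectors, hence the
   operators themselves, are recovered from rank one tests. The two conclusions differ only in which
   of X and X' carries the lines, so the projective geometry and the continuity argument are done
   for an abstract pairing of W with W'. *)
Require Import Defs.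
From HB Require Import structures.
From mathcomp Require Import all_boot all_order all_algebra.
From mathcomp Require Import all_classical all_reals all_analysis.
From mathcomp.real_closed Require Import complex.
From mathcomp Require Import ring lra.

Set Implicit Arguments.
Unset Strict Implicit.
Unset Printing Implicit Defensive.

Import Order.TTheory GRing.Theory Num.Theory.
Import numFieldNormedType.Exports.

Local Open Scope classical_set_scope.
Local Open Scope ring_scope.

Local Open Scope complex_scope.

(** * Hahn-Banach theorem *)

Section real_hahn_banach.
Variables (R : realType) (X : normedModType R[i]).
Implicit Types (x y : X) (t : R).

Lemma normcR t : `|t%:C| = `|t|%:C :> R[i].
Proof. by rewrite normc_def /= expr0n /= addr0 sqrtr_sqr. Qed.

Lemma rnormD x y : rnorm (x + y) <= rnorm x + rnorm y.
Proof. by rewrite -lecR rmorphD /= !rnormE ler_normD. Qed.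

Lemma rnormZr t x : rnorm (t%:C *: x) = `|t| * rnorm x.
Proof.
by apply: complexI; rewrite rmorphM /= -normcR !rnormE normrZ.
Qed.

Lemma rnormN x : rnorm (- x) = rnorm x.
Proof. by rewrite /rnorm normrN. Qed.

Lemma rnorm0 : rnorm (0 : X) = 0.
Proof. by rewrite /rnorm normr0. Qed.

Lemma rnorm_eq0 x : rnorm x = 0 -> x = 0.
Proof. by move=> h; apply: normr0_eq0; rewrite -rnormE h. Qed.

Lemma rnorm_gt0 x : x != 0 -> 0 < rnorm x.
Proof.
move=> x0; rewrite lt0r rnorm_ge0 andbT; apply: contra_neq x0.
exact: rnorm_eq0.
Qed.

(* Partially defined real-linear functionals are represented by their graphs. *)
Definition dominated_graph (G : set (X * R)) : Prop :=
  [/\ forall p q, G p -> G q -> G (p.1 + q.1, p.2 + q.2),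
      forall t p, G p -> G (t%:C *: p.1, t * p.2) &
      forall p, G p -> p.2 <= rnorm p.1].

(** Two points of the union lie in a common member of the chain. Joining [G0] to every member makes
    the maximal graph extend [G0], the empty chain included. *)
Lemma dominated_graph_bigcup (F : set (set (X * R))) (G0 : set (X * R)) :
  dominated_graph G0 ->
  F `<=` [set A | dominated_graph (G0 `|` A)] -> total_on F subset ->
  dominated_graph (G0 `|` \bigcup_(A in F) A).
Proof.
move=> G0d Fd Ftot.
have common p q : (G0 `|` \bigcup_(A in F) A) p ->
    (G0 `|` \bigcup_(A in F) A) q ->
    exists A, [/\ dominated_graph (G0 `|` A), (G0 `|` A) p, (G0 `|` A) q &
      G0 `|` A `<=` G0 `|` \bigcup_(A in F) A].
  have sub A : F A -> G0 `|` A `<=` G0 `|` \bigcup_(A in F) A.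
    by move=> FA z [|Az]; [left|right; exists A].
  move=> [p0|[A FA Ap]] [q0|[B FB Bq]].
  - by exists set0; split=> [|||z [|//]]; rewrite ?setU0//; left.
  - by exists B; split; [exact: Fd|left|right|exact: sub].
  - by exists A; split; [exact: Fd|right|left|exact: sub].
  - have [AB|BA] := Ftot _ _ FA FB.
    + by exists B; split; [exact: Fd|right; apply: AB|right|exact: sub].
    + by exists A; split; [exact: Fd|right|right; apply: BA|exact: sub].
split=> [p q Gp Gq|t p Gp|p Gp].
- by have [A [[dA _ _] Ap Aq sA]] := common _ _ Gp Gq; apply/sA/dA.
- by have [A [[_ dA _] Ap _ sA]] := common _ _ Gp Gp; apply/sA/dA.
- by have [A [[_ _ dA] Ap _ _]] := common _ _ Gp Gp; apply: dA.
Qed.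

(** A value [c] at [y] is admissible when p.2 - |p.1 - y| <= c <= |q.1 + y| - q.2 for all points p,
    q of [G]. The triangle inequality leaves room between the two sides, and homogeneity reduces any
    nonzero [t] to 1 or -1. *)
Lemma dominated_graph_extend (G : set (X * R)) y : dominated_graph G -> G (0, 0) ->
  exists c, dominated_graph
    [set p | exists q t, G q /\ p = (q.1 + t%:C *: y, q.2 + t * c)].
Proof.
move=> [GD GZ Gle] G0.
pose E := [set p.2 - rnorm (p.1 - y) | p in G].
have Eub p : G p -> ubound E (rnorm (p.1 + y) - p.2).
  move=> Gp _ [q Gq <-]; rewrite lerBrDr addrAC lerBlDr.
  have := Gle _ (GD _ _ Gp Gq) => /=; rewrite addrC => /le_trans; apply.
  by have -> : p.1 + q.1 = (p.1 + y) + (q.1 - y); [rewrite addrACA subrr addr0|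
    exact: rnormD].
have E0 : E !=set0 by exists (0 - rnorm (0 - y)), (0, 0).
have hE : has_sup E by split => //; exists (rnorm (0 + y) - 0); exact: (Eub _ G0).
exists (sup E); split.
- move=> _ _ [p [s [Gp ->]]] [q [t [Gq ->]]] /=.
  exists (p.1 + q.1, p.2 + q.2), (s + t); split; first exact: GD.
  by rewrite rmorphD /= scalerDl mulrDl addrACA (addrACA p.2).
- move=> s _ [p [t [Gp ->]]]; exists (s%:C *: p.1, s * p.2), (s * t).
  split; first exact: GZ.
  by rewrite /= rmorphM /= scalerDr scalerA mulrDr mulrA.
move=> _ [p [t [Gp ->]]] /=.
have [t0|t0|->] := ltgtP t 0; last by rewrite mul0r scale0r !addr0; exact: Gle.
- have h : E ((- t)^-1 * p.2 - rnorm ((- t^-1)%:C *: p.1 - y)).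
    exists ((- t^-1)%:C *: p.1, - t^-1 * p.2) => /=; first exact: GZ.
    by rewrite invrN.
  have /= := sup_upper_bound hE h.
  have -> : (- t^-1)%:C *: p.1 - y = (- t^-1)%:C *: (p.1 + t%:C *: y).
    rewrite scalerDr scalerA -rmorphM /= mulNr mulVf ?lt_eqF// rmorphN1.
    by rewrite scaleN1r.
  rewrite rnormZr gtr0_norm ?oppr_gt0 ?invr_lt0// invrN -mulrBr.
  rewrite mulNr -mulrN mulrC ler_ndivrMr// mulrC => h2.
  by move: h2; lra.
- have := ge_sup E0 (Eub _ (GZ t^-1 _ Gp)) => /=.
  have -> : (t^-1)%:C *: p.1 + y = (t^-1)%:C *: (p.1 + t%:C *: y).
    by rewrite scalerDr scalerA -rmorphM /= mulVf ?gt_eqF// rmorph1 scale1r.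
  rewrite rnormZr gtr0_norm ?invr_gt0// -mulrBr mulrC ler_pdivlMr// mulrC => h2.
  by move: h2; lra.
Qed.

Lemma real_hahn_banach x0 : exists u : X -> R,
  [/\ forall x y, u (x + y) = u x + u y, forall t x, u (t%:C *: x) = t * u x,
      forall x, u x <= rnorm x & u x0 = rnorm x0].
Proof.
pose G0 : set (X * R) := [set p | exists t, p = (t%:C *: x0, t * rnorm x0)].
have G0d : dominated_graph G0.
  split=> [_ _ [s ->] [t ->]|s _ [t ->]|_ [t ->]] /=.
  - by exists (s + t); rewrite rmorphD /= scalerDl mulrDl.
  - by exists (s * t); rewrite rmorphM /= scalerA mulrA.
  - by rewrite rnormZr ler_wpM2r ?rnorm_ge0// ler_norm.
have [A [Ad Amax]] :=
  Zorn_bigcup (fun F => @dominated_graph_bigcup F _ G0d).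
set G := G0 `|` A in Ad.
have G00 : G (0, 0) by left; exists 0; rewrite scale0r mul0r.
have [GD GZ Gle] := Ad.
have Gtot y : exists r, G (y, r).
  have [c cd] := dominated_graph_extend y Ad G00.
  set G' := (X in dominated_graph X) in cd.
  have GG' : G `<=` G'.
    by move=> p Gp; exists p, 0; rewrite scale0r mul0r !addr0; case: p Gp.
  have G'y : G' (y, c) by exists (0, 0), 1; rewrite rmorph1 scale1r mul1r !add0r.
  exists c; apply: contrapT => nG.
  apply: (Amax G').
    split; first by move=> p Ap; apply: GG'; right.
    by move=> /(_ _ G'y) Ay; apply: nG; right.
  suff : G0 `|` G' = G' by rewrite /= => ->.
  by apply/seteqP; split=> [p [G0p|//]|p]; [apply: GG'; left|right].
have Guniq y r s : G (y, r) -> G (y, s) -> r <= s.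
  move=> Gr Gs; have := GD _ _ Gr (GZ (-1) _ Gs) => /Gle /=.
  by rewrite rmorphN1 scaleN1r subrr rnorm0 mulN1r subr_le0.
pose u y := projT1 (cid (Gtot y)).
have uG y : G (y, u y) by rewrite /u; case: cid.
have uE y r : G (y, r) -> u y = r.
  by move=> Gr; apply/eqP; rewrite eq_le (Guniq _ _ _ (uG y) Gr) (Guniq _ _ _ Gr).
exists u; split=> [x y|t x|x|].
- by apply: uE; exact: (GD _ _ (uG x) (uG y)).
- by apply: uE; exact: (GZ t _ (uG x)).
- exact: (Gle _ (uG x)).
- by apply: uE; left; exists 1; rewrite rmorph1 scale1r mul1r.
Qed.

End real_hahn_banach.

(** * Finite spans and separation by a pairing *)

Section span.
Variables (K : fieldType) (V : lmodType K).

(** Removing one generator at a time suits the inductions on [s], which correct a single vector at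
    each step. *)
Fixpoint in_span (s : seq V) (x : V) : Prop :=
  if s is y :: s' then exists c, in_span s' (x - c *: y) else x = 0.

Lemma in_spanS s x y : in_span s x -> in_span (y :: s) x.
Proof. by exists 0; rewrite scale0r subr0. Qed.

Lemma in_span1P y x : in_span [:: y] x <-> exists c, x = c *: y.
Proof.
split=> [[c /= /eqP]|[c ->]]; first by rewrite subr_eq0 => /eqP ->; exists c.
by exists c; rewrite subrr.
Qed.

Lemma in_span2P y z x : in_span [:: y; z] x <-> exists c d, x = c *: y + d *: z.
Proof.
split=> [[c /in_span1P [d h]]|[c [d ->]]].
  by exists c, d; rewrite -h addrC subrK.
by exists c; apply/in_span1P; exists d; rewrite addrC addKr.
Qed.

Lemma in_span_sum s x : in_span s x ->
  exists c : 'I_(size s) -> K, x = \sum_(i < size s) c i *: tnth (in_tuple s) i.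
Proof.
elim: s x => [x ->|y s ih x [c /ih [d hd]]].
  by exists (fun=> 0); rewrite big_ord0.
exists (fun i => if unlift ord0 i is Some j then d j else c).
rewrite big_ord_recl unlift_none /= -[LHS](subrK (c *: y)) hd addrC.
congr (_ + _); apply: eq_bigr => i _; rewrite liftK; congr (_ *: _).
by rewrite !(tnth_nth 0).
Qed.

Lemma scale_eq_opp (c d : K) (u v : V) : c != 0 -> c *: u + d *: v = 0 ->
  u = (- c^-1 * d) *: v.
Proof.
move=> c0 /eqP; rewrite addr_eq0 => /eqP e; apply: (scalerI c0).
by rewrite e scalerA mulrA mulrN divff// mulN1r scaleNr.
Qed.

Lemma scaler_injl (v : V) (a b : K) : v != 0 -> a *: v = b *: v -> a = b.
Proof.
move=> v0 /eqP; rewrite -subr_eq0 -scalerBl scaler_eq0 (negbTE v0) orbF subr_eq0.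
by move/eqP.
Qed.

Definition unspanned : Prop := forall s, exists x, ~ in_span s x.

End span.

Arguments unspanned {K} V.

Lemma infinite_dimensionalP (K : fieldType) (V : lmodType K) :
  infinite_dimensional V -> unspanned V.
Proof.
move=> Vinf s; apply: contrapT => h; apply: Vinf.
exists (size s), (tnth (in_tuple s)) => x; apply: in_span_sum.
by apply: contrapT => nx; apply: h; exists x.
Qed.

Section pairing.
Variables (K : fieldType) (U V : lmodType K) (b : U -> V -> K).
Hypothesis bl : forall a u u' v, b (a *: u + u') v = a * b u v + b u' v.
Hypothesis br : forall a u v v', b u (a *: v + v') = a * b u v + b u v'.
Implicit Types (u w : U) (v : V) (c : K).

Lemma pair0l v : b 0 v = 0.
Proof.
have := bl 1 0 0 v; rewrite scaler0 addr0 mul1r => /eqP.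
by rewrite -subr_eq subrr eq_sym => /eqP.
Qed.

Lemma pair0r u : b u 0 = 0.
Proof.
have := br 1 u 0 0; rewrite scaler0 addr0 mul1r => /eqP.
by rewrite -subr_eq subrr eq_sym => /eqP.
Qed.

Lemma pairD u u' v : b (u + u') v = b u v + b u' v.
Proof. by have := bl 1 u u' v; rewrite scale1r mul1r. Qed.

Lemma pairZ c u v : b (c *: u) v = c * b u v.
Proof. by have := bl c u 0 v; rewrite pair0l !addr0. Qed.

Lemma pairN u v : b (- u) v = - b u v.
Proof. by rewrite -scaleN1r pairZ mulN1r. Qed.

Lemma pairZr c u v : b u (c *: v) = c * b u v.
Proof. by have := br c u v 0; rewrite pair0r !addr0. Qed.

Definition pairE := (pairD, pairN, pairZ, pair0l).

Lemma pair_neq0l w v : b w v != 0 -> w != 0.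
Proof. by apply: contra_neq => ->; rewrite pair0l. Qed.

Lemma pair_neq0r w v : b w v != 0 -> v != 0.
Proof. by apply: contra_neq => ->; rewrite pair0r. Qed.

Lemma pair_in_span s u v : (forall w, w \in s -> b w v = 0) -> in_span s u -> b u v = 0.
Proof.
elim: s u => [u _ ->|w s ih u h [c /ih]]; first exact: pair0l.
rewrite !pairE (h w) ?mem_head// mulr0 subr0; apply=> w' ws.
by apply: h; rewrite inE ws orbT.
Qed.

Hypothesis bnd : forall u, u != 0 -> exists v, b u v != 0.

(** Purely algebraic, so it serves X with X' and X' with X alike. If [y] is outside the span of [s],
    take [g] dual to [y] and zero on [s], separate x - (b x g) y from [s] by [h], and correct [h] by
    a multiple of [g] so that it vanishes at [y]. *)
Lemma pairing_separation s x : ~ in_span s x ->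
  exists v, b x v = 1 /\ forall y, y \in s -> b y v = 0.
Proof.
elim: s x => [x /= /eqP /bnd [v bv]|y s ih x nx].
  by exists ((b x v)^-1 *: v); rewrite pairZr mulVf.
have [ys|/ih [g [gy gs]]] := pselect (in_span s y).
  have /ih [v [xv sv]] : ~ in_span s x by move=> /in_spanS h; exact: nx.
  exists v; split=> // z; rewrite inE => /orP[/eqP -> {z}|]; last exact: sv.
  exact: pair_in_span ys.
have /ih [h [hx hs]] : ~ in_span s (x - b x g *: y).
  by move=> h; apply: nx; exists (b x g).
exists (- b y h *: g + h); split.
  by rewrite br; move: hx; rewrite !pairE => <-; ring.
move=> z; rewrite inE br => /orP[/eqP ->|zs]; first by rewrite gy; ring.
by rewrite (gs z)// (hs z)//; ring.
Qed.

End pairing.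

(** * The dual space and rank one operators *)

Section dual.
Variables (R : realType) (X : normedModType R[i]).
Implicit Types (x y z : X) (f g : topdual X) (A B : 'B(X)).

Definition ev f x : R[i] := f x.
Arguments ev : simpl never.

Lemma evD f x y : ev f (x + y) = ev f x + ev f y.
Proof. exact: (linearD (f : bounded_op X R[i]^o)). Qed.
Lemma evN f x : ev f (- x) = - ev f x.
Proof. exact: (linearN (f : bounded_op X R[i]^o)). Qed.
Lemma evZ f a x : ev f (a *: x) = a * ev f x.
Proof. exact: (linearZZ (f : bounded_op X R[i]^o)). Qed.
Lemma ev0 f : ev f 0 = 0.
Proof. exact: (linear0 (f : bounded_op X R[i]^o)). Qed.
Lemma evDl f g x : ev (f + g) x = ev f x + ev g x. Proof. by []. Qed.
Lemma evNl f x : ev (- f) x = - ev f x. Proof. by []. Qed.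
Lemma evZl f a x : ev (a *: f) x = a * ev f x. Proof. by []. Qed.
Lemma ev0l x : ev 0 x = 0. Proof. by []. Qed.
Lemma ev_adj A f x : ev (adjoint A f) x = ev f (A x). Proof. by []. Qed.

Definition evE := (evD, evN, evZ, ev0, evDl, evNl, evZl, ev0l, ev_adj).

Lemma dual_ext f g : (forall x, ev f x = ev g x) -> f = g.
Proof. by move=> h; apply: bounded_op_ext. Qed.

Lemma ev_bound f x : `|ev f x| <= `|f| * `|x|.
Proof. exact: (opnorm_bound (f : bounded_op X R[i]^o)). Qed.

Lemma dual_norm_le f (M : R[i]) :
  0 <= M -> (forall x, `|ev f x| <= M * `|x|) -> `|f| <= M.
Proof. exact: (@opnorm_le _ _ _ (f : bounded_op X R[i]^o)). Qed.

Lemma dual_of (g : X -> R[i]) (M : R[i]) :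
  (forall a x y, g (a *: x + y) = a * g x + g y) ->
  (forall x, `|g x| <= M * `|x|) -> exists f, forall x, ev f x = g x.
Proof.
move=> gl gM; have gP : (g : X -> R[i]^o) \in bounded_linear.
  by apply/bounded_linearP; split; [exact: gl|exists M].
by exists (BoundedOp gP).
Qed.

(** Complexification of a real functional [u]: g x = u x - i u (i x). Its modulus is bounded by
    rotating [x] until [g x] is nonnegative, where [g] equals [u]. *)
Lemma hahn_banach x0 : exists f,
  (forall x, `|ev f x| <= `|x|) /\ ev f x0 = `|x0|.
Proof.
have [u [uD uZ ule ux0]] := real_hahn_banach x0.
pose g x : R[i] := (u x) +i* (- u ('i%C *: x)).
have gE x : g x = (u x)%:C - 'i%C * (u ('i%C *: x))%:C.
  by rewrite /g [LHS]complexE /= rmorphN mulrN.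
have gl a x y : g (a *: x + y) = a * g x + g y.
  have uC (c : R[i]) z :
      u (c *: z) = complex.Re c * u z + complex.Im c * u ('i%C *: z).
    by rewrite {1}[c]complexE scalerDl uD uZ (mulrC 'i%C) -scalerA uZ.
  rewrite /g uD (uC a x) scalerDr uD scalerA (uC ('i%C * a) x).
  by case: a => a b; apply/eqP; rewrite eq_complex /=; apply/andP; split; apply/eqP; ring.
have gle x : `|g x| <= `|x|.
  have [->|gx0] := eqVneq (g x) 0; first by rewrite normr0.
  have n0 : `|g x| != 0 by rewrite normr_eq0.
  pose w := `|g x| / g x.
  have w1 : `|w| = 1 by rewrite normrM normfV normr_id divff.
  have gw : g (w *: x) = `|g x|.
    have g0 : g 0 = 0.
      have := gl 1 0 0; rewrite scaler0 addr0 mul1r => /eqP.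
      by rewrite -subr_eq subrr eq_sym => /eqP.
    by rewrite -[w *: x]addr0 gl g0 addr0 divfK.
  have -> : `|x| = `|w *: x| by rewrite normrZ w1 mul1r.
  rewrite -gw -rnormE.
  have -> : g (w *: x) = (u (w *: x))%:C.
    have := ge0_complexE (normr_ge0 (g x)); rewrite -gw => <-.
    by rewrite gE /= mul0r mul1r subr0; congr (_%:C); rewrite oppr0 addr0.
  by rewrite lecR ule.
have gle1 x : `|g x| <= 1 * `|x| by rewrite mul1r.
have [f fE] := dual_of gl gle1.
exists f; split=> [x|]; first by rewrite fE.
(* The real part of [g x0] is already the norm of [x0], so the bound on the modulus leaves no room
   for an imaginary part. *)
rewrite fE; have := gle x0; rewrite -rnormE /g ux0.
set t := - u _ => h.
suff -> : t = 0 by [].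
move: h; rewrite normc_def /= lecR => h.
have h0 := rnorm_ge0 x0.
have : Num.sqrt (rnorm x0 ^+ 2 + t ^+ 2) ^+ 2 <= rnorm x0 ^+ 2.
  by rewrite lerXn2r ?nnegrE ?sqrtr_ge0.
rewrite sqr_sqrtr ?addr_ge0 ?sqr_ge0//.
rewrite gerDl => t2; apply/eqP; rewrite -sqrf_eq0 eq_le t2 sqr_ge0//.
Qed.

Lemma ev_neq0 x : x != 0 -> exists f, ev f x != 0.
Proof.
by move=> x0; have [f [_ fx]] := hahn_banach x; exists f; rewrite fx normr_eq0.
Qed.

Lemma ev_inj x y : (forall f, ev f x = ev f y) -> x = y.
Proof.
move=> h; apply/eqP; rewrite -subr_eq0; apply: contraT => /ev_neq0 [f].
by rewrite evD evN h subrr eqxx.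
Qed.

Lemma dual_neq0 f : f != 0 -> exists x, ev f x != 0.
Proof.
move=> f0; apply: contrapT => h; move/eqP: f0; apply; apply: dual_ext => x.
by apply/eqP; apply: contraT => fx; case: h; exists x.
Qed.

Lemma dual_separation (s : seq X) x : ~ in_span s x ->
  exists f, ev f x = 1 /\ forall y, y \in s -> ev f y = 0.
Proof.
apply: (@pairing_separation _ X (topdual X) (fun x f => ev f x)) => //=.
- by move=> a u v f; rewrite !evE.
- exact: ev_neq0.
Qed.

Lemma predual_separation (s : seq (topdual X)) f : ~ in_span s f ->
  exists x, ev f x = 1 /\ forall g, g \in s -> ev g x = 0.
Proof.
apply: (@pairing_separation _ (topdual X) X (fun f x => ev f x)) => //=.
- by move=> a u v v'; rewrite !evE.
- exact: dual_neq0.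
Qed.

Lemma dual_separation0 x : x != 0 -> exists f, ev f x = 1.
Proof.
by move=> x0; have [|f [fx _]] := @dual_separation [::] x; [exact/eqP|exists f].
Qed.

Lemma dual_separation1 x y : ~ (exists c, x = c *: y) ->
  exists f, ev f x = 1 /\ ev f y = 0.
Proof.
move=> h; have [|f [fx fs]] := @dual_separation [:: y] x; first by move/in_span1P.
by exists f; split=> //; apply: fs; rewrite mem_head.
Qed.

Lemma dual_separation2 x y z : ~ in_span [:: y; z] x ->
  exists f, [/\ ev f x = 1, ev f y = 0 & ev f z = 0].
Proof.
move=> h; have [f [fx fs]] := dual_separation h.
by exists f; split=> //; apply: fs; rewrite !inE eqxx ?orbT.
Qed.

Lemma opD A x y : A (x + y) = A x + A y. Proof. exact: linearD. Qed.
Lemma opN A x : A (- x) = - A x. Proof. exact: linearN. Qed.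
Lemma opZ A a x : A (a *: x) = a *: A x. Proof. exact: linearZ. Qed.
Lemma op0 A : A 0 = 0. Proof. exact: linear0. Qed.
Lemma op1E x : (1 : 'B(X)) x = x. Proof. by []. Qed.

Definition opE := (opD, opN, opZ, op0, op1E, @bounded_opME R X, @bounded_opDE R X X,
  @bounded_opNE R X X, @bounded_opZE R X X, @bounded_op0E R X X).

Lemma rank1_subproof x f : (fun z => ev f z *: x) \in bounded_linear.
Proof.
apply/bounded_linearP; split; first by move=> a y z; rewrite !evE scalerDl scalerA.
exists (`|f| * `|x|) => z; rewrite normrZ mulrAC ler_wpM2r// ev_bound//.
Qed.

Definition rank1 x f : 'B(X) := BoundedOp (rank1_subproof x f).

Lemma rank1E x f z : rank1 x f z = ev f z *: x. Proof. by []. Qed.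

Lemma idempotentsE A : idempotents A <-> forall x, A (A x) = A x.
Proof.
split=> [h x|h]; last by apply: bounded_op_ext.
by have := congr1 (fun B : 'B(X) => B x) h.
Qed.

End dual.

(** Lets [ring] finish a goal that follows linearly from one hypothesis. *)
Lemma eq_of_sub (V : zmodType) (a b c d : V) : c = d -> a - b = c - d -> a = b.
Proof. by move=> -> /eqP; rewrite subrr subr_eq0 => /eqP. Qed.

(* Vector identities are reduced to scalar ones by applying all functionals. *)
Ltac pairing_ring := apply: ev_inj => ?; rewrite !evE; ring.
Ltac pairing_field := apply: ev_inj => ?; rewrite !evE; field.
Ltac pairing_linear e := let k := fresh "k" in let h := fresh "h" in
  apply: ev_inj => k; have h := congr1 (ev k) e; rewrite !evE in h *;
  apply: (eq_of_sub h); ring.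

(** * Jordan products with rank one operators *)

Section jordan_rank1.
Variables (R : realType) (X : normedModType R[i]).
Implicit Types (x y z : X) (f g : topdual X) (A B M : 'B(X)).

Definition sim A B : Prop := idempotents (jordan A B).

Lemma two_neq0 : (2 : R[i]) != 0. Proof. by rewrite pnatr_eq0. Qed.

(** Twice the Jordan product, so that idempotency reads J^2 = 2 J without denominators. *)
Definition jd A B z : X := A (B z) + B (A z).

Lemma simP A B : sim A B <-> forall z, jd A B (jd A B z) = 2 *: jd A B z.
Proof.
have E z : jordan A B z = 2^-1 *: jd A B z by [].
have jZ c z : jd A B (c *: z) = c *: jd A B z by rewrite /jd !opE scalerDr.
rewrite /sim idempotentsE; split=> h z; last first.
  by rewrite !E jZ h !scalerA; congr (_ *: _); field.
have := h z; rewrite !E jZ => /(congr1 (fun v => 4 *: v)); rewrite !scalerA.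
have -> : 4 / 2 / 2 = 1 :> R[i] by field.
by have -> : 4 / 2 = 2 :> R[i]; [field|rewrite scale1r].
Qed.

Lemma jd_rank1 A x f z :
  jd A (rank1 x f) z = ev f z *: A x + ev f (A z) *: x.
Proof. by rewrite /jd !rank1E opE. Qed.

Lemma simC A B : sim A B <-> sim B A.
Proof. by rewrite /sim /jordan addrC. Qed.

Lemma simZ a A B : sim (a *: A) B <-> sim A (a *: B).
Proof.
rewrite !simP; have E z : jd (a *: A) B z = jd A (a *: B) z by rewrite /jd !opE.
by split=> h z; have := h z; rewrite !E.
Qed.

Lemma sim_rank1P A x f : sim A (rank1 x f) <-> forall z,
  ((ev f (A x) - 2) * ev f z + ev f x * ev f (A z)) *: A x +
  (ev f (A (A x)) * ev f z + (ev f (A x) - 2) * ev f (A z)) *: x = 0.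
Proof.
rewrite simP; split=> h z; have := h z; rewrite !jd_rank1 !(opE, evE) => /eqP.
  rewrite -subr_eq0 => /eqP <-; pairing_ring.
move/eqP => e; apply/eqP; rewrite -subr_eq0 -e.
by apply/eqP; pairing_ring.
Qed.

(** Put a = f x. If f (A x) = 1, the expanded identity factors as (a f (A z) - f z) (a A x - x) = 0.
    Otherwise its value at z = x gives A x = l x, then f o A = -l f, and evaluating this at x gives
    l = 0. *)
Lemma sim_rank1 A x f : ev f x != 0 -> sim A (rank1 x f) ->
  [\/ ev f x *: A x = x, forall z, ev f x * ev f (A z) = ev f z |
      A x = 0 /\ forall z, ev f (A z) = 0].
Proof.
move=> a0 /sim_rank1P h.
have x0 : x != 0 by apply: contra_neq a0 => ->; rewrite ev0.
have [u1|u1] := eqVneq (ev f (A x)) 1; last first.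
  have [l Ax] : exists l, A x = l *: x.
    eexists; apply: (scale_eq_opp _ (h x)).
    rewrite (_ : _ + _ = 2 * ev f x * (ev f (A x) - 1)); last by ring.
    by rewrite !mulf_neq0 ?two_neq0 ?subr_eq0.
  have l1 : ev f x * l - 1 != 0.
    by move: u1; rewrite Ax evZ mulrC subr_eq0.
  have fA z : ev f (A z) = - l * ev f z.
    have := h z; rewrite !(Ax, opE, evE) scalerA -scalerDl => /eqP.
    rewrite scaler_eq0 (negbTE x0) orbF => /eqP e.
    apply/eqP; rewrite -subr_eq0.
    have : 2 * (ev f x * l - 1) * (ev f (A z) - - l * ev f z) = 0.
      by rewrite -e; ring.
    by move/eqP; rewrite !mulf_eq0 (negbTE two_neq0) (negbTE l1).
  have l0 : l = 0.
    have := fA x; rewrite Ax evZ => /eqP; rewrite -subr_eq0 mulNr opprK.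
    have -> : l * ev f x + l * ev f x = 2 * l * ev f x by ring.
    by rewrite !mulf_eq0 (negbTE two_neq0) (negbTE a0) orbF => /eqP.
  by apply: Or33; rewrite Ax l0 scale0r; split=> // z; rewrite fA l0 oppr0 mul0r.
have wa : ev f x * ev f (A (A x)) = 1.
  have := h x; rewrite u1 => /(congr1 (ev f)); rewrite !evE u1 => e.
  have : ev f x * (ev f x * ev f (A (A x)) - 1) = 0 by rewrite -e; ring.
  by move/eqP; rewrite mulf_eq0 (negbTE a0) subr_eq0 => /eqP.
have [e|ne] := eqVneq (ev f x *: A x) x; first exact: Or31.
apply: Or32 => z; apply/eqP; rewrite -subr_eq0.
have : (ev f x * ev f (A z) - ev f z) *: (ev f x *: A x - x) = 0.
  rewrite -(scaler0 _ (ev f x)) -(h z); apply: ev_inj => k; rewrite !evE u1.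
  transitivity (ev f x * ((1 - 2) * ev f z + ev f x * ev f (A z)) * ev k (A x)
    + (ev f x * ev f (A (A x)) * ev f z + ev f x * (1 - 2) * ev f (A z)) * ev k x).
    by rewrite wa; ring.
  by ring.
by move/eqP; rewrite scaler_eq0 => /orP[->//|/eqP/subr0_eq e]; rewrite e eqxx in ne.
Qed.

Lemma sim_rank1_l A x f : ev f x *: A x = x -> sim A (rank1 x f).
Proof.
move=> e; apply/simP => z; rewrite !jd_rank1 !(opE, evE).
have [a0|a0] := eqVneq (ev f x) 0.
  have x0 : x = 0 by rewrite -e a0 scale0r.
  by rewrite x0 !op0 !scaler0 !addr0 scaler0.
have Ax : A x = (ev f x)^-1 *: x by apply: (scalerI a0); rewrite e scalerA divff// scale1r.
by rewrite !(Ax, opE, evE); pairing_field.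
Qed.

Lemma sim_rank1_r A x f : ev f x != 0 ->
  (forall z, ev f x * ev f (A z) = ev f z) -> sim A (rank1 x f).
Proof.
move=> a0 e; apply/simP => z; rewrite !jd_rank1 !(opE, evE).
have E y : ev f (A y) = (ev f x)^-1 * ev f y by rewrite -(e y) mulKf.
by rewrite !E; apply: ev_inj => k; rewrite !(evE, E); field.
Qed.

Lemma sim_rank1_nil A x f : ev f x = 0 -> ev f (A x) = 2 -> ev f (A (A x)) = 0 ->
  sim A (rank1 x f).
Proof.
move=> a0 u w; apply/sim_rank1P => z; rewrite a0 u w.
by pairing_ring.
Qed.

(** The second alternative is the vanishing of the Jordan product; as f x = 0, it no longer forces l
    = 0. *)
Lemma sim_rank1_nilP A x f : x != 0 -> f != 0 -> ev f x = 0 ->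
  sim A (rank1 x f) ->
  (ev f (A x) = 2 /\ ev f (A (A x)) = 0) \/
  exists l, A x = l *: x /\ forall z, ev f (A z) = - l * ev f z.
Proof.
move=> x0 /dual_neq0 [v fv] a0 /sim_rank1P h.
have [u2|u2] := eqVneq (ev f (A x)) 2.
  left; split=> //; have := h v; rewrite u2 a0 subrr !mul0r !add0r scale0r add0r.
  move/eqP; rewrite addr0 scaler_eq0 (negbTE x0) mulf_eq0 (negbTE fv) !orbF.
  by move/eqP.
have u20 : ev f (A x) - 2 != 0 by rewrite subr_eq0.
have [l Ax] : exists l, A x = l *: x.
  eexists; apply: (scale_eq_opp _ (h v)).
  by rewrite a0 mul0r addr0 mulf_neq0.
right; exists l; split=> // z; have := h z.
rewrite !(Ax, opE, evE) a0 scalerA -scalerDl => /eqP.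
rewrite scaler_eq0 (negbTE x0) orbF => /eqP e.
apply/eqP; rewrite -subr_eq0.
have : 2 * (ev f (A z) - - l * ev f z) = 0 by rewrite -[RHS]oppr0 -e; ring.
by move/eqP; rewrite !mulf_eq0 (negbTE two_neq0).
Qed.

Definition jperp A B : Prop := forall z, jd A B z = 0.

Lemma jperp_sim A B : jperp A B -> sim A B.
Proof. by move=> h; apply/simP => z; rewrite !h scaler0. Qed.

Lemma jperpZ A B c : jperp A B -> jperp A (c *: B).
Proof.
by move=> h z; rewrite /jd !opE -scalerDr; have := h z; rewrite /jd => ->; rewrite scaler0.
Qed.

(** If E and c E are both idempotent then (c^2 - c) E = 0. This is how the vanishing of a Jordan
    product is read off from ~. *)
Lemma sim_jperp A B c : c != 0 -> c != 1 -> sim A B -> sim A (c *: B) -> jperp A B.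
Proof.
move=> c0 c1 /simP h /simP hc z; have := hc z.
have E y : jd A (c *: B) y = c *: jd A B y by rewrite /jd !opE scalerDr.
have jZ y : jd A B (c *: y) = c *: jd A B y by rewrite /jd !opE scalerDr.
rewrite !E jZ h !scalerA => /eqP; rewrite -subr_eq0 -scalerBl scaler_eq0.
have -> : c * c * 2 - 2 * c = 2 * c * (c - 1) by ring.
by rewrite !mulf_eq0 subr_eq0 (negbTE c0) (negbTE c1) (negbTE two_neq0) => /eqP.
Qed.

Lemma jperp_rank1 A x f : ev f x != 0 ->
  jperp A (rank1 x f) <-> A x = 0 /\ forall z, ev f (A z) = 0.
Proof.
move=> a0; split=> [h|[Ax fA] z]; last first.
  by rewrite jd_rank1 Ax fA scaler0 scale0r addr0.
have hx := h x; rewrite jd_rank1 in hx.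
have u0 : ev f (A x) = 0.
  have := congr1 (ev f) hx; rewrite !evE => /eqP.
  have -> : ev f x * ev f (A x) + ev f (A x) * ev f x = 2 * ev f x * ev f (A x).
    by ring.
  by rewrite !mulf_eq0 (negbTE two_neq0) (negbTE a0) => /eqP.
have Ax : A x = 0.
  by move/eqP: hx; rewrite u0 scale0r addr0 scaler_eq0 (negbTE a0) => /eqP.
split=> // z; have := h z; rewrite jd_rank1 Ax scaler0 add0r => /eqP.
rewrite scaler_eq0 => /orP[/eqP //|/eqP x0]; by rewrite x0 ev0 eqxx in a0.
Qed.

Lemma jperp_rank1_eig A x f : x != 0 -> f != 0 -> jperp A (rank1 x f) ->
  exists l, A x = l *: x /\ forall z, ev f (A z) = - l * ev f z.
Proof.
move=> x0 /dual_neq0 [v fv] h.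
have [l Ax] : exists l, A x = l *: x.
  have := h v; rewrite jd_rank1 => hv.
  by eexists; exact: (scale_eq_opp fv hv).
exists l; split=> // z; have := h z; rewrite jd_rank1 Ax scalerA -scalerDl => /eqP.
by rewrite scaler_eq0 (negbTE x0) orbF addr_eq0 => /eqP e; rewrite mulNr mulrC e opprK.
Qed.

Lemma jperp_rank1_eigV A x f l : A x = l *: x ->
  (forall z, ev f (A z) = - l * ev f z) -> jperp A (rank1 x f).
Proof.
move=> Ax fA z; rewrite jd_rank1 Ax fA.
by pairing_ring.
Qed.

End jordan_rank1.

(** * Operators related to the same rank one operators *)

Section rank1_tests.
Variables (R : realType) (X : normedModType R[i]).
Implicit Types (x y z w : X) (f g k : topdual X) (A B M : 'B(X)).

Definition rank1_equiv A B : Prop :=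
  forall x f, sim A (rank1 x f) <-> sim B (rank1 x f).

Lemma rank1_equivC A B : rank1_equiv A B -> rank1_equiv B A.
Proof. by move=> h x f; split=> /h. Qed.

Lemma rank1Z c x f : rank1 x (c *: f) = c *: rank1 x f.
Proof. by apply: bounded_op_ext => z; rewrite bounded_opZE !rank1E evZl scalerA. Qed.

Lemma rank10 f : rank1 0 f = 0.
Proof. by apply: bounded_op_ext => z; rewrite rank1E scaler0. Qed.

Lemma rank1_0 x : rank1 x 0 = 0.
Proof. by apply: bounded_op_ext => z; rewrite rank1E ev0l scale0r. Qed.

Lemma two_neq1 : (2 : R[i]) != 1.
Proof. by rewrite -[X in _ != X]/(1%:R) eqr_nat. Qed.

Lemma rank1_equiv_jperp A B x f : rank1_equiv A B ->
  jperp A (rank1 x f) -> jperp B (rank1 x f).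
Proof.
move=> h Axf; apply: (@sim_jperp _ _ _ _ 2); rewrite ?two_neq0 ?two_neq1//.
  exact/h/jperp_sim.
by rewrite -rank1Z; apply/h/jperp_sim; rewrite rank1Z; exact: jperpZ.
Qed.

Lemma jperp_rank1_eq0 A : (forall x f, ev f x = 1 -> jperp A (rank1 x f)) -> A = 0.
Proof.
move=> h; apply: bounded_op_ext => x; rewrite bounded_op0E.
have [->|/dual_separation0 [f fx]] := eqVneq x 0; first exact: op0.
by have := h _ _ fx; rewrite jperp_rank1 ?fx ?oner_neq0// => -[].
Qed.

Lemma rank1_equiv0 B : rank1_equiv 0 B -> B = 0.
Proof.
move=> h; apply: jperp_rank1_eq0 => x f _; apply: (rank1_equiv_jperp h) => z.
by rewrite /jd !opE addr0.
Qed.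

Lemma eig_of_sim A x l f : l != 0 -> A x = l *: x -> ev f x = l^-1 ->
  sim A (rank1 x f).
Proof. by move=> l0 Ax fx; apply: sim_rank1_l; rewrite Ax fx scalerA mulVf// scale1r. Qed.

(** A functional [f] vanishing at [x] is the difference of f + g and g, which do not vanish
    there. *)
Lemma scalar_op A x l : x != 0 ->
  (forall f, ev f x != 0 -> forall z, ev f (A z) = l * ev f z) ->
  forall z, A z = l *: z.
Proof.
move=> /dual_separation0 [g gx] h z; apply: ev_inj => f; rewrite evZ.
have [fx|] := eqVneq (ev f x) 0; last by move/h.
have /h /(_ z) : ev (f + g) x != 0 by rewrite evDl fx gx add0r oner_neq0.
have /h /(_ z) : ev g x != 0 by rewrite gx oner_neq0.
rewrite !evDl => -> /eqP; rewrite mulrDr -subr_eq0 opprD addrACA subrr addr0.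
by rewrite subr_eq0 => /eqP.
Qed.

Lemma zero_op A x : x != 0 ->
  (forall f, ev f x != 0 -> forall z, ev f (A z) = 0) -> A = 0.
Proof.
move=> x0 h; apply: bounded_op_ext => z.
rewrite (@scalar_op _ x 0 x0) ?scale0r// => f fx y; rewrite mul0r; exact: h.
Qed.

(** Each [f] with f x = 1/l gives a test passed by A, hence by B. If B x were not l x, every [f] not
    vanishing at [x] would fall under the other two cases of [sim_rank1], making B either the scalar
    l, which is absurd, or 0; but B = 0 forces A = 0. *)
Lemma rank1_equiv_eig A B x l : rank1_equiv A B -> l != 0 ->
  A x = l *: x -> B x = l *: x.
Proof.
move=> h l0 Ax; have [->|x0] := eqVneq x 0; first by rewrite op0 scaler0.
apply: contrapT => nBx.
have key f : ev f x = l^-1 ->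
    (forall z, ev f (B z) = l * ev f z) \/ B x = 0 /\ forall z, ev f (B z) = 0.
  move=> fx; have : sim B (rank1 x f) by apply/h/(eig_of_sim l0).
  case/sim_rank1; rewrite ?fx ?invr_eq0//.
  - move=> e; case: nBx; apply: (scalerI (_ : l^-1 != 0)); rewrite ?invr_eq0//.
    by rewrite e scalerA mulVf// scale1r.
  - by move=> e; left => z; rewrite -(e z) mulVKf.
  - by move=> e; right.
have key2 f : ev f x != 0 ->
    (forall z, ev f (B z) = l * ev f z) \/ B x = 0 /\ forall z, ev f (B z) = 0.
  move=> fx; have c0 : (l * ev f x)^-1 != 0 by rewrite invr_eq0 mulf_neq0.
  have := key ((l * ev f x)^-1 *: f); rewrite evZl invfM -mulrA mulVf// mulr1.
  move=> /(_ erefl); rewrite -invfM => -[e|[e1 e2]]; [left=> z|right; split=> // z].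
    by have := e z; rewrite !evZl (mulrCA l) => /(mulfI c0).
  by have /eqP := e2 z; rewrite evZl mulf_eq0 (negbTE c0) => /eqP.
have [Bx|Bx] := eqVneq (B x) 0; last first.
  apply: nBx; apply: (scalar_op x0) => f /key2 [//|[e _]].
  by rewrite e eqxx in Bx.
have B0 : B = 0.
  apply: (zero_op x0) => f fx; have [e|[]//] := key2 _ fx.
  have /eqP := e x; rewrite Bx ev0 eq_sym mulf_eq0 (negbTE l0) (negbTE fx)//.
move: h; rewrite B0 => /rank1_equivC/rank1_equiv0 A0; move: Ax.
rewrite A0 bounded_op0E => /esym/eqP; rewrite scaler_eq0 (negbTE l0) (negbTE x0)//.
Qed.

Lemma rank1_equiv_coeig A B f l : rank1_equiv A B -> l != 0 ->
  (forall z, ev f (A z) = l * ev f z) -> forall z, ev f (B z) = l * ev f z.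
Proof.
move=> h l0 fA; have [->|f0] := eqVneq f 0; first by move=> z; rewrite !ev0l mulr0.
apply: contrapT => nfB.
have key x : ev f x = l^-1 ->
    B x = l *: x \/ B x = 0 /\ forall z, ev f (B z) = 0.
  move=> fx; have fx0 : ev f x != 0 by rewrite fx invr_eq0.
  have : sim B (rank1 x f).
    by apply/h/sim_rank1_r => // z; rewrite fA fx mulKf.
  case/(sim_rank1 fx0) => e.
  - by left; apply: (scalerI fx0); rewrite e fx scalerA mulVf// scale1r.
  - by case: nfB => z; rewrite -(e z) fx mulVKf.
  - by right.
have [v fv] : exists v, ev f v = l^-1.
  have [v fv] := dual_neq0 f0; exists ((l * ev f v)^-1 *: v).
  by rewrite evZ invfM -mulrA mulVf// mulr1.
have [Bv|[Bv fB]] := key v fv.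
  apply: nfB => z.
  have Bk y : ev f y = 0 -> ev f (B y) = 0.
    move=> fy; have [e|[_ e]] := key (y + v) ltac:(by rewrite evD fy fv add0r).
      have -> : B y = B (y + v) - B v by rewrite opD addrK.
      by rewrite e Bv !evE fy fv; ring.
    exact: e.
  have := Bk (z - (l * ev f z) *: v).
  rewrite !(opE, evE) Bv !evE fv; set t := ev f (B z).
  have -> : ev f z - l * ev f z * l^-1 = 0 by field.
  by move=> /(_ erefl) /eqP; rewrite subr_eq0 => /eqP ->; field.
have B0 : B = 0.
  have Bf y : ev f y = l^-1 -> B y = 0.
    move=> fy; have [e|[//]] := key y fy.
    have := fB y; rewrite e evZ fy divff// => /eqP; rewrite oner_eq0//.
  apply: bounded_op_ext => z; rewrite bounded_op0E.
  have Bk y : ev f y = 0 -> B y = 0.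
    by move=> fy; have := Bf (y + v); rewrite opD Bv addr0 evD fy fv add0r; apply.
  have := Bk (z - (l * ev f z) *: v).
  rewrite !(opE, evE) Bv scaler0 subr0 fv; apply; field; exact: l0.
move: h; rewrite B0 => /rank1_equivC/rank1_equiv0 A0.
have := fA v; rewrite A0 bounded_op0E ev0 fv divff// => /eqP.
by rewrite eq_sym oner_eq0.
Qed.

Lemma rank1_equiv_ker A B w f : rank1_equiv A B -> f != 0 ->
  A w = 0 -> (forall z, ev f (A z) = 0) -> B w = 0.
Proof.
move=> h f0 Aw fA; have [->|w0] := eqVneq w 0; first exact: op0.
have : jperp B (rank1 w f).
  apply: (rank1_equiv_jperp h) => z; rewrite jd_rank1 Aw fA scaler0 scale0r addr0//.
case/(jperp_rank1_eig w0 f0) => l [Bw _].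
have [l0|l0] := eqVneq l 0; first by rewrite Bw l0 scale0r.
have := rank1_equiv_eig (rank1_equivC h) l0 Bw; rewrite Aw => /esym/eqP.
by rewrite scaler_eq0 (negbTE l0) (negbTE w0).
Qed.

(** The tester is built on 2 f because the nilpotent test asks for the value 2. The other
    alternative for B would make the Jordan product of A with the tester vanish, but that product
    sends x to 2 x. *)
Lemma rank1_equiv_nil A B x f : rank1_equiv A B ->
  ev f x = 0 -> ev f (A (A x)) = 0 -> ev f (A x) = 1 ->
  ev f (B x) = 1 /\ ev f (B (B x)) = 0.
Proof.
move=> h fx fAAx fAx.
have x0 : x != 0.
  by apply: contra_eq_neq fAx => ->; rewrite op0 ev0 eq_sym oner_neq0.
have f0 : 2 *: f != 0.
  rewrite scaler_eq0 (negbTE (two_neq0 R)) /=.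
  by apply: contra_eq_neq fAx => ->; rewrite ev0l eq_sym oner_neq0.
have fx2 : ev (2 *: f) x = 0 by rewrite evZl fx mulr0.
have : sim B (rank1 x (2 *: f)).
  apply/h; apply: sim_rank1_nil; rewrite ?evZl ?fx ?fAx ?fAAx ?mulr0 ?mulr1//.
case/(sim_rank1_nilP x0 f0 fx2) => [[]|[l [Bx fB]]].
  rewrite !evZl => e1 /eqP; rewrite mulf_eq0 (negbTE (two_neq0 R)) => /eqP e2.
  by split=> //; apply: (mulfI (two_neq0 R)); rewrite mulr1.
have := rank1_equiv_jperp (rank1_equivC h) (jperp_rank1_eigV Bx fB).
move=> /(_ x); rewrite jd_rank1 fx2 scale0r add0r evZl fAx mulr1 => /eqP.
by rewrite scaler_eq0 (negbTE (two_neq0 R)) (negbTE x0).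
Qed.

(** X is the sum of the eigenspaces of M for r1, r2 and 0. Eigenvectors for r1 and r2 pass to B by
    [rank1_equiv_eig], the kernel by [rank1_equiv_ker]. *)
Lemma rank1_equiv_cubic (r1 r2 : R[i]) M B : rank1_equiv M B ->
  r1 != 0 -> r2 != 0 -> r1 != r2 ->
  (forall x, M (M (M x)) = (r1 + r2) *: M (M x) - (r1 * r2) *: M x) -> B = M.
Proof.
move=> h r10 r20 r12 hM; apply: bounded_op_ext => y.
pose p x := M (M x) - (r1 + r2) *: M x + (r1 * r2) *: x.
have r0 : r1 * r2 != 0 by rewrite mulf_neq0.
have d0 : r1 - r2 != 0 by rewrite subr_eq0.
have Mp x : M (p x) = 0.
  by rewrite /p !opE hM; pairing_ring.
have Bp x : B (p x) = 0.
  have [->|px0] := eqVneq (p x) 0; first by rewrite op0.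
  have [k kp] := dual_separation0 px0.
  (* [p] divided by r1 r2 is the projection onto the kernel of M. Composing [k] with it gives a
     functional that vanishes on the range of M and is 1 at [p x]. *)
  pose k' : topdual X := (r1 * r2)^-1 *: (adjoint M (adjoint M k)
    - (r1 + r2) *: adjoint M k + (r1 * r2) *: k).
  have k'E z : ev k' z = (r1 * r2)^-1 * ev k (p z).
    by rewrite /k' /p !evE.
  have k'p : ev k' (p x) = 1.
    rewrite k'E {1}/p Mp op0 scaler0 subrr add0r evZ kp mulr1 mulVf//.
  apply: (@rank1_equiv_ker M B _ k') => //.
    by apply: contra_eq_neq k'p => ->; rewrite ev0l eq_sym oner_neq0.
  move=> z; rewrite k'E; have -> : p (M z) = M (p z) by rewrite /p !opE.
  by rewrite Mp ev0 mulr0.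
have BM x : B (M x) = M (M x).
  have E : M x = (r1 - r2)^-1 *: ((M (M x) - r2 *: M x) - (M (M x) - r1 *: M x)).
    by pairing_field.
  have e1 : B (M (M x) - r2 *: M x) = r1 *: (M (M x) - r2 *: M x).
    apply: (rank1_equiv_eig h r10); rewrite !opE hM.
    by pairing_ring.
  have e2 : B (M (M x) - r1 *: M x) = r2 *: (M (M x) - r1 *: M x).
    apply: (rank1_equiv_eig h r20); rewrite !opE hM.
    by pairing_ring.
  rewrite {1}E opZ opD e1 opN e2.
  by pairing_field.
have E : y = (r1 * r2)^-1 *: (p y - M (M y) + (r1 + r2) *: M y).
  by apply: ev_inj => k; rewrite /p !evE; field; rewrite r10 r20.
rewrite {1}E opZ (opD B (p y - _)) (opD B (p y)) opN (opZ B (r1 + r2)) Bp !BM.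
by rewrite hM; pairing_field; rewrite r10 r20.
Qed.

End rank1_tests.

(** * Maps fixing the rank one idempotents up to sign *)

Section rank1_fixed.
Variables (R : realType) (X : normedModType R[i]) (Phi : 'B(X) -> 'B(X)).
Implicit Types (x y z w : X) (f g k : topdual X) (A B M : 'B(X)).
Hypothesis Xinf : unspanned X.
Hypothesis Phi_sim : forall A B, sim A B <-> sim (Phi A) (Phi B).
Hypothesis Phi_idem : forall x f, ev f x = 1 -> Phi (rank1 x f) = rank1 x f.
Hypothesis Phi_idemN : forall x f, ev f x = 1 ->
  Phi (- rank1 x f) = - rank1 x f.

Lemma m1_neq0 : (-1 : R[i]) != 0. Proof. by rewrite oppr_eq0 oner_neq0. Qed.
Lemma m1_neq1 : (-1 : R[i]) != 1.
Proof. by rewrite -subr_eq0 -opprD oppr_eq0 -(natrD _ 1 1) pnatr_eq0. Qed.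

(** A rank one idempotent and its opposite are both fixed, so [sim_jperp] applies with the factor
    -1. *)
Lemma Phi_jperp A x f : ev f x = 1 ->
  jperp A (rank1 x f) <-> jperp (Phi A) (rank1 x f).
Proof.
move=> fx; split=> h; apply: (@sim_jperp _ _ _ _ (-1)); rewrite ?m1_neq0 ?m1_neq1//.
- by rewrite -(Phi_idem fx) -Phi_sim; exact: jperp_sim.
- by rewrite scaleN1r -(Phi_idemN fx) -Phi_sim -scaleN1r; exact/jperp_sim/jperpZ.
- by rewrite Phi_sim (Phi_idem fx); exact: jperp_sim.
- by rewrite scaleN1r Phi_sim (Phi_idemN fx) -scaleN1r; exact/jperp_sim/jperpZ.
Qed.

Lemma Phi_ker A x f : ev f x = 1 -> A x = 0 -> (forall z, ev f (A z) = 0) ->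
  Phi A x = 0 /\ forall z, ev f (Phi A z) = 0.
Proof.
move=> fx Ax fA; have f0 : ev f x != 0 by rewrite fx oner_neq0.
have h := (jperp_rank1 A f0).2 (conj Ax fA).
exact: ((jperp_rank1 _ f0).1 ((Phi_jperp A fx).1 h)).
Qed.

Lemma Phi_eq0 A : Phi A = 0 -> A = 0.
Proof.
move=> A0; apply: jperp_rank1_eq0 => x f fx; apply/Phi_jperp => // z.
by rewrite A0 /jd !opE addr0.
Qed.

Lemma Phi0 : Phi 0 = 0.
Proof.
apply: jperp_rank1_eq0 => x f fx; apply: (Phi_jperp 0 fx).1 => z.
by rewrite /jd !opE addr0.
Qed.

Lemma rank1_eq0 x f : x != 0 -> f != 0 -> rank1 x f != 0.
Proof.
move=> x0 /dual_neq0 [v fv]; apply/eqP => /(congr1 (fun B : 'B(X) => B v)) /eqP.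
by rewrite rank1E scaler_eq0 (negbTE fv) (negbTE x0).
Qed.

(** Every idempotent [rank1 z k] with k x = 0 and f z = 0 is orthogonal to [rank1 x f], hence to its
    image B. Enough such z and k exist for B to kill the kernel of f and to have its range in the
    line of x. *)
Lemma Phi_rank1_scal x f : exists h, Phi (rank1 x f) = h *: rank1 x f.
Proof.
have [->|x0] := eqVneq x 0.
  by exists 0; rewrite scale0r rank10 Phi0.
have [->|f0] := eqVneq f 0.
  by exists 0; rewrite scale0r rank1_0 Phi0.
set B := Phi _.
have K z k : ev k z = 1 -> ev k x = 0 -> ev f z = 0 ->
    B z = 0 /\ forall y, ev k (B y) = 0.
  move=> kz kx fz; apply: Phi_ker => //; first by rewrite rank1E fz scale0r.
  by move=> y; rewrite rank1E evZ kx mulr0.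
have [e fe] : exists e, ev f e = 1.
  have [v fv] := dual_neq0 f0; exists ((ev f v)^-1 *: v); rewrite evZ mulVf//.
have kerB0 z : ev f z = 0 -> ~ (exists c, z = c *: x) -> B z = 0.
  by move=> fz /dual_separation1 [k [kz kx]]; have [] := K z k kz kx fz.
have kerB z : ev f z = 0 -> B z = 0.
  move=> fz; have [[c zx]|/kerB0 -> //] := pselect (exists c, z = c *: x).
  (* A multiple of [x] in the kernel of [f] is written as a difference of two vectors of that kernel
     outside the line of [x]. *)
  have [z0 nz0] := Xinf [:: x; e].
  pose z' := z0 - ev f z0 *: e.
  have fz' : ev f z' = 0 by rewrite /z' !evE fe; ring.
  have nz' : ~ exists c, z' = c *: x.
    move=> [d zd]; apply: nz0; apply/in_span2P; exists d, (ev f z0).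
    by rewrite -zd /z' subrK.
  have := kerB0 (z + z'); rewrite evD fz fz' addr0 opD (kerB0 z')// addr0; apply=> //.
  move=> [d zd]; apply: nz'; exists (d - c).
  by rewrite scalerBl -zd zx addrAC subrr add0r.
have kB k : ev k x = 0 -> ~ (exists c, k = c *: f) -> forall y, ev k (B y) = 0.
  move=> kx nk; have [|z [kz zf]] := @predual_separation _ _ [:: f] k.
    by move/in_span1P.
  by have [] := K z k kz kx (zf _ (mem_head _ _)).
have Bx y : exists c, B y = c *: x.
  apply: contrapT => /dual_separation1 [k [kBy kx]].
  have [[c kc]|nk] := pselect (exists c, k = c *: f); last first.
    by have /eqP := kB k kx nk y; rewrite kBy oner_eq0.
  have c0 : c != 0 by apply: contra_eq_neq kBy => c0; rewrite kc c0 scale0r ev0l eq_sym oner_neq0.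
  (* [k] itself may be a multiple of [f]. Then a nonzero [k'] vanishing at [x] and [B y] either
     makes [k + k'] leave the line of [f], or is a multiple of [k] vanishing at [B y], hence 0. *)
  have [v /dual_separation2 [k' [k'v k'x k'By]]] := Xinf [:: x; B y].
  have [[d kd]|nk'] := pselect (exists d, k + k' = d *: f); last first.
    have kkx : ev (k + k') x = 0 by rewrite evDl kx k'x addr0.
    by have /eqP := kB _ kkx nk' y; rewrite evDl kBy k'By addr0 oner_eq0.
  have k'f : k' = ((d - c) / c) *: k.
    rewrite kc scalerA divfK// scalerBl -kd -kc addrAC subrr add0r//.
  have /eqP := k'By; rewrite k'f evZl kBy mulr1 => /eqP dc.
  by have /eqP := k'v; rewrite k'f dc scale0r ev0l eq_sym oner_eq0.
have [h Be] := Bx e; exists h; apply: bounded_op_ext => y.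
have -> : y = ev f y *: e + (y - ev f y *: e) by rewrite addrC subrK.
rewrite opD opZ (kerB (y - _)); last by rewrite !evE fe; ring.
rewrite bounded_opZE rank1E Be addr0 !evE fe scalerA [in RHS]scalerA; congr (_ *: _); ring.
Qed.

Lemma Phi_rank1_scal_neq0 x f h : x != 0 -> f != 0 ->
  Phi (rank1 x f) = h *: rank1 x f -> h != 0.
Proof.
move=> x0 f0 e; apply/eqP => h0; move: (rank1_eq0 x0 f0); apply/negP/negPn/eqP.
by apply: Phi_eq0; rewrite e h0 scale0r.
Qed.

Lemma Phi_sim_rank1 A x f : sim A (rank1 x f) -> x != 0 -> f != 0 ->
  exists2 h, h != 0 & Phi (rank1 x f) = h *: rank1 x f /\ sim (Phi A) (rank1 x (h *: f)).
Proof.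
move=> s x0 f0; have [h e] := Phi_rank1_scal x f.
exists h; first exact: (Phi_rank1_scal_neq0 x0 f0 e).
by split=> //; rewrite rank1Z -e -Phi_sim.
Qed.

(** If x were no eigenvector, choose f x = 1, f (B x) = 0, g x = 0, g (B x) = 1. Then f, f + g and f
    + 2 g would be left eigenfunctionals with eigenvalues 0, 1, 2, so their values at B^2 x would be
    0, 1, 4, whereas linearity in g requires 0, 1, 2. *)
Lemma eig_of_coeig B x :
  (forall f, ev f x = 1 ->
    (exists m, B x = m *: x) \/ exists m, forall z, ev f (B z) = m * ev f z) ->
  exists m, B x = m *: x.
Proof.
move=> h; apply: contrapT => nB.
have x0 : x != 0.
  by apply/eqP => x0; apply: nB; exists 0; rewrite x0 op0 scaler0.
have h' f : ev f x = 1 -> exists m, forall z, ev f (B z) = m * ev f z.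
  by move=> /h[//|].
have [f [fx fBx]] : exists f, ev f x = 1 /\ ev f (B x) = 0.
  apply: dual_separation1 => -[c xc]; apply: nB; exists c^-1.
  have c0 : c != 0 by apply/eqP => c0; move: x0; rewrite xc c0 scale0r eqxx.
  by rewrite [in RHS]xc scalerA mulVf// scale1r.
have [g [gBx gx]] := dual_separation1 nB.
have [m1 fB] := h' f fx.
have [|m2 gB] := h' (f + g); first by rewrite evDl fx gx addr0.
have [|m3 gB'] := h' (f + 2 *: g); first by rewrite evDl evZl fx gx mulr0 addr0.
have m10 : m1 = 0 by have := fB x; rewrite fBx fx mulr1.
have m21 : m2 = 1.
  by have := gB x; rewrite !evDl fBx gBx fx gx addr0 add0r mulr1.
have m32 : m3 = 2.
  by have := gB' x; rewrite !evDl !evZl fBx gBx fx gx mulr0 addr0 add0r !mulr1.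
have fBB : ev f (B (B x)) = 0 by rewrite fB m10 mul0r.
have gBB : ev g (B (B x)) = 1.
  by have := gB (B x); rewrite !evDl fBB fBx gBx m21 !add0r mulr1.
have := gB' (B x); rewrite !evDl !evZl fBB gBB fBx gBx m32 !add0r !mulr1 => /eqP.
rewrite -subr_eq0; have -> : (2 : R[i]) - 2 * 2 = - 2 by ring.
by rewrite oppr_eq0 (negbTE (two_neq0 R)).
Qed.

Lemma ev1_neq0 f x : ev f x = 1 -> f != 0.
Proof. by move=> fx; apply: contra_eq_neq fx => ->; rewrite ev0l eq_sym oner_neq0. Qed.

Lemma ev1_neq0r f x : ev f x = 1 -> x != 0.
Proof. by move=> fx; apply: contra_eq_neq fx => ->; rewrite ev0 eq_sym oner_neq0. Qed.

Lemma Phi_eig A x l : l != 0 -> A x = l *: x -> exists m, Phi A x = m *: x.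
Proof.
move=> l0 Ax; apply: eig_of_coeig => f fx.
have x0 := ev1_neq0r fx; have f0 := ev1_neq0 fx.
have li0 : l^-1 != 0 by rewrite invr_eq0.
have [||h h0 [_]] := @Phi_sim_rank1 A x (l^-1 *: f) _ x0.
- by apply: (eig_of_sim l0 Ax); rewrite evZl fx mulr1.
- by rewrite scaler_eq0 negb_or li0.
set c := h * l^-1; have c0 : c != 0 by rewrite mulf_neq0.
rewrite scalerA -/c => /sim_rank1; rewrite evZl fx mulr1 => /(_ c0) [e|e|[e _]].
- by left; exists c^-1; rewrite -[in RHS]e scalerA mulVf// scale1r.
- right; exists c^-1 => z; have := e z; rewrite !evZl mulrCA => /(mulfI c0) <-.
  by rewrite mulKf.
- by left; exists 0; rewrite e scale0r.
Qed.

(** [Phi_eig] leaves the eigenvalue open because rank one operators are so far known only up to a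
    factor. For s = 1 or -1 the operator [s *: rank1 x f] itself is fixed and pins it down. *)
Lemma Phi_unit_eig A x f s l : s * s = 1 -> Phi (s *: rank1 x f) = s *: rank1 x f ->
  ev f x = 1 -> A x = s *: x -> Phi A x = l *: x -> l = s.
Proof.
move=> s2 Ps fx Ax Bx; have x0 := ev1_neq0r fx.
have s0 : s != 0 by apply: contra_eq_neq s2 => ->; rewrite mul0r eq_sym oner_neq0.
have : sim (Phi A) (rank1 x (s *: f)).
  rewrite rank1Z -Ps -Phi_sim -rank1Z; apply: sim_rank1_l.
  by rewrite evZl fx mulr1 Ax scalerA s2 scale1r.
have fs : ev (s *: f) x = s by rewrite evZl fx mulr1.
move/sim_rank1; rewrite fs => /(_ s0) [||[h1 h2]].
- by rewrite Bx scalerA -{2}(scale1r x) -s2 => /(scaler_injl x0)/(mulfI s0).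
- by move=> /(_ x); rewrite !evZl Bx evZ fx mulr1 => /(mulfI s0); rewrite -s2 => /(mulfI s0).
- have h2' z : ev f (Phi A z) = 0.
    by have /eqP := h2 z; rewrite evZl mulf_eq0 (negbTE s0) => /eqP.
  have := (Phi_jperp A fx).2; rewrite !jperp_rank1 ?fx ?oner_neq0//.
  move=> /(_ (conj h1 h2')) [] /eqP.
  by rewrite Ax scaler_eq0 (negbTE s0) (negbTE x0).
Qed.

Section symmetry.
Variables (e1 e2 : X) (f1 f2 : topdual X).
Hypotheses (f1e1 : ev f1 e1 = 1) (f1e2 : ev f1 e2 = 0).
Hypotheses (f2e1 : ev f2 e1 = 0) (f2e2 : ev f2 e2 = 1).

Let S := rank1 e1 f1 - rank1 e2 f2.

Lemma symmetryE z : S z = ev f1 z *: e1 - ev f2 z *: e2. Proof. by []. Qed.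

Lemma Phi_symmetry c : c != 0 -> exists l m,
  forall z, Phi (c *: S) z = (l * ev f1 z) *: e1 + (m * ev f2 z) *: e2.
Proof.
move=> c0; set B := Phi _.
have [l Be1] : exists l, B e1 = l *: e1.
  apply: (Phi_eig c0); rewrite bounded_opZE symmetryE f1e1 f2e1 scale1r scale0r subr0//.
have [m Be2] : exists m, B e2 = m *: e2.
  apply: (@Phi_eig _ _ (- c)); first by rewrite oppr_eq0.
  by rewrite bounded_opZE symmetryE f1e2 f2e2 scale1r scale0r sub0r scalerN scaleNr.
have kerB z : ev f1 z = 0 -> ev f2 z = 0 -> B z = 0.
  move=> z1 z2; have [->|z0] := eqVneq z 0; first exact: op0.
  have [|k [kz k1 k2]] := @dual_separation2 _ _ z e1 e2.
    move/in_span2P => [a [b zab]]; move/eqP: z0; apply.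
    move: z1 z2; rewrite zab !evE f1e1 f1e2 f2e1 f2e2 !mulr0 !mulr1 addr0 add0r.
    by move=> -> ->; rewrite !scale0r addr0.
  have [] := @Phi_ker (c *: S) z k kz; rewrite //.
    by rewrite bounded_opZE symmetryE z1 z2 !scale0r subr0 scaler0.
  by move=> y; rewrite bounded_opZE symmetryE !evE k1 k2 !mulr0 subr0 mulr0.
exists l, m => z.
set z' := z - ev f1 z *: e1 - ev f2 z *: e2.
have zE : z = z' + ev f1 z *: e1 + ev f2 z *: e2 by rewrite addrAC subrK subrK.
have Bz' : B z' = 0.
  apply: kerB; first by rewrite /z' !evE f1e1 f1e2; ring.
  by rewrite /z' !evE f2e1 f2e2; ring.
rewrite {1}zE (opD B (z' + _)) (opD B z') Bz' add0r.
by rewrite !opZ Be1 Be2 !scalerA mulrC [_ * m]mulrC.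
Qed.

Let e10 := ev1_neq0r f1e1.
Let e20 := ev1_neq0r f2e2.

Lemma Phi_symmetry1 : Phi S = S.
Proof.
have [l [m E]] := Phi_symmetry (oner_neq0 _); rewrite scale1r in E.
have B1 : Phi S e1 = l *: e1 by rewrite E f1e1 f2e1 mulr1 mulr0 scale0r addr0.
have B2 : Phi S e2 = m *: e2 by rewrite E f1e2 f2e2 mulr1 mulr0 scale0r add0r.
have l1 : l = 1.
  apply: (Phi_unit_eig _ _ f1e1 _ B1); rewrite ?mulr1 ?scale1r ?Phi_idem//.
  by rewrite symmetryE f1e1 f2e1 scale1r scale0r subr0.
have m1 : m = - 1.
  apply: (Phi_unit_eig _ _ f2e2 _ B2); rewrite ?mulrNN ?mulr1 ?scaleN1r ?Phi_idemN//.
  by rewrite symmetryE f1e2 f2e2 scale1r scale0r sub0r.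
by apply: bounded_op_ext => z; rewrite E symmetryE l1 m1 mul1r mulN1r scaleNr.
Qed.

End symmetry.

(** A fixed reflection S exchanges x with a vector v such that f v = 2. It passes the nilpotent test
    of [rank1 x f], and it passes that of a multiple h f only for h = 1. *)
Lemma Phi_nilpotent x f : ev f x = 0 -> Phi (rank1 x f) = rank1 x f.
Proof.
move=> fx; have [h e] := Phi_rank1_scal x f.
have [x00|x0] := eqVneq x 0; first by rewrite x00 rank10 Phi0.
have [f00|f0] := eqVneq f 0; first by rewrite f00 rank1_0 Phi0.
have [v fv] : exists v, ev f v = 2.
  have [v fv] := dual_neq0 f0; exists ((2 / ev f v) *: v); rewrite evZ divfK//.
have [m [mx mv]] : exists m, ev m x = 2 /\ ev m v = 0.
  suff [m [mx mv]] : exists m, ev m x = 1 /\ ev m v = 0.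
    by exists (2 *: m); rewrite !evZl mx mv mulr1 mulr0.
  apply: dual_separation1 => -[c xc]; move: fx; rewrite xc evZ fv => /eqP.
  rewrite mulf_eq0 (negbTE (two_neq0 R)) orbF => /eqP c0.
  by move: x0; rewrite xc c0 scale0r eqxx.
(* Eigenvectors of the exchange of x and v, with their dual functionals; the values f v = m x = 2
   make the two families biorthogonal. *)
pose e1 := 2^-1 *: (v + x); pose e2 := 2^-1 *: (v - x).
pose f1 : topdual X := 2^-1 *: (f + m); pose f2 : topdual X := 2^-1 *: (f - m).
have f1e1 : ev f1 e1 = 1 by rewrite !evE fv fx mx mv; field.
have f1e2 : ev f1 e2 = 0 by rewrite !evE fv fx mx mv; field.
have f2e1 : ev f2 e1 = 0 by rewrite !evE fv fx mx mv; field.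
have f2e2 : ev f2 e2 = 1 by rewrite !evE fv fx mx mv; field.
have Sx : (rank1 e1 f1 - rank1 e2 f2) x = v.
  by rewrite symmetryE; apply: ev_inj => k; rewrite !evE fx mx; field.
have Sv : (rank1 e1 f1 - rank1 e2 f2) v = x.
  by rewrite symmetryE; apply: ev_inj => k; rewrite !evE fv mv; field.
have := Phi_symmetry1 f1e1 f1e2 f2e1 f2e2; set S := _ - _ in Sx Sv * => PS.
have [|h' h'0 [e']] := @Phi_sim_rank1 S x f _ x0 f0.
  by apply: sim_rank1_nil; rewrite ?Sx ?Sv.
have /(scaler_injl (rank1_eq0 x0 f0)) <- : h *: rank1 x f = h' *: rank1 x f by rewrite -e.
have hf0 : h *: f != 0.
  by rewrite scaler_eq0 negb_or f0 (Phi_rank1_scal_neq0 x0 f0 e).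
have hfx : ev (h *: f) x = 0 by rewrite evZl fx mulr0.
rewrite PS => /(sim_rank1_nilP x0 hf0 hfx) [[]|[l []]].
  rewrite Sx evZl fv -{2}[2]mul1r => /(mulIf (two_neq0 R)) h1 _.
  by rewrite e h1 scale1r.
rewrite Sx => vl; move: fv; rewrite vl evZ fx mulr0 => /esym/eqP.
by rewrite (negbTE (two_neq0 R)).
Qed.

(** The image is diagonal with entries l, m on e1, e2. The fixed nilpotent built on x = e1 - e2 and
    f = (f1 + f2) / c is related to c S, which forces l - m = 2 c and l^2 = m^2. *)
Lemma Phi_symmetryZ e1 e2 f1 f2 c : ev f1 e1 = 1 -> ev f1 e2 = 0 ->
  ev f2 e1 = 0 -> ev f2 e2 = 1 ->
  Phi (c *: (rank1 e1 f1 - rank1 e2 f2)) = c *: (rank1 e1 f1 - rank1 e2 f2).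
Proof.
move=> f1e1 f1e2 f2e1 f2e2; have [->|c0] := eqVneq c 0; first by rewrite scale0r Phi0.
have [l [m E]] := Phi_symmetry f1e1 f1e2 f2e1 f2e2 c0.
set S := _ - _ in E *.
have e10 := ev1_neq0r f1e1.
pose x := e1 - e2; pose f : topdual X := c^-1 *: (f1 + f2).
have fx : ev f x = 0 by rewrite !evE f1e1 f1e2 f2e1 f2e2; ring.
have x0 : x != 0.
  apply: (@ev1_neq0r f1); by rewrite /x !evE f1e1 f1e2 subr0.
have f0 : f != 0.
  rewrite scaler_eq0 negb_or invr_eq0 c0 (@ev1_neq0 _ e1)//.
  by rewrite evDl f1e1 f2e1 addr0.
have Sx : (c *: S) x = c *: (e1 + e2).
  by rewrite bounded_opZE symmetryE !evE f1e1 f1e2 f2e1 f2e2; pairing_ring.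
have SSx : (c *: S) ((c *: S) x) = (c * c) *: x.
  rewrite Sx bounded_opZE symmetryE !evE f1e1 f1e2 f2e1 f2e2.
  by pairing_ring.
have Bx : Phi (c *: S) x = l *: e1 - m *: e2.
  by rewrite E !evE f1e1 f1e2 f2e1 f2e2; pairing_ring.
have BBx : Phi (c *: S) (Phi (c *: S) x) = (l * l) *: e1 - (m * m) *: e2.
  rewrite Bx E !evE f1e1 f1e2 f2e1 f2e2.
  by pairing_ring.
have : sim (Phi (c *: S)) (rank1 x f).
  rewrite -(Phi_nilpotent fx) -Phi_sim; apply: sim_rank1_nil => //.
    by rewrite Sx !evE f1e1 f1e2 f2e1 f2e2; field.
  by rewrite SSx !evE f1e1 f1e2 f2e1 f2e2; ring.
case/(sim_rank1_nilP x0 f0 fx) => [[]|[a []]].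
  rewrite BBx Bx !evE f1e1 f1e2 f2e1 f2e2 => h1 h2.
  have lm : l - m = 2 * c.
    by apply: (mulfI (_ : c^-1 != 0)); rewrite ?invr_eq0// mulrCA mulVf// mulr1 -h1; ring.
  have lm' : l + m = 0.
    have : c^-1 * ((l - m) * (l + m)) = 0 by rewrite -h2; ring.
    by rewrite lm => /eqP; rewrite !mulf_eq0 invr_eq0 (negbTE c0) (negbTE (two_neq0 R)) => /eqP.
  have lc : l = c by apply: (mulfI (two_neq0 R)); rewrite -lm -[RHS]addr0 -lm'; ring.
  have mc : m = - c by apply/eqP; rewrite -addr_eq0 addrC -lc lm'.
  apply: bounded_op_ext => z; rewrite E lc mc bounded_opZE symmetryE.
  by pairing_ring.
rewrite Bx => Bxa fB.
have la : l = a.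
  by have := congr1 (ev f1) Bxa; rewrite /x !evE f1e1 f1e2 mulr0 mulr1 subr0 => ->; ring.
have ma : m = a.
  have := congr1 (ev f2) Bxa; rewrite /x !evE f2e1 f2e2 mulr0 mulr1 sub0r => h.
  by apply: oppr_inj; rewrite h; ring.
have a0 : a = 0.
  have := fB e1; rewrite E !evE f1e1 f2e1 f1e2 f2e2 la ma => /eqP; rewrite -subr_eq0.
  set t := (X in X == 0); have -> : t = 2 * c^-1 * a by rewrite /t; ring.
  by rewrite !mulf_eq0 invr_eq0 (negbTE c0) (negbTE (two_neq0 R)) => /eqP.
have /Phi_eq0 /(congr1 (fun B : 'B(X) => B e1)) : Phi (c *: S) = 0.
  by apply: bounded_op_ext => z; rewrite E la ma a0 !mul0r !scale0r addr0.
rewrite bounded_opZE symmetryE f1e1 f2e1 scale0r subr0 scale1r bounded_op0E => /eqP.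
by rewrite scaler_eq0 (negbTE c0) (negbTE e10).
Qed.

Lemma biorthogonal_complement x f : ev f x = 1 -> exists y g,
  [/\ ev f y = 0, ev g x = 0 & ev g y = 1].
Proof.
move=> fx; have [y ny] := Xinf [:: x].
have [k [ky kx]] : exists k, ev k y = 1 /\ ev k x = 0.
  by apply: dual_separation1 => h; apply: ny; apply/in_span1P.
exists (y - ev f y *: x), k; rewrite !(evD, evN, evZ) fx kx ky.
by rewrite mulr1 subrr mulr0 subr0.
Qed.

(** For f x nonzero the scalar is pinned by a fixed multiple of a reflection, chosen to have x as an
    eigenvector with eigenvalue 1 / f x. *)
Lemma Phi_rank1 x f : Phi (rank1 x f) = rank1 x f.
Proof.
have [|a0] := eqVneq (ev f x) 0; first exact: Phi_nilpotent.
have x0 : x != 0 by apply: contra_neq a0 => ->; rewrite ev0.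
have f0 : f != 0 by apply: contra_neq a0 => ->; rewrite ev0l.
have [f1 f1x] : exists f1, ev f1 x = 1.
  by exists ((ev f x)^-1 *: f); rewrite evZl mulVf.
have [e2 [k [f1e2 kx ke2]]] := biorthogonal_complement f1x.
have ai0 : (ev f x)^-1 != 0 by rewrite invr_eq0.
have PS := Phi_symmetryZ (ev f x)^-1 f1x f1e2 kx ke2.
have Sx : ((ev f x)^-1 *: (rank1 x f1 - rank1 e2 k)) x = (ev f x)^-1 *: x.
  by rewrite bounded_opZE symmetryE f1x kx scale1r scale0r subr0.
have := @Phi_sim_rank1 _ x f (eig_of_sim ai0 Sx (esym (invrK _))) x0 f0.
rewrite PS => -[h h0 [e H]].
suff h1 : h = 1 by rewrite e h1 scale1r.
have ha0 : ev (h *: f) x != 0 by rewrite evZl mulf_neq0.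
have [|/(_ x)|[]] := sim_rank1 ha0 H.
- rewrite Sx scalerA evZl mulfK// -{2}(scale1r x); exact: scaler_injl.
- rewrite -{2}[ev (h *: f) x]mulr1 => /(mulfI ha0).
  by rewrite Sx evZ evZl mulrCA mulVf// mulr1.
- by rewrite Sx => /eqP; rewrite scaler_eq0 (negbTE ai0) (negbTE x0).
Qed.

End rank1_fixed.

(** * Rank one operators separate non-algebraic operators *)

Section nonalgebraic.
Variables (R : realType) (X : normedModType R[i]).
Implicit Types (x y z w : X) (f g k : topdual X) (A B M : 'B(X)).

Lemma in_span_map (v : nat -> X) r x : uniq r -> in_span (map v r) x ->
  exists c : nat -> R[i], x = \sum_(j <- r) c j *: v j.
Proof.
elim: r x => [x _ ->|i r ih x /= /andP[ir /ih{}ih] [d /ih [c e]]].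
  by exists (fun=> 0); rewrite big_nil.
exists (fun j => if j == i then d else c j).
rewrite big_cons eqxx -[LHS](subrK (d *: v i)) e addrC; congr (_ + _).
by apply: eq_big_seq => j jr; rewrite (negbTE (memPn ir j jr)).
Qed.

Lemma free_or_dependent (n : nat) (v : nat -> X) :
  (exists g : nat -> topdual X, forall i j, (i < n)%N -> (j < n)%N ->
     ev (g i) (v j) = (i == j)%:R) \/
  (exists c : nat -> R[i], (exists2 i, (i < n)%N & c i != 0) /\
     \sum_(i < n) c i *: v i = 0).
Proof.
pose others i := [seq j <- iota 0 n | j != i].
have [[i [ni]]|h] := pselect (exists i, (i < n)%N /\ in_span (map v (others i)) (v i)).
  case/in_span_map => [|c e]; first by rewrite filter_uniq// iota_uniq.
  right; exists (fun j => if j == i then -1 else c j); split.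
    by exists i => //; rewrite eqxx oppr_eq0 oner_neq0.
  rewrite (bigD1 (Ordinal ni))//= eqxx scaleN1r {1}e big_filter.
  rewrite -[X in iota _ X]subn0 big_mkord addrC -sumrB big1 // => j ji.
  by case: eqP => [ij|_]; [case/eqP: ji; exact: val_inj|rewrite subrr].
left; have /choice [g gP] i : exists g : topdual X, (i < n)%N ->
    forall j, (j < n)%N -> ev g (v j) = (i == j)%:R.
  have [ni|] := boolP (i < n)%N; last by exists 0.
  have [|g [gi gs]] := @dual_separation _ _ (map v (others i)) (v i).
    by move=> hi; apply: h; exists i.
  exists g => _ j nj; case: eqVneq => [<- //|ij]; apply: gs; apply: map_f.
  by rewrite mem_filter eq_sym ij mem_iota.
by exists g => i j ni; exact: gP.
Qed.

Definition cyclic_free A n z : Prop := exists g : nat -> topdual X,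
  forall i j, (i < n)%N -> (j < n)%N -> ev (g i) ((A ^+ j) z) = (i == j)%:R.

Lemma exprSv A n z : (A ^+ n.+1) z = A ((A ^+ n) z).
Proof. by rewrite exprS bounded_opME. Qed.

Lemma exprSrv A n z : (A ^+ n.+1) z = (A ^+ n) (A z).
Proof. by rewrite exprSr bounded_opME. Qed.

Lemma exprDv A n m z : (A ^+ (n + m)) z = (A ^+ n) ((A ^+ m) z).
Proof. by rewrite exprD bounded_opME. Qed.

(** All [f] with f x = f (A^2 x) = 0 and f (A x) = 1 satisfy f (B x) = 1 and f (B^2 x) = 0. Any [k]
    vanishing at x and A^2 x gets this normalization after adding a multiple of one such [f]. *)
Lemma nil_span A B x : rank1_equiv A B -> ~ in_span [:: x; A (A x)] (A x) ->
  (exists a c, B x = A x + a *: x + c *: A (A x)) /\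
  in_span [:: x; A (A x)] (B (B x)).
Proof.
move=> h /dual_separation2 [f [f1 f0 f2]].
have [fB1 fB2] := rank1_equiv_nil h f0 f2 f1.
have key k : ev k x = 0 -> ev k (A (A x)) = 0 ->
    ev k (B x) = ev k (A x) /\ ev k (B (B x)) = 0.
  move=> k0 k2; pose t := 1 - ev k (A x).
  have [] := @rank1_equiv_nil _ _ A B x (k + t *: f) h.
  - by rewrite evDl evZl k0 f0 mulr0 addr0.
  - by rewrite evDl evZl k2 f2 mulr0 addr0.
  - by rewrite evDl evZl f1 /t; ring.
  rewrite !evDl !evZl fB1 fB2 mulr1 mulr0 addr0 /t => e ->; split=> //.
  by apply/eqP; rewrite -subr_eq0 -[X in _ == X](subrr 1) -{1}e; apply/eqP; ring.
split; last first.
  by apply: contrapT => /dual_separation2 [k [k1 k0 k2]]; have [_] := key k k0 k2;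
    rewrite k1 => /eqP; rewrite oner_eq0.
have : in_span [:: x; A (A x)] (B x - A x).
  apply: contrapT => /dual_separation2 [k [k1 k0 k2]]; have [e _] := key k k0 k2.
  by move: k1; rewrite evD evN e subrr => /eqP; rewrite eq_sym oner_eq0.
by move=> /in_span2P [a [c e]]; exists a, c; rewrite -addrA -e addrC subrK.
Qed.

Section four.
Variables (A B : 'B(X)) (g : nat -> topdual X) (z0 z1 z2 z3 : X).
Hypothesis AB : rank1_equiv A B.
Hypotheses (Az0 : A z0 = z1) (Az1 : A z1 = z2) (Az2 : A z2 = z3).
Hypothesis g0 : [/\ ev (g 0) z0 = 1, ev (g 0) z1 = 0, ev (g 0) z2 = 0 & ev (g 0) z3 = 0].
Hypothesis g1 : [/\ ev (g 1) z0 = 0, ev (g 1) z1 = 1, ev (g 1) z2 = 0 & ev (g 1) z3 = 0].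
Hypothesis g2 : [/\ ev (g 2) z0 = 0, ev (g 2) z1 = 0, ev (g 2) z2 = 1 & ev (g 2) z3 = 0].
Hypothesis g3 : [/\ ev (g 3) z0 = 0, ev (g 3) z1 = 0, ev (g 3) z2 = 0 & ev (g 3) z3 = 1].

(** [nil_span] holds at z0, z1 and z0 + z1, each time with coefficients of its own. Additivity of B
    and the independence of z0, ..., z3 force them to agree. *)
Lemma nil_span_coef : exists a c,
  [/\ B z0 = z1 + a *: z0 + c *: z2, B z1 = z2 + a *: z1 + c *: z3 &
      in_span [:: z0; z2] (B (B z0))].
Proof.
move: g0 g1 g2 g3 => [e00 e01 e02 e03] [e10 e11 e12 e13] [e20 e21 e22 e23] [e30 e31 e32 e33].
have E := (e00, e01, e02, e03, e10, e11, e12, e13, e20, e21, e22, e23, (e30, e31, e32, e33)).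
have [|[a [c Bz0]] BBz0] := @nil_span A B z0 AB.
  rewrite Az0 Az1 => /in_span2P [s [t /(congr1 (ev (g 1)))]].
  by rewrite !evE !E !mulr0 addr0 => /eqP; rewrite oner_eq0.
have [|[a' [c' Bz1]] _] := @nil_span A B z1 AB.
  rewrite Az1 Az2 => /in_span2P [s [t /(congr1 (ev (g 2)))]].
  by rewrite !evE !E !mulr0 addr0 => /eqP; rewrite oner_eq0.
have [|[b [d Bz]] _] := @nil_span A B (z0 + z1) AB.
  rewrite !opD Az0 Az1 Az2 => /in_span2P [s [t e]].
  have := congr1 (ev (g 1)) e; have := congr1 (ev (g 0)) e.
  rewrite !evE !E; set s' := s * _; have -> : s' = s by rewrite /s'; ring.
  rewrite !addr0 !mulr0 !addr0 => <-; rewrite !mul0r => /eqP.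
  by rewrite oner_eq0.
rewrite Az0 Az1 in Bz0 BBz0; rewrite Az1 Az2 in Bz1.
rewrite !opD Az0 Az1 Az2 Bz0 Bz1 in Bz.
have ab : a = b.
  by have := congr1 (ev (g 0)) Bz; rewrite !evE !E => h; rewrite -[RHS]add0r -[LHS]add0r; move: h; rewrite !(mulr1, mulr0, addr0, add0r).
have ab' : a' = b.
  by have := congr1 (ev (g 1)) Bz; rewrite !evE !E !(mulr1, mulr0, addr0, add0r) => /addrI.
have cd : c = d.
  by have := congr1 (ev (g 2)) Bz; rewrite !evE !E !(mulr1, mulr0, addr0, add0r) addrC => /addrI.
have cd' : c' = d.
  by have := congr1 (ev (g 3)) Bz; rewrite !evE !E !(mulr1, mulr0, addr0, add0r).
by exists a, c; split=> //; rewrite Bz1 ab' -ab cd' -cd.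
Qed.

End four.

(** The windows z0, ..., z3 and z1, ..., z4 overlap, so they share the coefficients a and c. Then
    B^2 z0, which lies in the span of z0 and z2, has the coefficient 2 a at z1 and c^2 at z4. *)
Lemma cyclic_free_eq A B z : rank1_equiv A B -> cyclic_free A 5 z -> B z = A z.
Proof.
move=> AB [g gP].
pose z_ i := (A ^+ i) z.
have Az i : A (z_ i) = z_ i.+1 by rewrite /z_ exprSv.
have gz i j : (i < 5)%N -> (j < 5)%N -> ev (g i) (z_ j) = (i == j)%:R by exact: gP.
have z0E : z_ 0%N = z by [].
clearbody z_.
have [|||| a [c [B0 B1 BB]]] :=
  @nil_span_coef A B g _ _ _ _ AB (Az 0%N) (Az 1%N) (Az 2%N).
1-4: by split; rewrite gz.
have [|||| a' [c' [B1' B2 _]]] :=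
  @nil_span_coef A B (fun i => g i.+1) _ _ _ _ AB (Az 1%N) (Az 2%N) (Az 3%N).
1-4: by split; rewrite gz.
have aa : a' = a.
  have := congr1 (ev (g 1%N)) B1'; rewrite B1 !evE !gz//=.
  by rewrite !(mulr1, mulr0, addr0, add0r).
have cc : c' = c.
  have := congr1 (ev (g 3%N)) B1'; rewrite B1 !evE !gz//=.
  by rewrite !(mulr1, mulr0, addr0, add0r).
rewrite aa cc in B2; move: BB.
rewrite B0 !opD !opZ B1 B0 B2 => /in_span2P [s [t e]].
have a0 : a = 0.
  have := congr1 (ev (g 1%N)) e; rewrite !evE !gz//= => /eqP.
  rewrite !(mulr1, mulr0, addr0, add0r) -mulr2n -mulr_natr mulf_eq0.
  by rewrite (negbTE (two_neq0 R)) orbF => /eqP.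
have c0 : c = 0.
  have := congr1 (ev (g 4%N)) e; rewrite !evE !gz//= => /eqP.
  by rewrite !(mulr1, mulr0, addr0, add0r) mulf_eq0 orbb => /eqP.
by rewrite -z0E B0 a0 c0 !scale0r !addr0 Az.
Qed.

(** Against the dual family of z, the orbit of y + t z has the matrix t + H, which is invertible
    unless t is an eigenvalue of -H. *)
Lemma cyclic_free_generic A n z y : cyclic_free A n z ->
  exists t, cyclic_free A n (y + t *: z).
Proof.
move=> [g gP].
pose H := \matrix_(i < n, j < n) ev (g i) ((A ^+ j) y).
have /closed_nonrootP [t nt] : char_poly (- H) != 0.
  by rewrite monic_neq0 ?char_poly_monic.
exists t; pose M := scalar_mx t + H.
have Mu : M \in unitmx.
  rewrite unitmxE unitfE.
  move: nt; rewrite -eigenvalue_root_char => /negP ne; apply/negP => /det0P.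
  move=> [v v0 vM]; apply: ne; apply/eigenvalueP; exists v => //.
  move: vM; rewrite mulmxDr mul_mx_scalar mulmxN => /eqP.
  by rewrite addr_eq0 => /eqP ->.
exists (fun i => if insub i is Some i' then \sum_(k < n) invmx M i' k *: g k else 0).
move=> i j ni nj; rewrite insubT /=.
have -> : ev (\sum_(k < n) invmx M (Sub i ni) k *: g k) ((A ^+ j) (y + t *: z)) =
    \sum_(k < n) invmx M (Ordinal ni) k * M k (Ordinal nj).
  have -> : ev (\sum_(k < n) invmx M (Sub i ni) k *: g k) ((A ^+ j) (y + t *: z)) =
      \sum_(k < n) invmx M (Ordinal ni) k * ev (g k) ((A ^+ j) (y + t *: z)).
    by elim/big_ind2: _ => // a b c d <- <-; rewrite evDl.
  apply: eq_bigr => k _; congr (_ * _); rewrite !mxE opD opZ evD evZ addrC.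
  congr (_ + _); rewrite gP//; have -> : (k == Ordinal nj) = (nat_of_ord k == j) by [].
  by case: eqP => _; rewrite ?mulr1 ?mulr0.
have := congr1 (fun N : matrix _ n n => N (Ordinal ni) (Ordinal nj)) (mulVmx Mu).
by rewrite !mxE => ->.
Qed.

Lemma cyclic_free_all A B z : rank1_equiv A B -> cyclic_free A 5 z -> B = A.
Proof.
move=> AB fz; apply: bounded_op_ext => y.
have [t ft] := cyclic_free_generic y fz.
have := cyclic_free_eq AB ft; rewrite !opD !opZ (cyclic_free_eq AB fz).
exact: addIr.
Qed.

End nonalgebraic.

(** * Algebraic operators *)

Section operator_polynomials.
Variables (R : realType) (X : normedModType R[i]).
Implicit Types (x y z w : X) (f g k : topdual X) (A B M : 'B(X)) (p q r s : {poly R[i]}).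

Definition opoly A p : 'B(X) := \sum_(i < size p) p`_i *: A ^+ i.

Lemma opolyE A p n : (size p <= n)%N -> opoly A p = \sum_(i < n) p`_i *: A ^+ i.
Proof.
move=> pn; rewrite /opoly (big_ord_widen n (fun i => p`_i *: A ^+ i) pn) big_mkcond /=.
by apply: eq_bigr => i _; case: ltnP => // h; rewrite nth_default ?scale0r.
Qed.

Lemma opolyD A p q : opoly A (p + q) = opoly A p + opoly A q.
Proof.
set n := maxn (size p) (size q).
rewrite (@opolyE _ (p + q) n) ?size_polyD// (@opolyE _ p n) ?leq_maxl//.
rewrite (@opolyE _ q n) ?leq_maxr// -big_split /=.
by apply: eq_bigr => i _; rewrite coefD scalerDl.
Qed.

Lemma opolyZ A c p : opoly A (c *: p) = c *: opoly A p.
Proof.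
rewrite (@opolyE _ (c *: p) (size p)) ?size_scale_leq// scaler_sumr.
by apply: eq_bigr => i _; rewrite coefZ scalerA.
Qed.

Lemma opolyC A c : opoly A c%:P = c *: (1 : 'B(X)).
Proof.
by rewrite (@opolyE _ _ 1) ?size_polyC_leq1// big_ord1 coefC expr0.
Qed.

Lemma opoly0 A : opoly A 0 = 0.
Proof. by rewrite /opoly size_poly0 big_ord0. Qed.

Lemma opoly1 A : opoly A 1 = 1. Proof. by rewrite opolyC scale1r. Qed.

Lemma opZl (c : R[i]) A B : (c *: A) * B = c *: (A * B).
Proof. exact: bounded_op_ext. Qed.

Lemma opZr (c : R[i]) A B : A * (c *: B) = c *: (A * B).
Proof. by apply: bounded_op_ext => x; rewrite bounded_opME !bounded_opZE opZ. Qed.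

Lemma opolyXM A p : opoly A (p * 'X) = A * opoly A p.
Proof.
rewrite (@opolyE _ (p * 'X) (size p).+1); last first.
  by rewrite (leq_trans (size_polyMleq _ _))// size_polyX addn2.
rewrite big_ord_recl coefMX eqxx scale0r add0r mulr_sumr.
by apply: eq_bigr => i _; rewrite coefMX /= opZr exprS.
Qed.

Lemma opolyM A p q : opoly A (p * q) = opoly A p * opoly A q.
Proof.
elim/poly_ind: p => [|p c ih]; first by rewrite mul0r opoly0 mul0r.
rewrite mulrDl -mulrA (mulrC 'X) mulrA opolyD opolyXM ih mul_polyC opolyZ.
by rewrite opolyD opolyXM opolyC mulrDl opZl mul1r mulrA.
Qed.

Lemma opoly_comm A p q x : opoly A p (opoly A q x) = opoly A q (opoly A p x).
Proof. by rewrite -!bounded_opME -!opolyM mulrC. Qed.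

Lemma opolyX A : opoly A 'X = A.
Proof. by rewrite -['X]mul1r opolyXM opoly1 mulr1. Qed.

Lemma opolyXsubC A c : opoly A ('X - c%:P) = A - c *: (1 : 'B(X)).
Proof. by rewrite opolyD opolyX -polyCN opolyC scaleNr. Qed.

Lemma opolyXn A p n : opoly A (p ^+ n) = opoly A p ^+ n.
Proof. by elim: n => [|n ih]; rewrite ?expr0 ?opoly1// !exprS opolyM ih. Qed.

(** The local minimal polynomial of A at z, up to a constant factor. *)
Definition annihilator A z p : Prop :=
  p != 0 /\ forall s, opoly A s z = 0 <-> p %| s.

Lemma annihilator_exists A z s : s != 0 -> opoly A s z = 0 ->
  exists p, annihilator A z p.
Proof.
move=> s0 sz.
have ex : exists n, `[< exists p, [/\ p != 0, opoly A p z = 0 & size p = n] >].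
  by exists (size s); apply/asboolP; exists s.
case: (ex_minnP ex) => n /asboolP [p [p0 pz pn]] nmin.
exists p; split=> // q; split=> [qz|/dvdpP [t ->]]; last first.
  by rewrite opolyM bounded_opME pz op0.
rewrite /dvdp; apply: contraT => r0.
have : (n <= size (q %% p)%R)%N.
  apply: nmin; apply/asboolP; exists (q %% p); split=> //.
  have := qz; rewrite {1}(divp_eq q p) opolyD opolyM bounded_opDE bounded_opME pz op0 add0r//.
by rewrite leqNgt -pn ltn_modp p0.
Qed.

(** Over an algebraically closed field non-divisibility shows at a single root: [l] is a root of r /
    gcd (p, r), hence not one of p / gcd (p, r). *)
Lemma not_dvdp_root p r : p != 0 -> r != 0 -> ~~ (r %| p) ->
  exists l a p1 r1, [/\ ~~ root p1 l, p = p1 * ('X - l%:P) ^+ a &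
    r = r1 * ('X - l%:P) ^+ a.+1].
Proof.
move=> p0 r0 nrp.
have [p' pE] := dvdpP _ _ (dvdp_gcdl p r); have [r' rE] := dvdpP _ _ (dvdp_gcdr p r).
have g0 : gcdp p r != 0 by rewrite gcdp_eq0 negb_and p0.
have cop : coprimep r' p'.
  have := @coprimep_div_gcd _ p r; rewrite p0 => /(_ isT).
  have -> : p %/ gcdp p r = p' by rewrite {1}pE mulpK.
  have -> : r %/ gcdp p r = r' by rewrite {1}rE mulpK.
  by rewrite coprimep_sym.
have /closed_rootP [l r'l] : size r' != 1%N.
  apply: contra nrp => /size_poly1P [c c0 r'c].
  by rewrite rE r'c mul_polyC dvdpZl ?dvdp_gcdl.
have p'l := coprimep_root cop r'l.
have [a [p1 p1l p1E]] := multiplicity_XsubC p l; rewrite p0 /= in p1l.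
have eg : ('X - l%:P) ^+ a %| gcdp p r.
  have cp : coprimep (('X - l%:P) ^+ a) p'.
    by apply: coprimep_expl; rewrite coprimep_sym coprimep_XsubC.
  by rewrite -(Gauss_dvdpr _ cp) -pE p1E dvdp_mull.
have : ('X - l%:P) ^+ a.+1 %| r.
  by rewrite rE exprS dvdp_mul// dvdp_XsubCl.
by move=> /dvdpP [r1 r1E]; exists l, a, p1, r1.
Qed.

(* Local algebraicity of bounded degree is global (Kaplansky): otherwise two
   coprime annihilators multiply to one of larger degree. *)
Lemma algebraic_of_locally A N :
  (forall z, exists p, [/\ p != 0, (size p <= N)%N & opoly A p z = 0]) ->
  exists2 p, p != 0 & opoly A p = 0.
Proof.
move=> h.
have ann z : exists p, annihilator A z p.
  by have [p [p0 _ pz]] := h z; exact: annihilator_exists p0 pz.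
have annN z p : annihilator A z p -> (size p <= N)%N.
  move=> [p0 pz]; have [q [q0 qN qz]] := h z.
  exact: leq_trans (dvdp_leq q0 ((pz _).1 qz)) qN.
have ex : exists n, `[< exists z p, annihilator A z p /\ size p = n >].
  by have [p pP] := ann 0; exists (size p); apply/asboolP; exists 0, p.
have exN n : `[< exists z p, annihilator A z p /\ size p = n >] -> (n <= N)%N.
  by move=> /asboolP [z [p [/annN pN <-]]].
case: (ex_maxnP ex exN) => n /asboolP [z [p [[p0 pz] pn]]] nmax.
exists p => //; apply: bounded_op_ext => y; rewrite bounded_op0E.
have [r [r0 ry]] := ann y; apply/ry; apply: contraT => nrp.
have [l [a [p1 [r1 [p1l pE rE]]]]] := not_dvdp_root p0 r0 nrp.
set e := 'X - l%:P in pE rE.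
have e0 : e != 0 by rewrite polyXsubC_eq0.
have cop : coprimep (e ^+ a.+1) p1.
  by apply: coprimep_expl; rewrite coprimep_sym coprimep_XsubC.
have p10 : p1 != 0 by apply: contraNneq p1l => ->; rewrite root0.
(* The first summand has annihilator [p1], the second e^(a+1). As these are coprime, only multiples
   of their product p e annihilate the sum. *)
have [s [s0 sP]] := ann (opoly A (e ^+ a) z + opoly A r1 y).
have sz := (sP s).2 (dvdpp s); rewrite opD in sz.
have ds : e ^+ a.+1 * p1 %| s.
  rewrite Gauss_dvdp//; apply/andP; split.
    rewrite -(Gauss_dvdpl _ cop).
    have r10 : r1 != 0 by apply: contra_neq r0 => r10; rewrite rE r10 mul0r.
    rewrite -(dvdp_mul2l _ _ r10) -rE; apply/ry.
    have := congr1 (opoly A p1) sz.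
    rewrite op0 opD -!bounded_opME -!opolyM.
    rewrite (_ : p1 * s * e ^+ a = s * p); last by rewrite pE; ring.
    rewrite opolyM bounded_opME ((pz p).2 (dvdpp p)) op0 add0r.
    by rewrite (_ : p1 * s * r1 = r1 * (s * p1)); last by ring.
  rewrite -(@Gauss_dvdpl _ _ (e ^+ a.+1)); last by rewrite coprimep_sym.
  have ea0 : e ^+ a != 0 by rewrite expf_neq0.
  rewrite -(dvdp_mul2r _ _ ea0) -pE; apply/pz.
  have := congr1 (opoly A (e ^+ a.+1)) sz.
  rewrite op0 opD -!bounded_opME -!opolyM.
  rewrite (_ : e ^+ a.+1 * s * r1 = s * r); last by rewrite rE; ring.
  rewrite (opolyM A s r) bounded_opME ((ry r).2 (dvdpp r)) op0 addr0.
  by rewrite (_ : e ^+ a.+1 * s * e ^+ a = s * e ^+ a.+1 * e ^+ a); last by ring.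
have : (size s <= n)%N.
  by apply: nmax; apply/asboolP; exists (opoly A (e ^+ a) z + opoly A r1 y), s.
have /(leq_trans (dvdp_leq s0 ds)) : (size s <= size s)%N by [].
move=> h1 h2; have := leq_trans h1 h2; rewrite -pn.
have -> : e ^+ a.+1 * p1 = p * e by rewrite pE exprS; ring.
by rewrite size_mul// size_XsubC addn2 ltnn.
Qed.

End operator_polynomials.

(** * Jordan chains *)

Section primary_components.
Variables (R : realType) (X : normedModType R[i]).
Implicit Types (x y z w : X) (f g k : topdual X) (A B M : 'B(X)).

(* M is algebraic and semisimple, with spectrum in {0, r1, r2}. *)
Definition cubic M : Prop := exists r1 r2 : R[i],
  [/\ r1 != 0, r2 != 0, r1 != r2 &
      forall x, M (M (M x)) = (r1 + r2) *: M (M x) - (r1 * r2) *: M x].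

Lemma cubicZ c M : c != 0 -> cubic M -> cubic (c *: M).
Proof.
move=> c0 [r1 [r2 [r10 r20 r12 hM]]]; exists (c * r1), (c * r2).
split; rewrite ?mulf_neq0//; first by rewrite (inj_eq (mulfI c0)).
move=> x; rewrite !opE hM.
by pairing_ring.
Qed.

Definition test_equiv A B : Prop :=
  rank1_equiv A B /\ forall M, cubic M -> (sim A M <-> sim B M).

Lemma test_equivZ c A B : c != 0 -> test_equiv A B -> test_equiv (c *: A) (c *: B).
Proof.
move=> c0 [h1 h2]; split=> [x f|M cM].
  by rewrite !simZ -rank1Z; exact: h1.
by rewrite !simZ; apply/h2/cubicZ.
Qed.

Lemma test_equiv_jperp A B M : test_equiv A B -> cubic M -> jperp A M -> jperp B M.
Proof.
move=> [_ h] cM AM; apply: (@sim_jperp _ _ _ _ 2); rewrite ?two_neq0 ?two_neq1//.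
  exact/h/jperp_sim.
by apply/h; [apply: cubicZ => //; exact: two_neq0|exact/jperp_sim/jperpZ].
Qed.

(** * Jordan chains of eigenvalue 0 *)

Section nilpotent.
Variables (A : 'B(X)) (x : X) (k : nat) (f : topdual X).
Hypothesis Akx : (A ^+ k.+1) x = 0.
Hypothesis fA : forall y, ev f ((A ^+ k.+1) y) = 0.
Hypothesis fx : ev f ((A ^+ k) x) = 1.

Lemma pow_big l y : (A ^+ k.+1) y = 0 -> (k < l)%N -> (A ^+ l) y = 0.
Proof. by move=> Ay kl; rewrite -(subnK kl) exprDv Ay op0. Qed.

(** Triangular elimination: subtracting from g a multiple of g o A^(j+1) clears its value at
    A^(k-j-1) x and leaves the later values alone, since A^(k+1) x = 0. *)
Lemma normalized_functional : exists g, (forall y, ev g ((A ^+ k.+1) y) = 0) /\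
  forall l, ev g ((A ^+ l) x) = (l == k)%:R.
Proof.
have H j : (j <= k)%N -> exists g, (forall y, ev g ((A ^+ k.+1) y) = 0) /\
    forall l, (k - j <= l)%N -> (l <= k)%N -> ev g ((A ^+ l) x) = (l == k)%:R.
  elim: j => [_|j ih jk].
    exists f; split=> // l; rewrite subn0 => kl lk.
    by have -> : l = k; [apply/eqP; rewrite eqn_leq lk|rewrite eqxx].
  have [g [gA gx]] := ih (ltnW jk).
  have kj : (k - j.+1 + j.+1 = k)%N by rewrite subnK.
  exists (g - ev g ((A ^+ (k - j.+1)) x) *: adjoint (A ^+ j.+1) g); split=> [y|l].
    rewrite evDl evNl evZl ev_adj gA -exprDv addnC exprDv.
    by rewrite gA mulr0 subr0.
  rewrite leq_eqVlt => /orP[/eqP <- _|kl lk].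
    rewrite evDl evNl evZl ev_adj -exprDv addnC kj (gx k) ?leq_subr ?leqnn//.
    by rewrite eqxx mulr1 subrr ltn_eqF// -[X in (_ < X)%N]kj addnS ltnS leq_addr.
  rewrite evDl evNl evZl ev_adj -exprDv (gx l)//; last first.
    by move: kl; rewrite subnS prednK ?subn_gt0.
  rewrite (@pow_big (j.+1 + l)) ?ev0 ?mulr0 ?subr0//.
  by rewrite -{1}kj addnC ltn_add2l.
have [g [gA gx]] := H k (leqnn k); exists g; split=> // l.
have [lk|kl] := leqP l k; last by rewrite pow_big// ev0 gtn_eqF.
by apply: gx; rewrite ?subnn.
Qed.

(** The functionals g o A^(k-j) are the coordinates along the chain. M alternates signs on the
    chain, hence anticommutes with A, and M^3 = M. *)
Lemma signed_block : exists M, [/\ cubic M, jperp A M &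
  forall i, (i <= k)%N -> M ((A ^+ i) x) = (-1) ^+ i *: (A ^+ i) x].
Proof.
have [g [gA gx]] := normalized_functional.
have [M ME] : exists M : 'B(X), forall y, M y =
    \sum_(j < k.+1) ((-1) ^+ j * ev g ((A ^+ (k - j)) y)) *: (A ^+ j) x.
  exists (\sum_(j < k.+1) (-1) ^+ j *: rank1 ((A ^+ j) x) (adjoint (A ^+ (k - j)) g)).
  move=> y; elim/big_ind2: _ => // [a b c d <- <-//|j _].
  by rewrite bounded_opZE rank1E scalerA ev_adj.
have Mx i : (i <= k)%N -> M ((A ^+ i) x) = (-1) ^+ i *: (A ^+ i) x.
  move=> ik; rewrite ME (bigD1 (Ordinal (ik : (i < k.+1)%N)))//= big1.
    by rewrite -exprDv subnK// gx eqxx mulr1 addr0.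
  move=> j /negP ij; rewrite -exprDv gx.
  case: eqP => [e|_]; last by rewrite mulr0 scale0r.
  case: ij; apply/eqP/val_inj => /=; apply/eqP.
  have jk : (j <= k)%N by rewrite -ltnS.
  by rewrite -(eqn_add2l (k - j)) e subnK.
have Msum (c : 'I_k.+1 -> R[i]) : M (\sum_(j < k.+1) c j *: (A ^+ j) x) =
    \sum_(j < k.+1) ((-1) ^+ j * c j) *: (A ^+ j) x.
  transitivity (\sum_(j < k.+1) c j *: M ((A ^+ j) x)).
    elim/big_ind2: _ => [|a b c' d <- <-|j _]; [exact: op0|exact: opD|exact: opZ].
  by apply: eq_bigr => j _; rewrite (Mx j (leq_ord j)) scalerA mulrC.
exists M; split=> //.
  exists 1, (-1); split; rewrite ?m1_neq0 ?oner_neq0 1?eq_sym ?m1_neq1//.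
  move=> y; rewrite subrr scale0r mul1r scaleN1r sub0r opprK (ME y) !Msum.
  apply: eq_bigr => j _; congr (_ *: _).
  have s2 : (-1) ^+ j * (-1) ^+ j = 1 :> R[i] by rewrite -expr2 sqrr_sign.
  by rewrite !mulrA s2 mul1r.
move=> y; rewrite /jd !ME.
have -> : A (\sum_(j < k.+1) ((-1) ^+ j * ev g ((A ^+ (k - j)) y)) *: (A ^+ j) x) =
    \sum_(j < k.+1) ((-1) ^+ j * ev g ((A ^+ (k - j)) y)) *: (A ^+ j.+1) x.
  elim/big_ind2: _ => [|a b c d <- <-|j _]; [exact: op0|exact: opD|].
  by rewrite opZ exprSv.
(* The two sums cancel after a shift of the index. The unmatched end terms vanish because A^(k+1) x
   = 0 and g o A^(k+1) = 0. *)
rewrite big_ord_recr /= Akx scaler0 addr0.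
rewrite [X in _ + X]big_ord_recl /= subn0 -exprSrv gA mulr0 scale0r add0r.
rewrite -big_split big1 //= => j _; rewrite -exprSrv /bump /= add1n subnSK//.
by rewrite [(-1) ^+ j.+1]exprS mulN1r mulNr scaleNr subrr.
Qed.

(** By [nil_span], B x = A x + a x + c A^2 x. The signed block fixes x and A^2 x and negates A x, so
    its vanishing Jordan product with B, taken at x, is 2 (a x + c A^2 x). *)
Lemma nilpotent_chain_eq B : test_equiv A B -> (0 < k)%N -> B x = A x.
Proof.
move=> AB k0; have [M [cM AM Mx]] := signed_block.
have Akx0 : (A ^+ k) x != 0 by exact: (ev1_neq0r fx).
have [|[a [c Bx]] _] := @nil_span _ _ A B x AB.1.
  move=> /in_span2P [s [t e]].
  have s0 : s = 0.
    have := congr1 (A ^+ k) e; rewrite opD !opZ -!exprSrv Akx.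
    rewrite (@pow_big k.+2)// scaler0 addr0 => /esym/eqP.
    by rewrite scaler_eq0 (negbTE Akx0) orbF => /eqP.
  have := congr1 (A ^+ k.-1) e; rewrite s0 scale0r add0r opZ -!exprSrv prednK//.
  by rewrite Akx scaler0 => /eqP; rewrite (negbTE Akx0).
have := test_equiv_jperp AB cM AM x; rewrite /jd.
have Mx0 : M x = x by have := Mx 0%N isT; rewrite expr0 scale1r.
have Mx1 : M (A x) = - A x by have := Mx 1%N k0; rewrite expr1 scaleN1r.
have Mx2 : M (A (A x)) = A (A x).
  have [k1|] := ltnP 1 k; first by have := Mx 2 k1; rewrite sqrrN expr1n scale1r.
  rewrite leq_eqVlt ltnNge k0 orbF => /eqP k1.
  by have := Akx; rewrite k1 exprSv expr1 => ->; rewrite op0.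
rewrite Mx0 Bx !opD !opZ Mx0 Mx1 Mx2 => e.
have e2 : 2 *: (a *: x + c *: A (A x)) = 0.
  by rewrite -[RHS]e; pairing_ring.
move/eqP: e2; rewrite scaler_eq0 (negbTE (two_neq0 R)) /= => /eqP e2.
by rewrite -addrA e2 addr0.
Qed.

End nilpotent.

(** * Jordan chains of nonzero eigenvalue, scaled to 1 *)

Section unipotent.
Variables (A B N D : 'B(X)).
Hypothesis AB : test_equiv A B.
Hypothesis AN : forall y, A y = y + N y.
Hypothesis BD : forall y, B y = A y + D y.

Lemma D_def y : D y = B y - A y.
Proof. by rewrite BD addrAC subrr add0r. Qed.

Lemma D_coeig f : (forall y, ev f (N y) = 0) -> forall y, ev f (D y) = 0.
Proof.
move=> fN y; have fA z : ev f (A z) = 1 * ev f z by rewrite AN evD fN addr0 mul1r.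
by rewrite D_def evD evN fA (rank1_equiv_coeig AB.1 (oner_neq0 _) fA) subrr.
Qed.

Lemma D_eig y : N y = 0 -> D y = 0.
Proof.
move=> Ny; have Ay : A y = 1 *: y by rewrite AN Ny addr0 scale1r.
rewrite D_def (rank1_equiv_eig AB.1 (oner_neq0 _) Ay) Ay subrr//.
Qed.

(** The roots of t^2 + t - 1, the characteristic polynomial of the tester of [unipotent_test] on the
    span of x and b: it maps x to b and b to x - b. *)
Lemma golden_roots : exists r1 r2 : R[i],
  [/\ r1 != 0, r2 != 0, r1 != r2, r1 + r2 = -1 & r1 * r2 = -1].
Proof.
have s5 : sqrtC 5 * sqrtC 5 = 5 :> R[i] by rewrite -expr2 sqrtCK.
have m1 := m1_neq0 R.
exists ((sqrtC 5 - 1) / 2), ((- sqrtC 5 - 1) / 2).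
have p : (sqrtC 5 - 1) / 2 * ((- sqrtC 5 - 1) / 2) = -1 :> R[i].
  transitivity ((1 - sqrtC 5 * sqrtC 5) / 4 : R[i]); first by field.
  by rewrite s5; field.
have /andP[h1 h2] : ((sqrtC 5 - 1) / 2 != 0 :> R[i]) && ((- sqrtC 5 - 1) / 2 != 0 :> R[i]).
  by rewrite -negb_or -mulf_eq0 p.
split=> //; last by field.
rewrite -subr_eq0 (_ : _ - _ = sqrtC 5); last by field.
by rewrite sqrtC_eq0 pnatr_eq0.
Qed.

(* With e = N x, the operator 2x (x) f1 + b (x) f2 is a tester for A: its Jordan
   product with A is the idempotent (2x + e) (x) f1. *)
Lemma unipotent_test x b f1 f2 :
  (forall y, ev f2 (N y) = 0) -> (forall y, ev f1 (N y) = ev f2 y) ->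
  ev f2 x = 1 -> ev f1 x = 0 -> 2 *: b + N b = - (2 *: x) ->
  let J y := (2 * ev f1 y) *: (2 *: x + N x + D x) + ev f2 y *: D b
             + (2 * ev f1 (D y)) *: x in
  forall y, J (J y) = 2 *: J y.
Proof.
move=> f2N f1N f2x f1x bE J.
have f2D := D_coeig f2N.
have f2b : ev f2 b = -1.
  have := congr1 (ev f2) bE; rewrite !evE f2N f2x addr0 mulr1 -[in RHS]mulrN1.
  exact: (mulfI (two_neq0 R)).
have f1b : ev f1 b = 2^-1.
  have := congr1 (ev f1) bE; rewrite !evE f1N f1x f2b mulr0 oppr0 => /eqP.
  by rewrite subr_eq0 => /eqP h; apply: (mulfI (two_neq0 R)); rewrite h; field.
have [M ME] : exists M : 'B(X), forall y, M y = (2 * ev f1 y) *: x + ev f2 y *: b.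
  exists (2 *: rank1 x f1 + rank1 b f2) => y.
  by rewrite bounded_opDE bounded_opZE !rank1E scalerA.
have Mx : M x = b by rewrite ME f1x f2x mulr0 scale0r add0r scale1r.
have Mb : M b = x - b by rewrite ME f1b f2b divff ?two_neq0// scale1r scaleN1r.
have cM : cubic M.
  have [r1 [r2 [r10 r20 r12 rD rM]]] := golden_roots.
  exists r1, r2; split=> // y; rewrite rD rM (ME y) !opE Mx Mb !opE Mx Mb.
  by pairing_ring.
have Nb : N b = - (2 *: x) - 2 *: b by rewrite -bE addrAC subrr add0r.
have jA y : jd A M y = (2 * ev f1 y) *: (2 *: x + N x).
  rewrite /jd !ME !opE !AN Nb !evE f1N f2N.
  by pairing_ring.
have /(AB.2 _ cM) /simP : sim A M.
  apply/simP => y; rewrite !jA !evE f1N f2x f1x.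
  by pairing_ring.
have jB y : jd B M y = J y.
  have -> : jd B M y = jd A M y + jd D M y.
    by rewrite /jd !BD !opE; pairing_ring.
  rewrite jA /J /jd !ME !opE f2D.
  by pairing_ring.
by move=> h y; have := h y; rewrite !jB.
Qed.

Section chain.
Variables (x : X) (k : nat) (f : topdual X).
Hypothesis k0 : (0 < k)%N.
Hypothesis Nkx : (N ^+ k.+1) x = 0.
Hypothesis fN : forall y, ev f ((N ^+ k.+1) y) = 0.
Hypothesis fx : ev f ((N ^+ k) x) = 1.

Lemma chain_functionals : exists f1 f2,
  [/\ forall y, ev f2 (N y) = 0, forall y, ev f1 (N y) = ev f2 y,
      ev f2 x = 1 & ev f1 x = 0].
Proof.
pose c := ev f ((N ^+ k.-1) x).
exists (adjoint (N ^+ k.-1) f - c *: adjoint (N ^+ k) f), (adjoint (N ^+ k) f).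
split=> [y|y||].
- by rewrite ev_adj -exprSrv fN.
- by rewrite evDl evNl evZl !ev_adj -!exprSrv fN mulr0 subr0 prednK.
- by rewrite ev_adj fx.
- by rewrite evDl evNl evZl !ev_adj fx mulr1 subrr.
Qed.

(** Here A x = (x + A^2 x) / 2, so [nil_span] does not apply at x and the tester alone must decide.
    Its identity at [N x] is a linear relation between x, N x and d = D x; [f2] and [f1] applied to
    it give f1 d = 0, whence d = 0. *)
Lemma unipotent_chain2 : k = 1%N -> D x = 0.
Proof.
move=> k1; have [f1 [f2 [f2N f1N f2x f1x]]] := chain_functionals.
have NNx : N (N x) = 0 by move: Nkx; rewrite k1 exprSv expr1.
have De : D (N x) = 0 by exact: D_eig.
(* The solution of 2 b + N b = -2 x when N^2 x = 0. *)
have [b bd] : exists b, b = 2^-1 *: N x - x by eexists.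
have bE : 2 *: b + N b = - (2 *: x).
  rewrite bd !opE NNx scaler0 add0r.
  by pairing_field.
have := unipotent_test f2N f1N f2x f1x bE; rewrite /=.
have Db : D b = - D x by rewrite bd opD opZ opN De scaler0 add0r.
rewrite Db.
have f2D := D_coeig f2N.
move=> /(_ (N x)); rewrite !f2N !f1N De f2x !ev0 !mulr0 !mulr1 !scale0r !addr0.
rewrite !(evZ, evD, opZ, opD, f1x, f2D, f2N, f1N, f2x, De).
set d := D x => e.
have E : (4 * ev f1 d + ev f1 (D d)) *: x + ev f1 d *: N x + (ev f1 d - 1) *: d = 0.
  apply: (scalerI (_ : 4 != 0)); first by rewrite pnatr_eq0.
  rewrite scaler0; move/eqP: e; rewrite -subr_eq0 => /eqP <-.
  by apply: ev_inj => h; rewrite !evE ?ev0; ring.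
have h1 := congr1 (ev f2) E; have h2 := congr1 (ev f1) E.
move: h1 h2; rewrite !evE f2x f2N f2D f1x f1N f2x !mulr1 !mulr0 !addr0 add0r => h1 h2.
have d0 : ev f1 d = 0.
  have : ev f1 d * ev f1 d = 0 by rewrite -h2; ring.
  by move/eqP; rewrite mulf_eq0 orbb => /eqP.
move: E; rewrite h1 d0 !scale0r !add0r => /eqP.
by rewrite scaleN1r oppr_eq0 => /eqP.
Qed.

(** [K] is A^2 - 1 expressed through N. *)
Variable K : X -> X.
Hypothesis KE : forall y, K y = 2 *: N y + N (N y).

Lemma pow_gt l y : (N ^+ k.+1) y = 0 -> (k < l)%N -> (N ^+ l) y = 0.
Proof. by move=> Ny kl; rewrite -(subnK kl) exprDv Ny op0. Qed.

Section order_ge3.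
Hypothesis k1 : (1 < k)%N.

(** If A y = s y + t A^2 y, comparing orders in N gives s + t = 1, then 2 t = 1, then N^2 y = 0,
    against N^k y <> 0 with k > 1. So [nil_span] applies. *)
Lemma exact_order_span y : (N ^+ k.+1) y = 0 -> (N ^+ k) y != 0 ->
  exists a c, D y = a *: y + c *: A (A y).
Proof.
move=> Ny Nky.
have NkNy : (N ^+ k) (N y) = 0 by rewrite -exprSrv.
have NkNNy : (N ^+ k) (N (N y)) = 0 by rewrite -!exprSrv pow_gt.
have [|[a [c Bx]] _] := @nil_span _ _ A B y AB.1; last first.
  exists a, c; rewrite D_def Bx.
  by pairing_ring.
rewrite !AN !opE => /in_span2P [s [t e]].
have st : s + t = 1.
  have := congr1 (N ^+ k) e; rewrite !opE NkNy NkNNy !addr0 -scalerDl.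
  by rewrite -{1}[(N ^+ k) y]scale1r => /(scaler_injl Nky).
have e2 : N y = (2 * t) *: N y + t *: N (N y).
  apply: (addrI y); rewrite e (_ : s = 1 - t); last by rewrite -st addrK.
  by pairing_ring.
have Nk1 : (N ^+ k.-1) (N y) = (N ^+ k) y by rewrite -exprSrv prednK.
have t2 : 2 * t = 1.
  have := congr1 (N ^+ k.-1) e2; rewrite !opE Nk1 -exprSrv prednK// NkNy scaler0 addr0.
  by rewrite -{1}[(N ^+ k) y]scale1r => /(scaler_injl Nky).
have NNy : N (N y) = 0.
  have t0 : t != 0 by apply: contra_eq_neq t2 => ->; rewrite mulr0 eq_sym oner_neq0.
  apply: (scalerI t0); rewrite scaler0; apply: (addrI (N y)).
  by rewrite addr0 [in RHS]e2 t2 scale1r.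
move/eqP: Nky; apply.
by rewrite -(subnK k1) exprDv exprSv expr1 NNy op0.
Qed.

(** Adding the eigenvector w = N^k y, on which D vanishes, does not change D y. Comparing the
    formulas for y and y + w at the coefficients of y, N y and w leaves a = -c. *)
Lemma exact_order_eig y : (N ^+ k.+1) y = 0 -> (N ^+ k) y != 0 ->
  exists c, D y = c *: K y.
Proof.
move=> Ny Nky; have [a [c Dy]] := exact_order_span Ny Nky.
have [w wE] : exists w, w = (N ^+ k) y by eexists.
have Nw : N w = 0 by rewrite wE -exprSv.
have Nkw : (N ^+ k) w = 0 by rewrite -(prednK k0) exprSrv Nw op0.
have Aw : A w = w by rewrite AN Nw addr0.
have [||a' [c' Dyw]] := @exact_order_span (y + w).
- by rewrite opD Ny exprSrv Nw op0 addr0.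
- by rewrite opD Nkw addr0.
have E : (a - a' + (c - c')) *: y + (c - c') *: K y - (a' + c') *: w = 0.
  have Dyw2 : a *: y + c *: A (A y) = a' *: (y + w) + c' *: (A (A y) + w).
    rewrite -Dy; have -> : D y = D (y + w).
      by rewrite opD (D_eig Nw) addr0.
    by rewrite Dyw !opD !Aw.
  transitivity (a *: y + c *: A (A y) - (a' *: (y + w) + c' *: (A (A y) + w))).
    by rewrite KE !AN !opD; pairing_ring.
  by rewrite Dyw2 subrr.
have NkNy : (N ^+ k) (N y) = 0 by rewrite -exprSrv.
have NkNNy : (N ^+ k) (N (N y)) = 0 by rewrite -!exprSrv pow_gt.
have Nk1 z : (N ^+ k.-1) (N z) = (N ^+ k) z by rewrite -exprSrv prednK.
have w0 : w != 0 by rewrite wE.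
have e1 : a - a' + (c - c') = 0.
  have := congr1 (N ^+ k) E; rewrite !KE !opE Nkw NkNy NkNNy -wE.
  rewrite !scaler0 oppr0 !addr0 scaler0 addr0 => /eqP.
  by rewrite scaler_eq0 (negbTE w0) orbF => /eqP.
have Nk1w : (N ^+ k.-1) w = 0.
  by rewrite -(prednK (_ : 0 < k.-1)%N) ?exprSrv ?Nw ?op0// -subn1 subn_gt0.
have e2 : c - c' = 0.
  have := congr1 (N ^+ k.-1) E; rewrite e1 scale0r add0r !KE !opE !Nk1 Nk1w NkNy -wE.
  rewrite scaler0 oppr0 !addr0 scalerA => /eqP.
  by rewrite scaler_eq0 (negbTE w0) orbF mulf_eq0 (negbTE (two_neq0 R)) orbF => /eqP.
have e3 : a' + c' = 0.
  move/eqP: E; rewrite e1 e2 !scale0r add0r sub0r oppr_eq0 scaler_eq0.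
  by rewrite (negbTE w0) orbF => /eqP.
exists c; rewrite Dy.
have -> : a = - c.
  move: e1; rewrite e2 addr0 => /eqP; rewrite subr_eq0 => /eqP ->.
  by move/eqP: e2; rewrite subr_eq0 => /eqP ->; apply/eqP; rewrite -addr_eq0 e3.
by rewrite !KE !AN !opD; pairing_ring.
Qed.

Lemma two_plus_N_inj j v : (N ^+ j) v = 0 -> 2 *: v + N v = 0 -> v = 0.
Proof.
elim: j v => [|j ih] v; first by rewrite expr0 op1E.
rewrite exprSrv => Njv e; have Nv : N v = 0.
  by apply: ih => //; rewrite -opZ -opD e op0.
move: e; rewrite Nv addr0 => /eqP; rewrite scaler_eq0 (negbTE (two_neq0 R)).
by move/eqP.
Qed.

(** If K y is a multiple of K x, then y differs from a multiple of x by an eigenvector. Otherwise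
    two vectors y + s x of exact order have factors d1 and d2, and the independence of K x and K y
    forces d1 = d2 = c. *)
Lemma exact_order_const : exists c, forall y, (N ^+ k.+1) y = 0 -> D y = c *: K y.
Proof.
have Nkx0 : (N ^+ k) x != 0 by exact: (ev1_neq0r fx).
have [c Dx] := exact_order_eig Nkx Nkx0; exists c => y Ny.
have KD u v : K (u + v) = K u + K v.
  by rewrite !KE !opD; pairing_ring.
have KZ a u : K (a *: u) = a *: K u.
  by rewrite !KE !opZ; pairing_ring.
have Kinj u : (N ^+ k.+1) u = 0 -> K u = 0 -> D u = 0.
  move=> Nu Ku; apply: D_eig; apply: (@two_plus_N_inj k.+1); last by rewrite -KE.
  by rewrite -exprSrv exprSv Nu op0.
have [[r Ky]|nK] := pselect (exists r, K y = r *: K x).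
  have : D (y + (- r) *: x) = 0.
    apply: Kinj; first by rewrite opD opZ Ny Nkx scaler0 addr0.
    by rewrite KD KZ Ky scaleNr subrr.
  rewrite opD opZ Dx Ky scaleNr => /eqP; rewrite subr_eq0 => /eqP ->.
  by rewrite !scalerA mulrC.
have good s : (N ^+ k) (y + s *: x) != 0 -> exists d, D y + s *: D x = d *: (K y + s *: K x).
  move=> h; have [|d] := @exact_order_eig (y + s *: x) _ h.
    by rewrite opD opZ Ny Nkx scaler0 addr0.
  by rewrite opD opZ KD KZ => e; exists d.
(* At most one value of s lowers the order of y + s x, so two of 0, 1, 2 remain. *)
have [s1 [s2 [s12 g1 g2]]] : exists s1 s2, [/\ s1 - s2 != 0,
    (N ^+ k) (y + s1 *: x) != 0 & (N ^+ k) (y + s2 *: x) != 0].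
  have bad s t : s - t != 0 -> (N ^+ k) (y + s *: x) = 0 -> (N ^+ k) (y + t *: x) != 0.
    move=> st h; apply: contra_neq Nkx0 => h'.
    have /eqP : (s - t) *: (N ^+ k) x = 0.
      rewrite -[RHS](subrr 0) -{1}h -h' !opD !opZ.
      by pairing_ring.
    by rewrite scaler_eq0 (negbTE st) => /eqP.
  have n1 : (1 : R[i]) - 0 != 0 by rewrite subr0 oner_neq0.
  have n2 : (2 : R[i]) - 0 != 0 by rewrite subr0 two_neq0.
  have n21 : (2 : R[i]) - 1 != 0 by rewrite subr_eq0 two_neq1.
  have [h0|h0] := eqVneq ((N ^+ k) (y + 0 *: x)) 0.
    exists 2, 1; split=> //; apply: bad h0; rewrite sub0r oppr_eq0 ?oner_neq0 ?two_neq0//.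
  have [h1|h1] := eqVneq ((N ^+ k) (y + 1 *: x)) 0; last by exists 1, 0.
  by exists 2, 0; split=> //; apply: bad h1; rewrite -opprB oppr_eq0.
have [d1 e1] := good _ g1; have [d2 e2] := good _ g2.
have [g [gKy gKx]] := dual_separation1 nK.
have Kx0 : K x != 0.
  apply/eqP => Kx.
  have : N x = 0.
    apply: (@two_plus_N_inj k.+1); last by rewrite -KE.
    by rewrite -exprSrv exprSv Nkx op0.
  by move=> Nx; move: Nkx0; rewrite -(prednK k0) exprSrv Nx op0 eqxx.
have E : (s1 - s2) *: (c *: K x) = (d1 - d2) *: K y + (d1 * s1 - d2 * s2) *: K x.
  transitivity ((D y + s1 *: D x) - (D y + s2 *: D x)).
    by rewrite Dx; pairing_ring.
  by rewrite e1 e2; pairing_ring.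
have d12 : d1 = d2.
  have := congr1 (ev g) E; rewrite !evE gKy gKx !mulr0 mulr1 addr0 => /esym/eqP.
  by rewrite subr_eq0 => /eqP.
have d1c : d1 = c.
  move: E; rewrite -d12 subrr scale0r add0r scalerA -mulrBr mulrC.
  by move=> /(scaler_injl Kx0) /(mulIf s12).
apply: (addIr (s1 *: D x)); rewrite e1 d1c Dx.
by pairing_ring.
Qed.

(** 2 + N is invertible where N is nilpotent; the solution for v is obtained from the solution b'
    for N v as -v - b' / 2. *)
Lemma half_inverse j v : (N ^+ j) v = 0 -> exists b,
  (N ^+ j) b = 0 /\ 2 *: b + N b = - (2 *: v).
Proof.
elim: j v => [|j ih] v.
  by rewrite expr0 op1E => ->; exists 0; rewrite !op0 !scaler0 oppr0 addr0.
move=> Njv; have /ih [b [Nb bE]] : (N ^+ j) (N v) = 0 by rewrite -exprSrv.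
exists (- v - 2^-1 *: b); split.
  by rewrite opD !opN opZ Njv [(N ^+ j.+1) b]exprSv Nb op0 scaler0 !oppr0 addr0.
have e : N b = - (2 *: N v) - 2 *: b by rewrite -bE addrAC subrr add0r.
by rewrite !opE e; pairing_field.
Qed.

(** Along the chain D = c K with a single constant. The identity of the tester at [N x], read by
    [f2], becomes 8 + 32 c = 8. *)
Lemma unipotent_chain_ge3 : D x = 0.
Proof.
have [f1 [f2 [f2N f1N f2x f1x]]] := chain_functionals.
have [c cK] := exact_order_const.
have [b [Nb bE]] := half_inverse Nkx.
have f1K y : ev f1 (K y) = 2 * ev f2 y by rewrite KE !evE !f1N f2N addr0.
have f2K y : ev f2 (K y) = 0 by rewrite KE !evE !f2N mulr0 addr0.
have Db : D b = - ((2 * c) *: N x).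
  rewrite (cK _ Nb) KE -opZ -opD bE.
  by rewrite opN opZ; pairing_ring.
have Ne : (N ^+ k.+1) (N x) = 0 by rewrite -exprSrv exprSv Nkx op0.
have [u uE] : exists u, u = 2 *: x + N x + D x by eexists.
have Nu : (N ^+ k.+1) u = 0.
  have NK : (N ^+ k.+1) (K x) = 0.
    by rewrite KE opD opZ Ne -exprSrv exprSv Ne op0 scaler0 addr0.
  by rewrite uE (cK _ Nkx) !opD opZ Nkx Ne opZ NK !scaler0 !addr0.
have := unipotent_test f2N f1N f2x f1x bE; rewrite /= -uE => /(_ (N x)).
rewrite f1N f2N f2x (cK _ Ne) evZ f1K f2N !mulr0 !scale0r !addr0 mulr1.
move=> /(congr1 (ev f2)); rewrite !(evD, evZ) opZ Db (cK _ Nu) !(evN, evZ) f1K f2N.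
have -> : ev f2 u = 2 by rewrite uE !evE f2x f2N (cK _ Nkx) evZ f2K mulr1 mulr0 !addr0.
have -> : ev f1 u = 1 + 2 * c.
  by rewrite uE !evE f1x f1N f2x (cK _ Nkx) evZ f1K f2x mulr0 add0r mulr1 mulrC.
rewrite f2x => e.
have c0 : c = 0.
  have e' : 32 * c = 0 by apply/eqP; rewrite -[X in _ == X](subrr (2 * (2 * 2))) -{1}e; apply/eqP; ring.
  by move/eqP: e'; rewrite mulf_eq0 pnatr_eq0 => /eqP.
by rewrite (cK _ Nkx) c0 scale0r.
Qed.

End order_ge3.

End chain.

End unipotent.
End primary_components.

(** * Separation of operators by the testers *)

Section separation_of_operators.
Variables (R : realType) (X : normedModType R[i]).
Implicit Types (x y z w : X) (f g : topdual X) (A B M : 'B(X)) (p q s : {poly R[i]}).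

Lemma powZ c A j x : ((c *: A) ^+ j) x = c ^+ j *: (A ^+ j) x.
Proof.
elim: j => [|j ih]; first by rewrite !expr0 scale1r.
by rewrite !exprSv bounded_opZE ih opZ scalerA -exprS.
Qed.

Lemma primary_chain_eq A B l k x f : test_equiv A B ->
  let N : 'B(X) := A - l *: (1 : 'B(X)) in
  (N ^+ k.+1) x = 0 -> (forall y, ev f ((N ^+ k.+1) y) = 0) ->
  ev f ((N ^+ k) x) = 1 -> B x = A x.
Proof.
move=> AB N Nx fN fx.
have [l0|l0] := eqVneq l 0.
  have NA : N = A by rewrite /N l0 scale0r subr0.
  rewrite NA in Nx fN fx; case: k => [|k] in Nx fN fx *; last first.
    exact: (nilpotent_chain_eq Nx fN fx AB).
  have Ax : A x = 0 by move: Nx; rewrite expr1.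
  rewrite Ax; apply: (rank1_equiv_ker AB.1 (ev1_neq0 fx) Ax) => z.
  by have := fN z; rewrite expr1.
pose A1 := l^-1 *: A; pose B1 := l^-1 *: B; pose N1 := l^-1 *: N; pose D1 := B1 - A1.
have li0 : l^-1 != 0 by rewrite invr_eq0.
have AB1 : test_equiv A1 B1 by exact: test_equivZ.
have AN1 y : A1 y = y + N1 y.
  rewrite /A1 /N1 /N !bounded_opZE bounded_opDE bounded_opNE bounded_opZE op1E.
  by rewrite scalerBr scalerA mulVf// scale1r addrC subrK.
have BD1 y : B1 y = A1 y + D1 y.
  by rewrite /D1 bounded_opDE bounded_opNE addrC subrK.
have N1x : (N1 ^+ k.+1) x = 0 by rewrite powZ Nx scaler0.
have [g [gN1 gx1]] : exists g, (forall y, ev g ((N1 ^+ k.+1) y) = 0) /\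
    ev g ((N1 ^+ k) x) = 1.
  (* Dividing A by l divides N^k by l^k; the functional makes up for it. *)
  exists (l ^+ k *: f); split=> [y|].
    by rewrite evZl powZ evZ fN !mulr0.
  by rewrite evZl powZ evZ fx mulr1 -exprMn divff// expr1n.
suff Dx : D1 x = 0.
  apply: (scalerI li0); rewrite -!bounded_opZE -/B1 -/A1 BD1 Dx addr0//.
clearbody A1 B1 N1 D1.
case: k => [|[|k]] in Nx fN fx N1x gN1 gx1 *.
- by apply: (D_eig AB1 AN1 BD1); move: N1x; rewrite expr1.
- exact: (unipotent_chain2 AB1 AN1 BD1 (isT : 0 < 1)%N N1x gN1 gx1 erefl).
- pose K y := 2 *: N1 y + N1 (N1 y).
  exact: (unipotent_chain_ge3 AB1 AN1 BD1 (isT : 0 < k.+2)%N N1x gN1 gx1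
    (fun y => erefl : K y = _) isT).
Qed.

(** On the range of q(A), the primary component of l, N is nilpotent of exact index k + 1. Vectors
    of full order head a chain; a vector of lower order is a difference of two of full order. *)
Lemma primary_component_eq A B p q l m : test_equiv A B -> opoly A p = 0 ->
  p != 0 -> p = q * ('X - l%:P) ^+ m -> ~~ root q l ->
  forall y, B (opoly A q y) = A (opoly A q y).
Proof.
move=> AB Ap p0 pE ql.
pose N : 'B(X) := A - l *: (1 : 'B(X)).
have NE j : opoly A (('X - l%:P) ^+ j) = N ^+ j by rewrite opolyXn opolyXsubC.
have ex : exists j, `[< forall y, (N ^+ j) (opoly A q y) = 0 >].
  exists m; apply/asboolP => y; rewrite -NE opoly_comm -bounded_opME -opolyM -pE Ap//.
case: (ex_minnP ex) => -[|k] /asboolP Nq kmin.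
  by move=> y; have := Nq y; rewrite expr0 op1E => ->; rewrite !op0.
have [y0 Ny0] : exists y0, (N ^+ k) (opoly A q y0) != 0.
  apply: contrapT => h; suff : (k.+1 <= k)%N by rewrite ltnn.
  apply: kmin; apply/asboolP => y; apply/eqP; apply: contraT => hy.
  by case: h; exists y.
have cop : coprimep q (('X - l%:P) ^+ k.+1).
  by apply: coprimep_expr; rewrite coprimep_XsubC.
have [[u v] /= uv] := Bezout_eq1_coprimepP _ _ cop.
have NqE y : (N ^+ k.+1) (opoly A q y) = opoly A q ((N ^+ k.+1) y).
  by rewrite -NE opoly_comm.
have chain x : (N ^+ k.+1) x = 0 -> (N ^+ k) x != 0 -> B x = A x.
  move=> Nx /dual_separation0 [g gx].
  (* By the Bezout identity (u q)(A) is the identity on N^k x, and it kills the range of N^(k+1);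
     composing with it makes [g] a functional on the chain. *)
  apply: (@primary_chain_eq A B l k x (adjoint (opoly A (u * q)) g)) => // [y|].
    by rewrite ev_adj opolyM bounded_opME -NqE Nq op0 ev0.
  rewrite ev_adj -gx; congr (ev g _).
  have := congr1 (fun s => opoly A s ((N ^+ k) x)) uv.
  rewrite opolyD opoly1 bounded_opDE op1E [X in _ + X = _](_ : _ = 0) ?addr0//.
  by rewrite opolyM bounded_opME NE -exprDv addnC exprDv Nx !op0.
move=> y; have [h|h] := eqVneq ((N ^+ k) (opoly A q y)) 0; last exact: chain.
have By0 := chain _ (Nq y0) Ny0.
have e1 : (N ^+ k.+1) (opoly A q y + opoly A q y0) = 0 by rewrite opD !Nq addr0.
have e2 : (N ^+ k) (opoly A q y + opoly A q y0) != 0 by rewrite opD h add0r.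
have := chain _ e1 e2; rewrite (opD B) (opD A) By0; exact: addIr.
Qed.

(** The polynomials s such that A and B agree on the range of s(A) form an ideal with a generator
    [d] of least degree. The cofactor in [p] of the primary factor at [l] belongs to it and does not
    vanish at [l], so [d] has no root. *)
Lemma test_equiv_eq A B : test_equiv A B -> B = A.
Proof.
move=> AB; have [[z fz]|nf] := pselect (exists z, cyclic_free A 5 z).
  exact: cyclic_free_all AB.1 fz.
have [p p0 Ap] : exists2 p, p != 0 & opoly A p = 0.
  apply: (@algebraic_of_locally _ _ A 5) => z.
  have [[g gP]|[c [[i i5 ci] cz]]] := free_or_dependent 5 (fun j => (A ^+ j) z).
    by case: nf; exists z, g.
  have pi : (\poly_(j < 5) c j)`_i = c i by rewrite coef_poly i5.
  exists (\poly_(j < 5) c j); split; last 1 first.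
  - rewrite (@opolyE _ _ _ _ 5) ?size_poly// -[RHS]cz.
    transitivity (\sum_(j < 5) ((\poly_(j < 5) c j)`_j *: A ^+ j) z).
      by elim/big_ind2: _ => // a b c' d <- <-.
    by apply: eq_bigr => j _; rewrite coef_poly ltn_ord.
  - by apply: contra_neq ci => e; rewrite -pi e coef0.
  - exact: size_poly.
pose I s := forall y, B (opoly A s y) = A (opoly A s y).
have ex : exists n, `[< exists s, [/\ s != 0, I s & size s = n] >].
  exists (size p); apply/asboolP; exists p; split=> // y.
  by rewrite Ap bounded_op0E !op0.
case: (ex_minnP ex) => n /asboolP [d [d0 Id dn]] nmin.
have Idiv s : I s -> d %| s.
  move=> Is; rewrite /dvdp; apply: contraT => r0.
  have : (n <= size (s %% d)%R)%N.
    apply: nmin; apply/asboolP; exists (s %% d); split=> // y.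
    have -> : s %% d = s - s %/ d * d by rewrite {2}(divp_eq s d) addrC addKr.
    rewrite opolyD -scaleN1r opolyZ bounded_opDE bounded_opZE opolyM bounded_opME.
    by rewrite opoly_comm !opD !opZ Id Is.
  by rewrite leqNgt -dn ltn_modp d0.
have [/size_poly1P [c c0 dc]|/closed_rootP [l dl]] := boolP (size d == 1%N).
  apply: bounded_op_ext => y; apply: (scalerI c0).
  have := Id y; rewrite dc opolyC bounded_opZE op1E !opZ //.
have [m [q ql pE]] := multiplicity_XsubC p l; rewrite p0 /= in ql.
have := Idiv q (primary_component_eq AB Ap p0 pE ql) => /dvdpP [t qE].
by move: ql; rewrite qE rootM dl orbT.
Qed.

Theorem preserver_fixing_rank1_idempotents (Phi : 'B(X) -> 'B(X)) :
  unspanned X ->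
  (forall A B, sim A B <-> sim (Phi A) (Phi B)) ->
  (forall x f, ev f x = 1 -> Phi (rank1 x f) = rank1 x f) ->
  (forall x f, ev f x = 1 -> Phi (- rank1 x f) = - rank1 x f) ->
  forall A, Phi A = A.
Proof.
move=> Xinf hs h1 h2 A.
have r1 B : rank1_equiv B (Phi B).
  by move=> x f; rewrite hs (Phi_rank1 Xinf hs h1 h2).
apply: test_equiv_eq; split=> // M [t1 [t2 [t10 t20 t12 hM]]].
by rewrite hs (rank1_equiv_cubic (r1 M) t10 t20 t12 hM).
Qed.

End separation_of_operators.

(** * Idempotents and orthogonality *)

Section idempotent_operators.
Variables (R : realType) (X : normedModType R[i]).
Implicit Types (x y z w : X) (f g k : topdual X) (A B J P Q S : 'B(X)).

Lemma simNr A B z : jd A (- B) z = - jd A B z.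
Proof. by rewrite /jd !opE opprD. Qed.

(** T = P S + S P satisfies T^2 = -2 T. With a = P S P its corners give 3 a^2 = -5 a and a^3 = a, so
    9 a = 25 a and a = 0; the off-diagonal corners then vanish as well. *)
Lemma idem_sim_opp P S : idempotents P -> idempotents S -> sim P (- S) ->
  (forall z, P (S z) = 0) /\ (forall z, S (P z) = 0).
Proof.
move=> /idempotentsE PP /idempotentsE SS /simP hT.
have T z : jd P S (jd P S z) = - (2 *: jd P S z).
  have := hT z; rewrite !simNr /jd !opE scalerN => e.
  by rewrite -e; pairing_ring.
have a2 z : 3 *: P (S (P (S (P z)))) = - (5 *: P (S (P z))).
  have := congr1 P (T (P z)); rewrite /jd !(opE, PP, SS) => e.
  pairing_linear e.
have ab z : P (S (P (S z))) - P (S (P (S (P z)))) = - (P (S z) - P (S (P z))).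
  apply: (scalerI (two_neq0 R)).
  have := congr1 P (T (z - P z)); rewrite /jd !(opE, PP, SS) => e.
  pairing_linear e.
have ca z : S (P (S (P z))) - P (S (P (S (P z)))) = - (S (P z) - P (S (P z))).
  apply: (scalerI (two_neq0 R)).
  have := congr1 (fun u => u - P u) (T (P z)); rewrite /jd !(opE, PP, SS) => e.
  pairing_linear e.
have a3 z : P (S (P (S (P (S (P z)))))) = P (S (P z)).
  have := ab (S (P z)); rewrite SS => e.
  apply: ev_inj => k; have := congr1 (ev k) e; rewrite !evE => {}e.
  have := congr1 (ev k) (ab (P z)); rewrite !PP !evE => e'.
  by apply: (eq_of_sub (esym e)); ring.
have a0 z : P (S (P z)) = 0.
  apply: (scalerI (_ : 16 != 0)); first by rewrite pnatr_eq0.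
  rewrite scaler0; apply: ev_inj => k.
  have := congr1 (ev k) (a2 (S (P z))); rewrite a3 !evE => e1.
  have := congr1 (ev k) (a2 z); rewrite !evE => e2.
  have e3 : 9 * ev k (P (S (P z))) = 25 * ev k (P (S (P z))).
    transitivity (3 * - (5 * ev k (P (S (P (S (P z))))))); first by rewrite -e1; ring.
    transitivity (-5 * (3 * ev k (P (S (P (S (P z)))))) : R[i]); first by ring.
    by rewrite e2; ring.
  by apply: (eq_of_sub (esym e3)); ring.
split=> z.
  have := ab z; rewrite !a0 !subr0 => /esym/eqP.
  by rewrite oppr_eq0 => /eqP.
have := ca z; rewrite !(a0, op0, subr0) => /esym/eqP.
by rewrite oppr_eq0 => /eqP.
Qed.

Lemma sim_self J : sim J J <-> forall z, J (J (J (J z))) = J (J z).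
Proof.
rewrite simP; split=> h z; have := h z; rewrite /jd !opE => e.
  apply: (scalerI (_ : 4 != 0)); first by rewrite pnatr_eq0.
  by pairing_linear e.
by rewrite e; pairing_ring.
Qed.

(** Otherwise some C with zero Jordan product with J satisfies C^2 v = v for a nonzero v. Then B = 2
    C is related to J, while B^4 = B^2 fails at v because 16 differs from 4. *)
Lemma unit_characterization J : sim J J -> (forall B, sim J B -> sim B B) ->
  J = 1 \/ J = -1.
Proof.
move=> /sim_self J4 h.
have h' B : jperp J B -> forall z, B (B (B (B z))) = B (B z).
  by move=> /jperp_sim /h /sim_self.
have n416 (v : X) : 4 *: v = 16 *: v -> v = 0.
  move=> e; apply: (scalerI (_ : 12 != 0)); first by rewrite pnatr_eq0.
  rewrite scaler0 -[RHS](subrr (4 *: v)) {1}e.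
  by pairing_ring.
have [J2|] := pselect (forall z, J (J z) = z); last first.
  have [JF nF|nJF] := pselect (forall z, J (z - J (J z)) = 0).
    case: nF => z; apply/esym/eqP; rewrite -subr_eq0; apply/eqP.
    have JF' y : J (J (J y)) = J y by apply/eqP; rewrite eq_sym -subr_eq0 -opN -opD JF.
    (* Here J^3 = J, so 1 - J^2 is a nonzero idempotent annihilated by J. *)
    pose B : 'B(X) := 2 *: (1 - J * J).
    have BE y : B y = 2 *: (y - J (J y)) by [].
    have jB : jperp J B.
      by move=> y; rewrite /jd !BE !opE !JF' !subrr scaler0 addr0.
    have := h' _ jB z; rewrite !BE !opE !JF'; set d := z - _.
    clearbody B; rewrite !(subrr, oppr0, addr0, subr0, scaler0) => e.
    apply: n416; apply/esym; apply: ev_inj => k; have := congr1 (ev k) e.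
    by rewrite /d !evE => {}e; apply: (eq_of_sub e); ring.
  have [u0 vn0] : exists u0, J (u0 - J (J u0)) != 0.
    by apply: contrapT => hh; apply: nJF => z; apply/eqP; apply: contraT => hz; case: hh; exists z.
  move=> _; exfalso.
  have [u uE] : exists u, u = u0 - J (J u0) by eexists.
  rewrite -uE in vn0.
  have JJu : J (J u) = 0 by rewrite uE !opE J4 subrr.
  have [g0 g0v] := dual_separation0 vn0.
  have [g [gv gJJ]] : exists g, ev g (J u) = 1 /\ forall z, ev g (J (J z)) = 0.
    exists (g0 - adjoint (J * J) g0); split=> [|z].
      by rewrite evDl evNl ev_adj bounded_opME JJu op0 ev0 subr0.
    by rewrite evDl evNl ev_adj bounded_opME J4 subrr.
  (* J is a nilpotent block on the span of [u] and [J u]; there B is twice an involution fixing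
     [J u]. *)
  have [B BE] : exists B : 'B(X), forall z, B z = (2 * ev g z) *: J u - (2 * ev g (J z)) *: u.
    exists (2 *: (rank1 (J u) g - rank1 u (adjoint J g))) => z.
    by rewrite bounded_opZE bounded_opDE bounded_opNE !rank1E ev_adj scalerBr !scalerA.
  have jB : jperp J B.
    move=> z; rewrite /jd !BE !opE JJu gJJ.
    by pairing_ring.
  have Bv : B (J u) = 2 *: J u by rewrite BE gv JJu ev0 mulr0 scale0r subr0 mulr1.
  have := h' _ jB (J u); rewrite !(Bv, opZ) !scalerA => e.
  move/eqP: vn0; apply; apply: n416; apply/esym.
  by pairing_linear e.
have [J1|nJ1] := pselect (forall z, J z = z); first by left; exact: bounded_op_ext.
have [Jm1|nJm1] := pselect (forall z, J z = - z); first by right; exact: bounded_op_ext.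
exfalso.
have [y [y0 Jy]] : exists y, y != 0 /\ J y = - y.
  apply: contrapT => hh; apply: nJ1 => z; apply/eqP; rewrite -subr_eq0.
  apply: contraT => hz; case: hh; exists (J z - z); split=> //.
  by rewrite !opE J2 opprB.
have [x [x0 Jx]] : exists x, x != 0 /\ J x = x.
  apply: contrapT => hh; apply: nJm1 => z; apply/eqP; rewrite -subr_eq0 opprK.
  apply: contraT => hz; case: hh; exists (J z + z); split=> //.
  by rewrite !opE J2 addrC.
have [f0 f0y] := dual_separation0 y0; have [g0 g0x] := dual_separation0 x0.
have [f [fy fJ]] : exists f, ev f y = 1 /\ forall z, ev f (J z) = - ev f z.
  exists (2^-1 *: (f0 - adjoint J f0)); split=> [|z].
    by rewrite !evE Jy evN f0y; field.
  by rewrite !evE J2; ring.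
have [g [gx gJ]] : exists g, ev g x = 1 /\ forall z, ev g (J z) = ev g z.
  exists (2^-1 *: (g0 + adjoint J g0)); split=> [|z].
    by rewrite !evE Jx g0x; field.
  by rewrite !evE J2; ring.
have z0 (a : R[i]) : a = - a -> a = 0.
  move=> e; apply: (mulfI (two_neq0 R)); rewrite mulr0.
  by apply: (eq_of_sub e); ring.
have fx : ev f x = 0 by apply: z0; rewrite -fJ Jx.
have gy : ev g y = 0 by apply: z0; rewrite -evN -Jy gJ.
(* Twice the exchange of an eigenvector for 1 with an eigenvector for -1. *)
have [B BE] : exists B : 'B(X), forall z, B z = (2 * ev f z) *: x + (2 * ev g z) *: y.
  exists (2 *: (rank1 x f + rank1 y g)) => z.
  by rewrite bounded_opZE bounded_opDE !rank1E scalerDr !scalerA.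
have jB : jperp J B.
  move=> z; rewrite /jd !BE !opE Jx Jy fJ gJ.
  by pairing_ring.
have Bx : B x = 2 *: y by rewrite BE fx gx mulr0 scale0r add0r mulr1.
have By : B y = 2 *: x by rewrite BE fy gy mulr0 scale0r addr0 mulr1.
have := h' _ jB x; rewrite !(Bx, By, opZ) !scalerA => e.
move/eqP: x0; apply; apply: n416; apply/esym.
by pairing_linear e.
Qed.

(** Pulling a functional back through P puts a rank one idempotent below P. *)
Lemma idem_eq0_rank1 P : idempotents P -> P != 0 -> exists x f,
  [/\ ev f x = 1, P x = x & forall z, ev f (P z) = ev f z].
Proof.
move=> /idempotentsE PP P0.
have [y Py] : exists y, P y != 0.
  apply: contrapT => h; move/eqP: P0; apply; apply: bounded_op_ext => y.
  by apply/eqP; apply: contraT => Py; case: h; exists y.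
have [f fPy] := dual_separation0 Py.
by exists (P y), (adjoint P f); rewrite !ev_adj PP; split=> // z; rewrite !ev_adj PP.
Qed.

Lemma idem_rank1 x f : ev f x = 1 -> idempotents (rank1 x f).
Proof. by move=> fx; apply/idempotentsE => z; rewrite !rank1E evZ fx mulr1. Qed.

Lemma idem_compl P : idempotents P -> idempotents (1 - P).
Proof.
move=> /idempotentsE PP; apply/idempotentsE => z.
by rewrite !opE PP subrr oppr0 addr0.
Qed.

End idempotent_operators.

Section orthogonality.
Variables (R : realType) (X : normedModType R[i]).
Implicit Types (x y z w : X) (f g h k : topdual X) (A B P Q S T : 'B(X)).
Hypothesis Xinf : unspanned X.

Definition perp P S : Prop := (forall z, P (S z) = 0) /\ (forall z, S (P z) = 0).

Lemma perp_sim P S : idempotents P -> idempotents S -> perp P S <-> sim P (- S).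
Proof.
move=> hP hS; split=> [[PS SP]|]; last exact: idem_sim_opp.
by apply: jperp_sim => z; rewrite simNr /jd PS SP addr0 oppr0.
Qed.

Lemma perp_sim' P S : perp P S -> sim P S.
Proof. by move=> [PS SP]; apply: jperp_sim => z; rewrite /jd PS SP addr0. Qed.

Definition isrank1 P : Prop := exists x f, ev f x = 1 /\ P = rank1 x f.

Lemma isrank1_idem P : isrank1 P -> idempotents P.
Proof. by move=> [x [f [fx ->]]]; exact: idem_rank1. Qed.

Lemma isrank1_neq0 P : isrank1 P -> P != 0.
Proof. by move=> [x [f [fx ->]]]; apply: rank1_eq0; [exact: ev1_neq0r fx|exact: ev1_neq0 fx]. Qed.

Lemma perp_compl_rank1 P Q : isrank1 P -> idempotents Q -> perp Q (1 - P) ->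
  Q = 0 \/ Q = P.
Proof.
move=> [x [f [fx ->]]] /idempotentsE QQ [h1 h2].
have Q1 z : Q z = Q (rank1 x f z).
  by have /eqP := h1 z; rewrite !opE subr_eq0 => /eqP.
have Q2 z : Q z = rank1 x f (Q z).
  by have /eqP := h2 z; rewrite !opE subr_eq0 => /eqP.
have QE z : Q z = (ev f z * ev f (Q x)) *: x.
  by rewrite Q1 Q2 !rank1E opZ evZ.
have [c0|c0] := eqVneq (ev f (Q x)) 0.
  by left; apply: bounded_op_ext => z; rewrite QE c0 mulr0 scale0r.
right; apply: bounded_op_ext => z; rewrite QE rank1E.
have := congr1 (ev f) (QQ x); rewrite (QE (Q x)) evZ fx mulr1 => e.
have -> : ev f (Q x) = 1 by apply: (mulfI c0); rewrite mulr1 e.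
by rewrite mulr1.
Qed.

Lemma compl_rank1_neq0 P : isrank1 P -> 1 - P != 0.
Proof.
move=> [x [f [fx ->]]]; have [y ny] := Xinf [:: x].
apply/eqP => /(congr1 (fun B : 'B(X) => B y)) /eqP.
rewrite !opE subr_eq0 rank1E => /eqP e; apply: ny; apply/in_span1P.
by exists (ev f y).
Qed.

Lemma perp_compl P : idempotents P -> perp P (1 - P).
Proof. by move=> /idempotentsE PP; split=> z; rewrite !opE PP subrr. Qed.

Lemma idem1 : idempotents (1 : 'B(X)).
Proof. by apply/idempotentsE. Qed.

Lemma perp1 P : perp P 1 -> P = 0.
Proof. by move=> [h _]; apply: bounded_op_ext => z; have := h z; rewrite op1E. Qed.

Lemma perp0 P : perp 0 P.
Proof. by split=> z; rewrite !opE. Qed.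

Lemma one_neq0 : (1 : 'B(X)) != 0.
Proof.
have [y ny] := Xinf [::]; apply/eqP => /(congr1 (fun B : 'B(X) => B y)).
by rewrite op1E bounded_op0E.
Qed.

Section pair.
(** These stand for [phi] and S |-> - phi (- S), in either order. *)
Variables psi chi : 'B(X) -> 'B(X).
Hypothesis psiI : forall P, idempotents P -> idempotents (psi P).
Hypothesis psi_hit : forall E, idempotents E -> E != 0 ->
  exists2 P, idempotents P & psi P = E.
Hypothesis chi_hit : forall E, idempotents E -> E != 0 ->
  exists2 P, idempotents P & chi P = E.
Hypothesis hperp : forall P S, idempotents P -> idempotents S ->
  perp P S <-> perp (psi P) (chi S).

Lemma psi_neq0 P : idempotents P -> P != 0 -> psi P != 0.
Proof.
move=> iP; apply: contra_neq => e; apply: perp1.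
by apply/(hperp iP idem1); rewrite e; exact: perp0.
Qed.

Lemma psi_neq0' P : idempotents P -> psi P != 0 -> P != 0.
Proof.
move=> iP; apply: contra_neq => e.
have [S iS S1] := chi_hit idem1 one_neq0.
by apply: perp1; rewrite -S1; apply/(hperp iP iS); rewrite e; exact: perp0.
Qed.

(** A rank one idempotent E below psi P is psi Q for some Q. As chi (1 - P) is orthogonal to psi P,
    it is orthogonal to E, so Q is orthogonal to 1 - P; hence Q = P and psi P = E. *)
Lemma psi_rank1 P : isrank1 P -> isrank1 (psi P).
Proof.
move=> rP; have iP := isrank1_idem rP.
have [y [g [gy Ey gE]]] := idem_eq0_rank1 (psiI iP) (psi_neq0 iP (isrank1_neq0 rP)).
have r1 : isrank1 (rank1 y g) by exists y, g.
have [Q iQ QE] := psi_hit (isrank1_idem r1) (isrank1_neq0 r1).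
have iC := idem_compl iP.
have : perp Q (1 - P).
  apply/(hperp iQ iC); rewrite QE.
  have [h1 h2] := (hperp iP iC).1 (perp_compl iP).
  split=> z; rewrite !rank1E; first by rewrite -gE h1 ev0 scale0r.
  by rewrite opZ -Ey h2 scaler0.
case/(perp_compl_rank1 rP iQ) => [Q0|<-]; last by rewrite QE.
have : Q != 0 by apply: psi_neq0' => //; rewrite QE; exact: isrank1_neq0.
by rewrite Q0 eqxx.
Qed.

Lemma psi_inj P Q : isrank1 P -> idempotents Q -> psi P = psi Q -> Q = P.
Proof.
move=> rP iQ e; have iP := isrank1_idem rP; have iC := idem_compl iP.
have : perp Q (1 - P).
  by apply/(hperp iQ iC); rewrite -e; apply/(hperp iP iC); exact: perp_compl.
case/(perp_compl_rank1 rP iQ) => // Q0.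
have : psi Q != 0 by rewrite -e; exact: psi_neq0 (isrank1_neq0 rP).
by move=> /(psi_neq0' iQ); rewrite Q0 eqxx.
Qed.

(** Take a rank one idempotent below S. Whatever is orthogonal to S is orthogonal to it, in
    particular the [chi]-preimage of 1 - psi S; so its image is psi S, and [psi_inj] identifies it
    with S. *)
Lemma psi_rank1_preim S : idempotents S -> isrank1 (psi S) -> isrank1 S.
Proof.
move=> iS rE; have S0 := psi_neq0' iS (isrank1_neq0 rE).
have [x [f [fx Sx fS]]] := idem_eq0_rank1 iS S0.
have r1 : isrank1 (rank1 x f) by exists x, f.
have [T iT TE] := chi_hit (idem_compl (isrank1_idem rE)) (compl_rank1_neq0 rE).
have [h1 h2] : perp S T.
  by apply/(hperp iS iT); rewrite TE; exact: perp_compl (isrank1_idem rE).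
have : perp (psi (rank1 x f)) (1 - psi S).
  rewrite -TE; apply/(hperp (isrank1_idem r1) iT).
  split=> z; rewrite !rank1E; first by rewrite -fS h1 ev0 scale0r.
  by rewrite opZ -Sx h2 scaler0.
have r1' := psi_rank1 r1.
case/(perp_compl_rank1 rE (isrank1_idem r1')) => [e|/(psi_inj r1 iS) -> //].
by have := isrank1_neq0 r1'; rewrite e eqxx.
Qed.

End pair.

Lemma sim_rank1_idem x f y g : ev f x = 1 -> ev g y = 1 ->
  sim (rank1 y g) (rank1 x f) ->
  [\/ exists c, x = c *: y, exists c, f = c *: g | perp (rank1 y g) (rank1 x f)].
Proof.
move=> fx gy; case/sim_rank1; rewrite ?fx ?oner_neq0//.
- by rewrite scale1r rank1E => e; apply: Or31; exists (ev g x).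
- move=> e; apply: Or32; exists (ev f y); apply: dual_ext => z.
  by rewrite -(e z) mul1r rank1E !evZ evZl mulrC.
- move=> [/eqP e1 e2]; apply: Or33.
  have gx : ev g x = 0.
    by move: e1; rewrite rank1E scaler_eq0 (negbTE (ev1_neq0r gy)) orbF => /eqP.
  have fy : ev f y = 0.
    by have := e2 y; rewrite rank1E gy scale1r.
  by split=> z; rewrite !rank1E evZ ?gx ?fy mulr0 scale0r.
Qed.

Lemma separated_point (s : seq X) f g : ~ (exists c, f = c *: g) -> ~ (exists c, g = c *: f) ->
  exists z, [/\ ev f z = 1, ev g z = 0 & ~ in_span s z].
Proof.
move=> fg gf; have [|u [fu gu]] := @predual_separation _ _ [:: g] f; first by move/in_span1P.
have [|v [gv fv]] := @predual_separation _ _ [:: f] g; first by move/in_span1P.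
have {}gu : ev g u = 0 by apply: gu; rewrite mem_head.
have {}fv : ev f v = 0 by apply: fv; rewrite mem_head.
have [w nw] := Xinf (u :: v :: s).
exists (w - (ev f w - 1) *: u - ev g w *: v); split.
- by rewrite !evE fu fv; ring.
- by rewrite !evE gu gv; ring.
- by move=> h; apply: nw; exists (ev f w - 1), (ev g w).
Qed.

(** This will identify [phi] with its twist on rank one idempotents. By [sim_rank1_idem] it is
    enough that [rank1 z k] shares neither range nor kernel with [rank1 x f] and is not orthogonal
    to it. *)
Lemma rank1_separation x f y g : ev f x = 1 -> ev g y = 1 ->
  rank1 x f != rank1 y g -> exists z k,
  [/\ ev k z = 1, perp (rank1 z k) (rank1 y g) & ~ sim (rank1 z k) (rank1 x f)].
Proof.
move=> fx gy ne.
suff [z [k [kz ky gz h]]] : exists z k, [/\ ev k z = 1, ev k y = 0, ev g z = 0 &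
    [/\ ~ (exists c, x = c *: z), ~ (exists c, f = c *: k) & ~ (ev k x = 0 /\ ev f z = 0)]].
  exists z, k; split=> //.
    by split=> u; rewrite !rank1E evZ ?ky ?gz mulr0 scale0r.
  case: h => h1 h2 h3 /(sim_rank1_idem fx kz) [//|//|[p1 p2]]; apply: h3.
  split; first by have := congr1 (ev k) (p1 x); rewrite !rank1E fx !evZ kz ev0 mul1r mulr1.
  by have := congr1 (ev f) (p2 z); rewrite !rank1E kz !evZ fx ev0 mul1r mulr1.
have [[c xc]|nxy] := pselect (exists c, x = c *: y).
  have fg : ~ exists d, f = d *: g.
    move=> [d fd]; case/eqP: ne; apply: bounded_op_ext => u.
    have cd : d * c = 1 by rewrite -fx xc fd evZl evZ gy; ring.
    by rewrite !rank1E xc fd evZl scalerA mulrAC cd mul1r.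
  have [|z [fz gz]] := @predual_separation _ _ [:: g] f; first by move/in_span1P.
  have {}gz : ev g z = 0 by apply: gz; rewrite mem_head.
  have [k [kz ky]] : exists k, ev k z = 1 /\ ev k y = 0.
    apply: dual_separation1 => -[d zd].
    by have := fz; rewrite zd; have := gz; rewrite zd evZ gy mulr1 => ->;
      rewrite scale0r ev0 => /eqP; rewrite eq_sym oner_eq0.
  have kx : ev k x = 0 by rewrite xc evZ ky mulr0.
  exists z, k; split=> //; split.
  - move=> [d xd]; move: kx; rewrite xd evZ kz mulr1 => d0.
    by have := fx; rewrite xd d0 scale0r ev0 => /eqP; rewrite eq_sym oner_eq0.
  - by move=> [d fd]; move: fx; rewrite fd evZl kx mulr0 => /eqP; rewrite eq_sym oner_eq0.
  - by move=> [_ /eqP]; rewrite fz oner_eq0.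
have [[c fc]|nfg] := pselect (exists c, f = c *: g).
  have [k [kx ky]] := dual_separation1 nxy.
  have [|z [kz gz]] := @predual_separation _ _ [:: g] k.
    by move/in_span1P => [d kd]; move: ky; rewrite kd evZl gy mulr1 => d0;
      move: kx; rewrite kd d0 scale0r ev0l => /eqP; rewrite eq_sym oner_eq0.
  have {}gz : ev g z = 0 by apply: gz; rewrite mem_head.
  exists z, k; split=> //; split.
  - by move=> [d xd]; move: fx; rewrite fc evZl xd evZ gz !mulr0 => /eqP; rewrite eq_sym oner_eq0.
  - move=> [d fd]; have := congr1 (fun h => ev h z) (etrans (esym fc) fd).
    rewrite !evZl gz kz mulr0 mulr1 => d0; move: fx.
    by rewrite fd -d0 scale0r ev0l => /eqP; rewrite eq_sym oner_eq0.
  - by rewrite kx => -[/eqP]; rewrite oner_eq0.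
have ngf : ~ exists c, g = c *: f.
  move=> [c gc]; apply: nfg; exists c^-1.
  have c0 : c != 0.
    by apply: contra_eq_neq gy => c0; rewrite gc c0 scale0r ev0l eq_sym oner_neq0.
  by rewrite gc scalerA mulVf// scale1r.
have [z [fz gz nz]] := separated_point [:: x; y] nfg ngf.
have [k1 [k1z k1x k1y]] := dual_separation2 nz.
have [k2 [k2x k2y]] := dual_separation1 nxy.
(* Chosen so that k z = 1, k y = 0 and k x = 2. The value 2 differs from 0, which excludes
   orthogonality, and from 1, which excludes that f is a multiple of k. *)
pose k : topdual X := k1 + 2 *: k2 - (2 * ev k2 z) *: k1.
have kE u : ev k u = ev k1 u + 2 * ev k2 u - 2 * ev k2 z * ev k1 u.
  by rewrite /k !evE.
have kx : ev k x = 2 by rewrite kE k1x k2x; ring.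
exists z, k; split; rewrite ?kE ?k1z ?k1y ?k2y//; try by ring.
split.
- move=> [c xc]; apply: nz; apply/in_span2P; exists c^-1, 0.
  have c0 : c != 0.
    by apply: contra_eq_neq fx => c0; rewrite xc c0 scale0r ev0 eq_sym oner_neq0.
  by rewrite scale0r addr0 xc scalerA mulVf// scale1r.
- move=> [c fc]; have := fz; rewrite fc evZl kE k1z => h1.
  have c1 : c = 1 by rewrite -h1; ring.
  have := fx; rewrite fc evZl kx c1 mul1r => /eqP; rewrite (negbTE (two_neq1 R))//.
- by rewrite -kE kx => -[/eqP]; rewrite (negbTE (two_neq0 R)).
Qed.

End orthogonality.

(** * Adjacency of rank one idempotents *)

Section adjacency.
Variable T : Type.
Variables (D : T -> Prop) (r1 r2 s1 s2 : T -> T -> Prop) (F : T -> T).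
Hypothesis r1C : forall p q, r1 p q -> r1 q p.
Hypothesis r2C : forall p q, r2 p q -> r2 q p.
Hypothesis s1C : forall p q, s1 p q -> s1 q p.
Hypothesis s2C : forall p q, s2 p q -> s2 q p.
Hypothesis r1T : forall p q u, r1 p q -> r1 q u -> r1 p u.
Hypothesis r2T : forall p q u, r2 p q -> r2 q u -> r2 p u.
Hypothesis s1T : forall p q u, s1 p q -> s1 q u -> s1 p u.
Hypothesis s2T : forall p q u, s2 p q -> s2 q u -> s2 p u.
Hypothesis s2R : forall p, D p -> s2 (F p) (F p).
Hypothesis r12 : forall p q, D p -> D q -> r1 p q -> r2 p q -> p = q.
Hypothesis s12 : forall p q, D p -> D q -> s1 (F p) (F q) -> s2 (F p) (F q) -> p = q.
Hypothesis rs : forall p q, D p -> D q ->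
  (r1 p q \/ r2 p q) <-> (s1 (F p) (F q) \/ s2 (F p) (F q)).

(** The relations stand for same range and same kernel, exchanged or not by F. One neighbour [q0] of
    [p] decides for all: a neighbour behaving differently would make two distinct idempotents
    related in both ways, by transitivity through [p] or [q0]. *)
Lemma adjacency_dichotomy p q0 : D p -> D q0 -> r1 p q0 -> p <> q0 ->
  s1 (F p) (F q0) -> forall q, D q ->
  (r1 p q -> s1 (F p) (F q)) /\ (r2 p q -> s2 (F p) (F q)).
Proof.
move=> Dp Dq0 pq0 ne spq0 q Dq; split=> pq.
  have [//|h] := (rs Dp Dq).1 (or_introl pq).
  have [h'|h'] := (rs Dq0 Dq).1 (or_introl (r1T (r1C pq0) pq)).
    exact: s1T spq0 h'.
  by case: ne; apply: s12 => //; exact: s2T h (s2C h').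
have [h|//] := (rs Dp Dq).1 (or_intror pq).
have [h'|h'] := (rs Dq0 Dq).2 (or_introl (s1T (s1C spq0) h)).
  have e : p = q by apply: r12 => //; exact: r1T pq0 h'.
  by rewrite -e; exact: s2R.
by case: ne; apply: r12 => //; exact: r2T pq (r2C h').
Qed.

End adjacency.

(** * The graph of rank one idempotents with equal range or equal kernel *)

Section rank1_graph.
Variables (R : realType) (X : normedModType R[i]).
Implicit Types (x y z w : X) (f g h k : topdual X) (A B P Q S T : 'B(X)).
Hypothesis Xinf : unspanned X.

Definition same_range P Q : Prop := forall z, P (Q z) = Q z /\ Q (P z) = P z.
Definition same_kernel P Q : Prop := forall z, P (Q z) = P z /\ Q (P z) = Q z.

Lemma same_rangeC P Q : same_range P Q -> same_range Q P.
Proof. by move=> h z; have [] := h z. Qed.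

Lemma same_kernelC P Q : same_kernel P Q -> same_kernel Q P.
Proof. by move=> h z; have [] := h z. Qed.

Lemma same_rangeT P Q S : same_range P Q -> same_range Q S -> same_range P S.
Proof.
move=> h h' z; split.
  by have [e _] := h' z; rewrite -e; have [-> _] := h (S z).
by have [_ e] := h z; rewrite -e; have [_ ->] := h' (P z).
Qed.

Lemma same_kernelT P Q S : same_kernel P Q -> same_kernel Q S -> same_kernel P S.
Proof.
move=> h h' z; split.
  by have [<- _] := h (S z); have [-> _] := h' z; have [-> _] := h z.
by have [_ <-] := h' (P z); have [_ ->] := h z; have [_ ->] := h' z.
Qed.

Lemma same_range_kernel P Q : same_range P Q -> same_kernel P Q -> P = Q.
Proof.
by move=> h h'; apply: bounded_op_ext => z; have [e _] := h z; have [<- _] := h' z.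
Qed.

Lemma same_range_sim P Q : idempotents P -> idempotents Q -> same_range P Q -> sim P Q.
Proof.
move=> /idempotentsE PP /idempotentsE QQ h.
have PQ z : P (Q z) = Q z by have [] := h z.
have QP z : Q (P z) = P z by have [] := h z.
apply/simP => z; rewrite /jd !(opE, PQ, QP, PP, QQ).
by pairing_ring.
Qed.

Lemma same_kernel_sim P Q : idempotents P -> idempotents Q -> same_kernel P Q -> sim P Q.
Proof.
move=> /idempotentsE PP /idempotentsE QQ h.
have PQ z : P (Q z) = P z by have [] := h z.
have QP z : Q (P z) = Q z by have [] := h z.
apply/simP => z; rewrite /jd !(opE, PQ, QP, PP, QQ).
by pairing_ring.
Qed.

Lemma same_range_rank1 x f g : ev f x = 1 -> ev g x = 1 ->
  same_range (rank1 x f) (rank1 x g).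
Proof. by move=> fx gx z; rewrite !rank1E !evZ fx gx !mulr1. Qed.

Lemma same_kernel_rank1 x y f : ev f x = 1 -> ev f y = 1 ->
  same_kernel (rank1 x f) (rank1 y f).
Proof. by move=> fx gx z; rewrite !rank1E !evZ fx gx !mulr1. Qed.

Definition adjacent P Q := sim P Q /\ ~ perp P Q.

(** Expresses the geometric relation through ~ and orthogonality, both of which [phi] preserves. *)
Lemma adjacentP P Q : isrank1 P -> isrank1 Q ->
  (same_range P Q \/ same_kernel P Q) <-> adjacent P Q.
Proof.
move=> rP rQ; have [iP iQ] := (isrank1_idem rP, isrank1_idem rQ).
split.
  move=> h; split.
    by case: h; [exact: same_range_sim|exact: same_kernel_sim].
  move=> [h1 h2]; have /eqP := isrank1_neq0 rP; apply; apply: bounded_op_ext => z.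
  by case: h => h; have [e1 e2] := h z; [rewrite -e2 h2|rewrite -e1 h1].
move: rP rQ => [x [f [fx ->]]] [y [g [gy ->]]] [/simC s np].
have [[c xc]|[c fc]|p] := sim_rank1_idem fx gy s.
- left=> z; rewrite !rank1E !evZ.
  have h1 : ev f y * c = 1 by rewrite -fx xc evZ mulrC.
  have h2 : ev g x = c by rewrite xc evZ gy mulr1.
  by rewrite h2 xc !scalerA -mulrA h1 mulr1.
- right=> z; rewrite !rank1E !evZ.
  have h1 : ev f y = c by rewrite fc evZl gy mulr1.
  have h2 : c * ev g x = 1 by rewrite -fx fc evZl.
  by rewrite h1 fc !evZl mulrC (mulrAC c) h2 mul1r.
- by case: np; case: p.
Qed.

Lemma same_range_refl P : isrank1 P -> same_range P P.
Proof. by move=> /isrank1_idem /idempotentsE PP z. Qed.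

Lemma same_kernel_refl P : isrank1 P -> same_kernel P P.
Proof. by move=> /isrank1_idem /idempotentsE PP z. Qed.

Lemma other_same_range P : isrank1 P -> exists Q, [/\ isrank1 Q, same_range P Q & P <> Q].
Proof.
move=> [x [f [fx ->]]]; have [y ny] := Xinf [:: x].
have [k [ky kx]] : exists k, ev k y = 1 /\ ev k x = 0.
  by apply: dual_separation1 => h; apply: ny; apply/in_span1P.
have gx : ev (f + k) x = 1 by rewrite evDl fx kx addr0.
exists (rank1 x (f + k)); split; first by exists x, (f + k).
  exact: same_range_rank1.
move=> /(congr1 (fun B : 'B(X) => ev f (B y))); rewrite !rank1E !evE fx ky !mulr1.
by move=> /eqP; rewrite -subr_eq0 opprD addrA subrr add0r oppr_eq0 oner_eq0.
Qed.

(** A functional nonzero at both x and y, suitably scaled, replaces f and g in the two middle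
    idempotents. *)
Lemma rank1_connected P Q : isrank1 P -> isrank1 Q -> exists M N,
  [/\ isrank1 M, isrank1 N, same_range P M, same_kernel M N & same_range N Q].
Proof.
move=> [x [f [fx ->]]] [y [g [gy ->]]].
have [h [hx hy]] : exists h, ev h x != 0 /\ ev h y != 0.
  have [fy|fy] := eqVneq (ev f y) 0; last by exists f; rewrite fx oner_neq0.
  have [gx|gx] := eqVneq (ev g x) 0; last by exists g; rewrite gy oner_neq0.
  by exists (f + g); rewrite !evE fx fy gx gy addr0 add0r oner_neq0.
have kx : ev ((ev h x)^-1 *: h) x = 1 by rewrite evZl mulVf.
have ky : ev ((ev h y)^-1 *: h) y = 1 by rewrite evZl mulVf.
exists (rank1 x ((ev h x)^-1 *: h)), (rank1 y ((ev h y)^-1 *: h)); split.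
- by exists x; eexists; split; first exact: kx.
- by exists y; eexists; split; first exact: ky.
- exact: same_range_rank1.
- by move=> z; rewrite !rank1E !evE; split; congr (_ *: _); field; rewrite ?hx ?hy.
- exact: same_range_rank1.
Qed.

End rank1_graph.

(** * Action of phi on rank one idempotents *)

Section front.
Variables (R : realType) (X : normedModType R[i]).
Implicit Types (x y z w : X) (f g h k : topdual X) (A B P Q S T : 'B(X)).
Hypothesis Xinf : unspanned X.
Variable phi : 'B(X) -> 'B(X).
Hypothesis hphi : forall A B, sim A B <-> sim (phi A) (phi B).
Hypothesis phi1 : phi 1 = 1.
Hypothesis phim1 : phi (-1) = -1.
Hypothesis hit : pm_idempotents `<=` range phi.

Lemma sim1 A : sim 1 A <-> idempotents A.
Proof.
rewrite simP idempotentsE; have E z : jd 1 A z = 2 *: A z by rewrite /jd op1E scaler_nat.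
split=> h z; last by rewrite !E opZ h.
by have := h z; rewrite !E opZ => /(scalerI (two_neq0 R)) /(scalerI (two_neq0 R)).
Qed.

Lemma simm1 A : sim (-1) A <-> idempotents (- A).
Proof. by rewrite -scaleN1r simZ scaleN1r sim1. Qed.

Lemma phi_idem P : idempotents P <-> idempotents (phi P).
Proof. by rewrite -!sim1 -[X in _ <-> sim X _]phi1; exact: hphi. Qed.

Lemma phi_anti P : idempotents (- P) <-> idempotents (- phi P).
Proof. by rewrite -!simm1 -[X in _ <-> sim X _]phim1; exact: hphi. Qed.

(** The partner of [phi] for orthogonality: P is orthogonal to S when P ~ -S, that is, when phi P ~
    - cophi S. *)
Definition cophi S := - phi (- S).

Lemma cophi_idem P : idempotents P <-> idempotents (cophi P).
Proof. by rewrite /cophi -phi_anti opprK. Qed.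

Lemma phi_hit E : idempotents E -> E != 0 -> exists2 P, idempotents P & phi P = E.
Proof.
move=> iE E0; have [|P _ PE] := hit (_ : pm_idempotents E); first by left.
by exists P => //; rewrite phi_idem PE.
Qed.

Lemma cophi_hit E : idempotents E -> E != 0 -> exists2 P, idempotents P & cophi P = E.
Proof.
move=> iE E0; have [|P _ PE] := hit (_ : pm_idempotents (- E)).
  by right; split; rewrite ?oppr_eq0// mulrNN opprK.
by exists (- P); rewrite /cophi ?opprK ?PE ?opprK// phi_anti PE opprK.
Qed.

Lemma phi_perp P S : idempotents P -> idempotents S -> perp P S <-> perp (phi P) (cophi S).
Proof.
move=> iP iS; rewrite !perp_sim// -?phi_idem -?cophi_idem//.
by rewrite opprK; exact: hphi.
Qed.

Lemma perpC P S : perp P S <-> perp S P.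
Proof. by split=> -[]. Qed.

Lemma cophi_perp P S : idempotents P -> idempotents S -> perp P S <-> perp (cophi P) (phi S).
Proof. by move=> iP iS; rewrite perpC phi_perp// perpC. Qed.

Lemma phi_isrank1 P : isrank1 P -> isrank1 (phi P).
Proof.
by apply: (psi_rank1 Xinf _ phi_hit cophi_hit phi_perp) => ?; rewrite -phi_idem.
Qed.

Lemma cophi_isrank1 P : isrank1 P -> isrank1 (cophi P).
Proof.
by apply: (psi_rank1 Xinf _ cophi_hit phi_hit cophi_perp) => ?; rewrite -cophi_idem.
Qed.

Lemma phi_rank1_preim E : isrank1 E -> exists2 P, isrank1 P & phi P = E.
Proof.
move=> rE; have [P iP PE] := phi_hit (isrank1_idem rE) (isrank1_neq0 rE).
exists P => //; apply: (psi_rank1_preim Xinf _ phi_hit cophi_hit phi_perp) => //.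
  by move=> ?; rewrite -phi_idem.
by rewrite PE.
Qed.

Lemma phi_rank1_inj P Q : isrank1 P -> isrank1 Q -> phi P = phi Q -> P = Q.
Proof.
move=> rP rQ e; apply: esym.
apply: (psi_inj Xinf cophi_hit phi_perp) => //; exact: isrank1_idem.
Qed.

(** Write cophi P = phi Q. If Q <> P, some rank one idempotent orthogonal to P is not related to Q,
    whereas its image is orthogonal to cophi P = phi Q, hence related to it. *)
Lemma cophiE P : isrank1 P -> cophi P = phi P.
Proof.
move=> rS; have [Q rQ QE] := phi_rank1_preim (cophi_isrank1 rS).
suff e : Q = P by rewrite -QE e.
apply/eqP; apply: contraT => ne.
move: rS rQ QE ne => [y [g [gy ->]]] [x [f [fx ->]]] QE ne.
have [z [k [kz p np]]] := rank1_separation Xinf fx gy ne.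
exfalso; apply: np; apply/hphi; rewrite QE; apply: perp_sim'.
by apply/(phi_perp (idem_rank1 kz) (idem_rank1 gy)).
Qed.

Lemma phi_rank1N P : isrank1 P -> phi (- P) = - phi P.
Proof. by move=> /cophiE <-; rewrite /cophi opprK. Qed.

Lemma phi_perp_rank1 P Q : isrank1 P -> isrank1 Q -> perp P Q <-> perp (phi P) (phi Q).
Proof.
by move=> rP rQ; rewrite -(cophiE rQ); apply: phi_perp; exact: isrank1_idem.
Qed.

Lemma phi_adjacent P Q : isrank1 P -> isrank1 Q ->
  (same_range P Q \/ same_kernel P Q) <->
  (same_range (phi P) (phi Q) \/ same_kernel (phi P) (phi Q)).
Proof.
move=> rP rQ; rewrite !adjacentP//; [|exact: phi_isrank1..].
by rewrite /adjacent hphi phi_perp_rank1.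
Qed.

Definition straight P := forall Q, isrank1 Q ->
  (same_range P Q -> same_range (phi P) (phi Q)) /\
  (same_kernel P Q -> same_kernel (phi P) (phi Q)).
Definition crossed P := forall Q, isrank1 Q ->
  (same_range P Q -> same_kernel (phi P) (phi Q)) /\
  (same_kernel P Q -> same_range (phi P) (phi Q)).

Lemma phi_range_kernel P Q : isrank1 P -> isrank1 Q ->
  same_range (phi P) (phi Q) -> same_kernel (phi P) (phi Q) -> P = Q.
Proof. by move=> rP rQ h h'; apply: phi_rank1_inj => //; exact: same_range_kernel. Qed.

Lemma straight_or_crossed P : isrank1 P -> straight P \/ crossed P.
Proof.
move=> rP; have [Q0 [rQ0 PQ0 ne]] := other_same_range Xinf rP.
have [h|h] := (phi_adjacent rP rQ0).1 (or_introl PQ0); [left|right].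
- apply: (adjacency_dichotomy (D := @isrank1 R X) (r1 := @same_range R X)
    (r2 := @same_kernel R X) (s1 := @same_range R X) (s2 := @same_kernel R X) _ _ _ _ _ _ _ _
    _ _ _ _ rP rQ0 PQ0 ne h);
  eauto using same_rangeC, same_kernelC, same_rangeT, same_kernelT, same_range_kernel,
    phi_range_kernel, same_range_refl, same_kernel_refl, phi_isrank1.
  by move=> p q; exact: phi_adjacent.
- apply: (adjacency_dichotomy (D := @isrank1 R X) (r1 := @same_range R X)
    (r2 := @same_kernel R X) (s1 := @same_kernel R X) (s2 := @same_range R X) _ _ _ _ _ _ _ _
    _ _ _ _ rP rQ0 PQ0 ne h);
  eauto using same_rangeC, same_kernelC, same_rangeT, same_kernelT, same_range_kernel,
    phi_range_kernel, same_range_refl, same_kernel_refl, phi_isrank1.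
  by move=> p q rp rq; rewrite phi_adjacent//; split=> -[]; [right|left|right|left].
Qed.

(** If neighbours had different types, their images would have both the same range and the same
    kernel. *)
Lemma straight_step P Q : isrank1 P -> isrank1 Q ->
  same_range P Q \/ same_kernel P Q -> straight P -> straight Q.
Proof.
move=> rP rQ PQ sP; have [//|cQ] := straight_or_crossed rQ.
suff e : P = Q by rewrite -e.
have [a b] := sP _ rQ; have [a' b'] := cQ _ rP.
case: PQ => PQ; apply: phi_range_kernel => //.
- exact: a.
- by apply/same_kernelC/a'/same_rangeC.
- by apply/same_rangeC/b'/same_kernelC.
- exact: b.
Qed.

Lemma all_straight_or_crossed :
  (forall P, isrank1 P -> straight P) \/ (forall P, isrank1 P -> crossed P).
Proof.
have [[P [rP sP]]|h] := pselect (exists P, isrank1 P /\ straight P).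
  left=> Q rQ; have [M [N [rM rN PM MN NQ]]] := rank1_connected rP rQ.
  apply: (straight_step rN rQ); first by left.
  apply: (straight_step rM rN); first by right.
  by apply: (straight_step rP rM) => //; left.
right=> P rP; have [sP|//] := straight_or_crossed rP.
by case: h; exists P.
Qed.

End front.

(** * Uniform boundedness *)

Notation cabs z := (@rnorm _ (complex _)^o z).

Section geometric_completeness.
Variable R : realType.

(** The base 32 makes the tail 4 ratio (n+1) equal to ratio n / 8, half of the quarter that a hump
    gains in [uniform_boundedness]. *)
Definition ratio (n : nat) : R := 32^-1 ^+ n.

Lemma ratioS n : ratio n = 32 * ratio n.+1.
Proof. by rewrite /ratio exprS; field. Qed.

Lemma ratio_gt0 n : 0 < ratio n.
Proof. by rewrite exprn_gt0// invr_gt0 ltr0n. Qed.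

Lemma small_ratio (e : R) : 0 < e -> exists n, ratio n < e.
Proof.
move=> /ltr_add_invr [k]; rewrite add0r => h; exists k.
apply: le_lt_trans h; rewrite /ratio exprVn -natrX lef_pV2 ?posrE ?ltr0n ?expn_gt0//.
by rewrite ler_nat; exact: ltn_expl.
Qed.

Lemma le0_ratio (r C : R) : (forall n, r <= C * ratio n) -> r <= 0.
Proof.
move=> h; rewrite leNgt; apply/negP => r0.
have C0 : 0 < C.
  have := h 0%N; rewrite /ratio expr0 mulr1; exact: lt_le_trans.
have [n hn] := small_ratio (divr_gt0 r0 C0).
by have := h n; rewrite leNgt mulrC -ltr_pdivlMr// hn.
Qed.

(** The subtracted term carries the induction: 2 ratio p - 2 ratio (p+1) exceeds the bound ratio p
    of the next term. *)
Lemma geometric_tail (V : normedModType R[i]) (u : nat -> V) n m :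
  (forall k, rnorm (u k) <= ratio k) ->
  rnorm (\sum_(k < n + m) u k - \sum_(k < n) u k) <= 2 * ratio n - 2 * ratio (n + m).
Proof.
move=> h; elim: m => [|m ih]; first by rewrite addn0 !subrr rnorm0.
rewrite addnS big_ord_recr /= addrAC; apply: le_trans (rnormD _ _) _.
have := ratioS (n + m); have := ratio_gt0 (n + m).+1; have := h (n + m)%N.
by move: ih; lra.
Qed.

Lemma geometric_tail_le (V : normedModType R[i]) (u : nat -> V) n p :
  (forall k, rnorm (u k) <= ratio k) -> (n <= p)%N ->
  rnorm (\sum_(k < p) u k - \sum_(k < n) u k) <= 2 * ratio n.
Proof.
move=> h np; have := geometric_tail n (p - n) h; rewrite subnKC// => /le_trans; apply.
by have := ratio_gt0 p; lra.
Qed.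

(* Completeness restricted to geometrically dominated series; unlike the
   library's complete types it makes sense for R[i] and for dual spaces. *)
Definition geometrically_complete (V : normedModType R[i]) : Prop :=
  forall u : nat -> V, (forall n, rnorm (u n) <= ratio n) ->
  exists s, forall n, rnorm (s - \sum_(k < n) u k) <= 4 * ratio n.

Lemma rnorm_le (V : normedModType R[i]) (x : V) (M : R) :
  (`|x| <= M%:C) = (rnorm x <= M).
Proof. by rewrite -rnormE lecR. Qed.

Lemma geometrically_complete_complete (X : completeNormedModType R[i]) :
  geometrically_complete X.
Proof.
move=> u h; pose s n := \sum_(k < n) u k.
have cs : cauchy (s n @[n --> \oo]).
  apply: cauchy_exP => e e0.
  have Re0 : 0 < complex.Re e by rewrite -ltcR ge0_complexE// ltW.
  have [N hN] := small_ratio (divr_gt0 Re0 (ltr0n _ 2)).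
  exists (s N); exists N => // p /= Np; rewrite -ball_normE /=.
  rewrite -(ge0_complexE (ltW e0)) -normrN opprB -rnormE ltcR.
  apply: le_lt_trans (geometric_tail_le h Np) _.
  by move: hN; rewrite ltr_pdivlMr ?ltr0n// mulrC.
have /cvgrPdist_le cl : cvg (s n @[n --> \oo]) by exact: cauchy_cvg cs.
exists (lim (s n @[n --> \oo])) => n.
have e0 : 0 < ratio n by exact: ratio_gt0.
have := cl (ratio n)%:C; rewrite ltcR => /(_ e0) [N _ hN].
have := hN (maxn N n) (leq_maxl _ _); rewrite /= rnorm_le => h1.
have h2 := geometric_tail_le h (leq_maxr N n).
rewrite -(subrKA (s (maxn N n))); apply: le_trans (rnormD _ _) _.
by move: h1 h2 e0; rewrite /s; lra.
Qed.

(** The intervals of radius 2 ratio n around the partial sums meet pairwise, so the supremum of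
    their left ends lies in all of them. *)
Lemma geometrically_complete_real (a : nat -> R) :
  (forall n, `|a n| <= ratio n) ->
  exists s, forall n, `|s - \sum_(k < n) a k| <= 2 * ratio n.
Proof.
move=> h.
have tail n m : `|\sum_(k < n + m) a k - \sum_(k < n) a k| <= 2 * ratio n - 2 * ratio (n + m).
  elim: m => [|m ih]; first by rewrite addn0 !subrr normr0.
  rewrite addnS big_ord_recr /= addrAC; apply: le_trans (ler_normD _ _) _.
  have := ratioS (n + m); have := ratio_gt0 (n + m).+1; have := h (n + m)%N.
  by move: ih; lra.
pose E := [set \sum_(k < n) a k - 2 * ratio n | n in [set: nat]].
have cross n m : \sum_(k < n) a k - 2 * ratio n <= \sum_(k < m) a k + 2 * ratio m.
  have [nm|/ltnW mn] := leqP n m.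
    have := tail n (m - n)%N; rewrite subnKC// ler_norml => /andP[].
    by have := ratio_gt0 m; lra.
  have := tail m (n - m)%N; rewrite subnKC// ler_norml => /andP[].
  by have := ratio_gt0 n; lra.
have E0 : E !=set0 by exists (\sum_(k < 0) a k - 2 * ratio 0), 0%N.
have Eub m : ubound E (\sum_(k < m) a k + 2 * ratio m) by move=> _ [n _ <-].
have hE : has_sup E by split=> //; eexists; exact: (Eub 0%N).
exists (sup E) => n; rewrite ler_norml; apply/andP; split.
  have /= := sup_upper_bound hE => /(_ (\sum_(k < n) a k - 2 * ratio n)).
  by move=> ub; have := ub (ex_intro2 _ _ n I erefl); lra.
by rewrite lerBlDr addrC; apply: ge_sup.
Qed.

Lemma rnormZ (V : normedModType R[i]) a (x : V) :
  rnorm (a *: x) = cabs a * rnorm x.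
Proof. by apply: complexI; rewrite rmorphM /= !rnormE normrZ. Qed.

Lemma rnormM (a b : R[i]) :
  cabs (a * b) = cabs a * cabs b.
Proof. exact: (rnormZ a (b : R[i]^o)). Qed.

Lemma normi : `|'i%C| = 1 :> R[i].
Proof. by rewrite normc_def /= expr0n /= expr1n add0r sqrtr1. Qed.

Lemma rnorm_i : cabs ('i%C : R[i]) = 1.
Proof. by apply: complexI; rewrite rnormE normi. Qed.

Lemma rnormR (t : R) : cabs (t%:C) = `|t|.
Proof. by apply: complexI; rewrite rnormE normcR. Qed.

(** The bounds 2 ratio n for the real and the imaginary part add up to the constant 4. *)
Lemma geometrically_complete_complex : geometrically_complete (R[i]^o).
Proof.
move=> u h.
have Re_le (z : R[i]) : `|complex.Re z| <= cabs z.
  by rewrite -lecR rnormE; exact: normc_ge_Re.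
have Im_le (z : R[i]) : `|complex.Im z| <= cabs z.
  have -> : `|complex.Im z| = `|complex.Re ('i%C * z)|.
      by case: z => a b /=; rewrite mul0r mul1r add0r normrN.
    by rewrite (le_trans (Re_le _))// rnormM ler_piMl ?rnorm_ge0// rnorm_i.
have [s hs] := geometrically_complete_real (fun n => le_trans (Re_le _) (h n)).
have [t ht] := geometrically_complete_real (fun n => le_trans (Im_le _) (h n)).
exists (s +i* t) => n.
have ReS : complex.Re (\sum_(k < n) u k : R[i]) = \sum_(k < n) complex.Re (u k : R[i]).
  by elim/big_ind2: _ => // z b z' b' <- <-; case: (b : R[i]) (b' : R[i]) => ? ? [].
have ImS : complex.Im (\sum_(k < n) u k : R[i]) = \sum_(k < n) complex.Im (u k : R[i]).
  by elim/big_ind2: _ => // z b z' b' <- <-; case: (b : R[i]) (b' : R[i]) => ? ? [].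
rewrite -rnorm_le; set z : R[i] := _ - _.
rewrite (_ : `|_| = `|z|)// (complexE z).
apply: le_trans (ler_normD _ _) _; rewrite normrM.
rewrite normi mul1r !normcR -rmorphD lecR /=.
have -> : complex.Re z = s - \sum_(k < n) complex.Re (u k : R[i]).
  by rewrite -ReS /z; case: (\sum_(k < n) u k).
have -> : complex.Im z = t - \sum_(k < n) complex.Im (u k : R[i]).
  by rewrite -ImS /z; case: (\sum_(k < n) u k).
by have := hs n; have := ht n; lra.
Qed.

Lemma ev_sum (X : normedModType R[i]) (u : nat -> topdual X) n x :
  ev (\sum_(k < n) u k) x = \sum_(k < n) ev (u k) x.
Proof. by elim/big_rec2: _ => // i y1 y2 _ <-; rewrite evDl. Qed.

Lemma ev_rbound (X : normedModType R[i]) (f : topdual X) x :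
  cabs (ev f x) <= rnorm f * rnorm x.
Proof. by rewrite -lecR rmorphM /= !rnormE; exact: ev_bound. Qed.

Lemma dual_rnorm_le (X : normedModType R[i]) (f : topdual X) (M : R) : 0 <= M ->
  (forall x, cabs (ev f x) <= M * rnorm x) -> rnorm f <= M.
Proof.
move=> M0 h; rewrite -rnorm_le; apply: dual_norm_le; first by rewrite lecR.
by move=> x; have := h x; rewrite -lecR rmorphM /= !rnormE.
Qed.

(** The limit is taken pointwise. Dividing by |x| brings the scalar series at x under the prescribed
    rate; linearity and the bound pass to the limit. *)
Lemma geometrically_complete_dual (X : normedModType R[i]) :
  geometrically_complete (topdual X).
Proof.
move=> u h.
have lim_ex x : exists l : R[i]^o, forall n,
    rnorm (l - \sum_(k < n) ev (u k) x) <= 4 * rnorm x * ratio n.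
  have [->|x0] := eqVneq x 0.
    exists 0 => n; rewrite big1 ?subrr ?rnorm0 ?mulr0 ?mul0r// => k _.
    exact: ev0.
  have r0 := rnorm_gt0 x0.
  have rC : (rnorm x)%:C != 0 :> R[i] by rewrite rnormE normr_eq0.
  have [|l hl] := @geometrically_complete_complex
      (fun n => ((rnorm x)^-1)%:C *: (ev (u n) x : R[i]^o)).
    move=> n; rewrite rnormZr gtr0_norm ?invr_gt0// mulrC ler_pdivrMr//.
    by apply: le_trans (ev_rbound _ _) _; rewrite ler_wpM2r ?h// ltW.
  exists ((rnorm x)%:C *: l) => n.
  have := hl n; rewrite -scaler_sumr => e.
  have -> : (rnorm x)%:C *: l - \sum_(k < n) ev (u k) x =
     (rnorm x)%:C *: (l - ((rnorm x)^-1)%:C *: \sum_(k < n) (ev (u k) x : R[i]^o)) :> R[i]^o.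
    by rewrite scalerBr scalerA -rmorphM /= divff ?gt_eqF// rmorph1 scale1r.
  by rewrite rnormZr gtr0_norm//; move: e; rewrite -(ler_pM2l r0); lra.
have [g gE] := choice lim_ex.
have glin a x y : g (a *: x + y) = a * g x + g y.
  apply/eqP; rewrite -subr_eq0; apply/eqP.
  apply: (@rnorm_eq0 _ (R[i]^o)); apply/eqP; rewrite eq_le rnorm_ge0 andbT.
  apply: (@le0_ratio _ (4 * rnorm (a *: x + y) + cabs a * (4 * rnorm x)
    + 4 * rnorm y)) => n.
  have e : \sum_(k < n) ev (u k) (a *: x + y) =
     a *: (\sum_(k < n) ev (u k) x : R[i]^o) + \sum_(k < n) ev (u k) y :> R[i]^o.
    by rewrite -!ev_sum evD evZ.
  have -> : g (a *: x + y) - (a * g x + g y) =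
     (g (a *: x + y) - \sum_(k < n) ev (u k) (a *: x + y)) -
     (a *: (g x - \sum_(k < n) ev (u k) x : R[i]^o) +
     (g y - \sum_(k < n) ev (u k) y)) :> R[i]^o.
    rewrite e scalerBr.
    by apply: (@eq_of_sub _ _ _ 0 0) => //; rewrite /GRing.scale /=; ring.
  have i1 := gE (a *: x + y) n; have i2 := gE y n.
  have i3 : rnorm (a *: (g x - \sum_(k < n) ev (u k) x : R[i]^o)) <=
      cabs a * (4 * rnorm x * ratio n).
    by rewrite rnormZ ler_wpM2l ?rnorm_ge0.
  apply: le_trans (rnormD _ _) _; rewrite rnormN.
  have i4 := rnormD (a *: (g x - \sum_(k < n) ev (u k) x : R[i]^o))
    (g y - \sum_(k < n) ev (u k) y : R[i]^o).
  by move: i1 i2 i3 i4; lra.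
have gle x : `|g x| <= 4 * `|x|.
  have := gE x 0%N; rewrite big_ord0 subr0 /ratio expr0 mulr1 -rnorm_le.
  by rewrite rmorphM /= rnormE rmorph_nat.
have [s sE] := dual_of glin gle.
exists s => n; apply: dual_rnorm_le.
  by rewrite mulr_ge0// ltW// ratio_gt0.
by move=> x; rewrite evDl evNl ev_sum sE mulrAC; exact: gE.
Qed.

Lemma rnorm_le_dual (X : normedModType R[i]) (x : X) (M : R) : 0 <= M ->
  (forall f, cabs (ev f x) <= M * rnorm f) -> rnorm x <= M.
Proof.
move=> M0 h; have [f [f1 fx]] := hahn_banach x.
have {}f1 : rnorm f <= 1 by apply: dual_rnorm_le => // z; rewrite mul1r -lecR !rnormE.
have := h f; have -> : cabs (ev f x) = rnorm x.
  by apply: complexI; rewrite !rnormE fx normr_id.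
by move/le_trans; apply; rewrite ler_piMr.
Qed.

Lemma almost_attained (X : normedModType R[i]) (f : topdual X) : f != 0 ->
  exists2 v, rnorm v <= 1 & rnorm f <= 2 * cabs (ev f v).
Proof.
move=> f0; apply: contrapT => h.
have fr := rnorm_gt0 f0.
have hv v : rnorm v <= 1 -> cabs (ev f v) < rnorm f / 2.
  by move=> v1; rewrite ltNge; apply/negP => h'; apply: h; exists v => //; rewrite mulrC -ler_pdivrMr// ltr0n.
have f2 : rnorm f / 2 < rnorm f by rewrite ltr_pdivrMr// ltr_pMr// ltr1n.
suff : rnorm f <= rnorm f / 2 by rewrite leNgt f2.
apply: dual_rnorm_le; first by rewrite divr_ge0// ltW.
move=> x; have [->|x0] := eqVneq x 0; first by rewrite ev0 (@rnorm0 R X) mulr0 (@rnorm0 R (R[i]^o)).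
have r0 := rnorm_gt0 x0.
have := hv (((rnorm x)^-1)%:C *: x).
rewrite rnormZr gtr0_norm ?invr_gt0// mulVf ?gt_eqF// => /(_ (lexx _)).
rewrite evZ rnormM rnormR gtr0_norm ?invr_gt0//.
by rewrite mulrC ltr_pdivrMr// => /ltW.
Qed.

(* Sokal's gliding hump: no category argument is needed. *)
Lemma uniform_boundedness (X : normedModType R[i]) (F : set (topdual X)) :
  geometrically_complete X ->
  (forall x, exists M : R, forall f, F f -> cabs (ev f x) <= M) ->
  exists M : R, forall f, F f -> rnorm f <= M.
Proof.
move=> gcX pb; apply: contrapT => h.
have step n : exists p : topdual X * X, [/\ F p.1, rnorm p.2 <= 1,
    rnorm p.1 <= 2 * cabs (ev p.1 p.2) & 8 * n%:R <= ratio n * rnorm p.1].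
  have [f [Ff nf]] : exists f, F f /\ 8 * n%:R / ratio n < rnorm f.
    apply: contrapT => h'; apply: h; exists (8 * n%:R / ratio n) => f Ff.
    by rewrite leNgt; apply/negP => nf; apply: h'; exists f.
  have f0 : f != 0.
    apply: contraTneq nf => ->; rewrite rnorm0 -leNgt.
    by rewrite divr_ge0 ?mulr_ge0 ?ler0n// ltW// ratio_gt0.
  have [v v1 fv] := almost_attained f0.
  exists (f, v); split=> //=.
  by move: nf; rewrite ltr_pdivrMr ?ratio_gt0// (mulrC (rnorm f)) => /ltW.
have [p hp] := choice step.
(* The hump is added only if the n-th functional is small at x. In either case its modulus
   afterwards is at least half of ratio n times its modulus at the chosen vector. *)
pose hump n x := if cabs (ev (p n).1 x) < ratio n * cabs (ev (p n).1 (p n).2) / 2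
  then (ratio n)%:C *: (p n).2 else 0.
have [x [x0 xS]] : exists x : nat -> X, x 0%N = 0 /\ forall n, x n.+1 = x n + hump n (x n).
  by exists (fix x n := if n is m.+1 then x m + hump m (x m) else 0).
have hump_le n y : rnorm (hump n y) <= ratio n.
  rewrite /hump; case: ifP => _; last by rewrite rnorm0 ltW// ratio_gt0.
  by rewrite rnormZr gtr0_norm ?ratio_gt0// ler_piMr//; [exact: ltW (ratio_gt0 n)|have [] := hp n].
have hump_big n : ratio n * cabs (ev (p n).1 (p n).2) / 2 <= cabs (ev (p n).1 (x n.+1)).
  rewrite xS /hump; case: ifPn => [lt|]; last by rewrite -leNgt addr0.
  have := rnormD (ev (p n).1 (x n + (ratio n)%:C *: (p n).2) : R[i]^o)
    (- ev (p n).1 (x n) : R[i]^o).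
  rewrite rnormN evD (addrC (ev _ (x n))) addrK evZ.
  rewrite rnormM rnormR gtr0_norm ?ratio_gt0//.
  by move: lt; lra.
have [s hs] := gcX _ (fun n => hump_le n (x n)).
have xE n : \sum_(k < n) hump k (x k) = x n.
  by elim: n => [|n ih]; rewrite ?big_ord0// big_ord_recr /= ih -xS.
have [M hM] := pb s.
have [n Mn] : exists n, M < n%:R.
  exists (Num.bound `|M|); apply: le_lt_trans (ler_norm _) _; exact: archi_boundP.
have [Ff v1 att big] := hp n.
have h1 := hs n.+1; rewrite xE in h1.
have h2 := hM _ Ff; have h3 := hump_big n.
have h4 := ev_rbound (p n).1 (s - x n.+1).
have h5 : cabs (ev (p n).1 (x n.+1)) <= cabs (ev (p n).1 s) +
    cabs (ev (p n).1 (s - x n.+1)).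
  rewrite -[cabs (ev _ (s - _))]rnormN; apply: le_trans (rnormD _ _).
  by rewrite evD evN opprB addrC subrK.
have h6 : rnorm (p n).1 * rnorm (s - x n.+1) <= rnorm (p n).1 * (ratio n / 8).
  rewrite ler_wpM2l ?rnorm_ge0//; apply: le_trans h1 _.
  by have := ratioS n; lra.
have h7 : ratio n * rnorm (p n).1 <= ratio n * (2 * cabs (ev (p n).1 (p n).2)).
  by rewrite ler_pM2l ?ratio_gt0.
(* With f the n-th functional, |f s| >= ratio n |f| / 4 - ratio n |f| / 8 >= n > M. *)
by move: h2 h3 h4 h5 h6 h7 big Mn; lra.
Qed.

End geometric_completeness.

(** * Fundamental theorem of projective geometry *)

Section fundamental_theorem.
Variables (R : realType) (W W' : lmodType R[i]) (X : normedModType R[i]).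
(** Instances are X with X' and X' with X. [sigma] picks vectors on the image lines, [kappa]
    functionals for the image hyperplanes. *)
Variable b : W -> W' -> R[i].
Hypothesis bl : forall a u u' v, b (a *: u + u') v = a * b u v + b u' v.
Hypothesis br : forall a u v v', b u (a *: v + v') = a * b u v + b u v'.
Hypothesis bnd : forall u, u != 0 -> exists v, b u v != 0.
Hypothesis Winf : unspanned W.
Variables (sigma : W -> X) (kappa : W' -> topdual X).
Hypothesis sigma_neq0 : forall w, w != 0 -> sigma w != 0.
Hypothesis kappa_neq0 : forall v, v != 0 -> kappa v != 0.
Hypothesis incidence : forall w v, w != 0 -> v != 0 ->
  b w v = 0 <-> ev (kappa v) (sigma w) = 0.
Hypothesis sigma_onto : forall y, y != 0 -> exists w c, w != 0 /\ sigma w = c *: y.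
Hypothesis kappa_onto : forall g, g != 0 -> exists v c, v != 0 /\ kappa v = c *: g.
Implicit Types (u w h : W) (v : W') (y z : X) (g : topdual X) (c d t : R[i]).

Let pair0l := pair0l bl.
Let pair0r := pair0r br.
Let pairD := pairD bl.
Let pairZ := pairZ bl.
Let pairZr := pairZr br.
Let pairE := pairE bl.
Let pair_neq0l := pair_neq0l bl.
Let pair_neq0r := pair_neq0r br.

Lemma ev_in_span (s : seq X) y g : (forall z, z \in s -> ev g z = 0) -> in_span s y -> ev g y = 0.
Proof.
elim: s y => [y _ ->|w s ih y h [c /ih]]; first exact: ev0.
rewrite !evE (h w) ?mem_head// mulr0 subr0; apply=> w' ws.
by apply: h; rewrite inE ws orbT.
Qed.

(** On both sides a finite span is the common kernel of the functionals vanishing on it, and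
    incidence matches these kernels. *)
Lemma span_sigma s u : 0 \notin s -> u != 0 -> in_span s u <-> in_span (map sigma s) (sigma u).
Proof.
move=> s0 u0; have sn w : w \in s -> w != 0 by apply: contraTneq => ->.
split=> su; apply: contrapT.
  move=> /dual_separation [g [gu gs]].
  have [|v [c [v0 vc]]] := @kappa_onto g; first by exact: ev1_neq0 gu.
  have := kappa_neq0 v0; rewrite vc => c0.
  suff /(incidence u0 v0) : b u v = 0.
    by rewrite vc evZl gu mulr1 => c1; move: c0; rewrite c1 scale0r eqxx.
  apply: (pair_in_span bl) su => w ws; apply/(incidence (sn _ ws) v0).
  by rewrite vc evZl gs ?mulr0//; apply: map_f.
move=> /(@pairing_separation _ _ _ b bl br bnd) [v [uv sv]].
have v0 : v != 0 by apply: (@pair_neq0r u); rewrite uv oner_neq0.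
suff /(incidence u0 v0) : ev (kappa v) (sigma u) = 0.
  by move=> e; move: uv => /eqP; rewrite e eq_sym oner_eq0.
apply: ev_in_span su => _ /mapP [w ws ->].
by apply/(incidence (sn _ ws) v0); exact: sv.
Qed.

Lemma span_sigma1 w u : w != 0 -> u != 0 ->
  (exists c, u = c *: w) <-> exists c, sigma u = c *: sigma w.
Proof.
by move=> w0 u0; rewrite -!in_span1P; apply: (@span_sigma [:: w]); rewrite // inE eq_sym.
Qed.

Lemma span_sigma2 w w' u : w != 0 -> w' != 0 -> u != 0 ->
  (exists c d, u = c *: w + d *: w') <-> exists c d, sigma u = c *: sigma w + d *: sigma w'.
Proof.
move=> w0 w0' u0; rewrite -!in_span2P; apply: (@span_sigma [:: w; w']) => //.
by rewrite !inE ![0 == _]eq_sym negb_or w0.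
Qed.

Section chart.
Variables (w0 : W) (f0 : W').
Hypothesis w0f0 : b w0 f0 = 1.

Let f0_neq0 : f0 != 0.
Proof. by apply: (@pair_neq0r w0); rewrite w0f0 oner_neq0. Qed.

(** Affine chart: the point of the line of [sigma w] on the hyperplane kappa f0 = 1. *)
Definition chart w : X := (ev (kappa f0) (sigma w))^-1 *: sigma w.

Lemma chart_neq0 w : b w f0 != 0 -> ev (kappa f0) (sigma w) != 0.
Proof.
move=> wf; have wn := pair_neq0l wf.
by apply: contra_neq wf => e; apply/(incidence wn f0_neq0).
Qed.

Lemma chart1 w : b w f0 != 0 -> ev (kappa f0) (chart w) = 1.
Proof. by move=> wf; rewrite evZ mulVf// chart_neq0. Qed.

Lemma sigma_ideal h : b h f0 = 0 -> ev (kappa f0) (sigma h) = 0 \/ h = 0.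
Proof.
move=> hf; have [->|h0] := eqVneq h 0; first by right.
by left; apply/(incidence h0 f0_neq0).
Qed.

Lemma chart_translate w h : b w f0 = 1 -> b h f0 = 0 -> h != 0 ->
  exists c, chart (w + h) = chart w + c *: sigma h.
Proof.
move=> wf hf h0.
have wf0 : b w f0 != 0 by rewrite wf oner_neq0.
have whf : b (w + h) f0 != 0 by rewrite pairD hf addr0.
have [|c [d e]] := (@span_sigma2 w h (w + h) (pair_neq0l wf0) h0 (pair_neq0l whf)).1.
  by exists 1, 1; rewrite !scale1r.
have [kh|/eqP] := sigma_ideal hf; last by rewrite (negbTE h0).
have k1 := chart_neq0 wf0; have k2 := chart_neq0 whf.
exists ((ev (kappa f0) (sigma (w + h)))^-1 * d).
move: k2; rewrite /chart e evD !evZ kh mulr0 addr0 mulf_eq0 negb_or => /andP[c0 _].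
by rewrite scalerDr !scalerA; congr (_ *: _ + _); field; rewrite c0 k1.
Qed.

(** The translation that h induces in the chart; it will be the semilinear map on the hyperplane b h
    f0 = 0. *)
Definition shift h : X := chart (w0 + h) - chart w0.

Lemma shift0 : shift 0 = 0.
Proof. by rewrite /shift addr0 subrr. Qed.

Lemma shift_sigma h : b h f0 = 0 -> h != 0 -> exists c, c != 0 /\ shift h = c *: sigma h.
Proof.
move=> hf h0; have [c e] := chart_translate w0f0 hf h0.
exists c; rewrite /shift e addrC addKr; split=> //.
apply: contra_neq h0 => c0; move: e; rewrite c0 scale0r addr0 /chart => e.
have w0n : b w0 f0 != 0 by rewrite w0f0 oner_neq0.
have whn : b (w0 + h) f0 != 0 by rewrite pairD hf addr0.
have [|d hd] := (span_sigma1 (pair_neq0l w0n) (pair_neq0l whn)).2.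
  exists (ev (kappa f0) (sigma (w0 + h)) * (ev (kappa f0) (sigma w0))^-1).
  by rewrite -scalerA -e scalerA divff ?scale1r// chart_neq0.
have := congr1 (b^~ f0) hd; rewrite pairD hf pairZ w0f0 addr0 mulr1 => d1.
by move: hd; rewrite -d1 scale1r => /eqP; rewrite -subr_eq0 addrC addKr => /eqP.
Qed.

Lemma shift_neq0 h : b h f0 = 0 -> h != 0 -> shift h != 0.
Proof.
move=> hf h0; have [c [c0 ->]] := shift_sigma hf h0.
by rewrite scaler_eq0 (negbTE c0) (negbTE (sigma_neq0 h0)).
Qed.

Lemma sigma_indep h1 h2 a d : h1 != 0 -> ~ (exists c, h2 = c *: h1) ->
  a *: sigma h1 + d *: sigma h2 = 0 -> a = 0 /\ d = 0.
Proof.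
move=> h10 nh.
have h20 : h2 != 0 by apply: contra_not_neq nh => ->; exists 0; rewrite scale0r.
have d0 : a *: sigma h1 + d *: sigma h2 = 0 -> d = 0.
  move=> e; apply/eqP; apply: contraT => d0; case: nh.
  apply/(span_sigma1 h10 h20); exists (- d^-1 * a).
  by apply: scale_eq_opp => //; rewrite addrC e.
move=> e; have dd := d0 e; split=> //; move: e; rewrite dd scale0r addr0.
by move/eqP; rewrite scaler_eq0 (negbTE (sigma_neq0 h10)) orbF => /eqP.
Qed.

Lemma shift_indep h1 h2 a d : b h1 f0 = 0 -> b h2 f0 = 0 ->
  h1 != 0 -> ~ (exists c, h2 = c *: h1) ->
  a *: shift h1 + d *: shift h2 = 0 -> a = 0 /\ d = 0.
Proof.
move=> f1 f2 h10 nh.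
have h20 : h2 != 0 by apply: contra_not_neq nh => ->; exists 0; rewrite scale0r.
have [c1 [c10 ->]] := shift_sigma f1 h10; have [c2 [c20 ->]] := shift_sigma f2 h20.
rewrite !scalerA => /(sigma_indep h10 nh) [/eqP e1 /eqP e2]; split; apply/eqP.
  by move: e1; rewrite mulf_eq0 (negbTE c10) orbF.
by move: e2; rewrite mulf_eq0 (negbTE c20) orbF.
Qed.

(** Parallelogram rule: the image of w0 + h1 + h2 lies on the parallels through the images of w0 +
    h1 and w0 + h2, and independence makes their intersection a single point. *)
Lemma shiftD_indep h1 h2 : b h1 f0 = 0 -> b h2 f0 = 0 ->
  h1 != 0 -> ~ (exists c, h2 = c *: h1) -> shift (h1 + h2) = shift h1 + shift h2.
Proof.
move=> f1 f2 h10 nh.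
have h20 : h2 != 0 by apply: contra_not_neq nh => ->; exists 0; rewrite scale0r.
have w1 : b (w0 + h1) f0 = 1 by rewrite pairD f1 addr0.
have w2 : b (w0 + h2) f0 = 1 by rewrite pairD f2 addr0.
have [c1 e1] := chart_translate w2 f1 h10.
have [c2 e2] := chart_translate w1 f2 h20.
have [d1 [_ e3]] := shift_sigma f1 h10; have [d2 [_ e4]] := shift_sigma f2 h20.
have e5 : shift (h1 + h2) = shift h2 + c1 *: sigma h1.
  by rewrite /shift (addrC h1) addrA e1 addrAC.
have e6 : shift (h1 + h2) = shift h1 + c2 *: sigma h2.
  by rewrite /shift addrA e2 addrAC.
have [|h _] := @sigma_indep h1 h2 (c1 - d1) (d2 - c2) h10 nh.
  by apply: (eq_of_sub (etrans (esym e5) e6)); rewrite e3 e4; pairing_ring.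
rewrite e5 addrC; congr (_ + _); rewrite e3; congr (_ *: _).
by apply/eqP; rewrite -subr_eq0 h.
Qed.

Lemma other_direction h : exists h', b h' f0 = 0 /\ ~ (exists c, h' = c *: h).
Proof.
have [z nz] := Winf [:: w0; h]; exists (z - b z f0 *: w0); split.
  by rewrite !pairE w0f0 mulr1 subrr.
by move=> [c e]; apply: nz; apply/in_span2P; exists (b z f0), c; rewrite -e addrC subrK.
Qed.

Lemma not_multiple h c h' : ~ (exists d, h' = d *: h) -> h' != 0 /\ ~ (exists d, h' = d *: (c *: h))
   /\ ~ (exists d, c *: h + h' = d *: h).
Proof.
move=> nh; split; first by apply: contra_not_neq nh => ->; exists 0; rewrite scale0r.
split=> -[d e]; apply: nh; first by exists (d * c); rewrite -scalerA.
by exists (d - c); rewrite scalerBl -e addrC addKr.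
Qed.

(** For dependent vectors a third direction h3 is added: h1 + (h2 + h3) and (h1 + h2) + h3 are both
    covered by the independent case. *)
Lemma shiftD h1 h2 : b h1 f0 = 0 -> b h2 f0 = 0 -> shift (h1 + h2) = shift h1 + shift h2.
Proof.
move=> f1 f2; have [->|h10] := eqVneq h1 0; first by rewrite shift0 !add0r.
have [->|h20] := eqVneq h2 0; first by rewrite shift0 !addr0.
have [[c h2c]|nh] := pselect (exists c, h2 = c *: h1); last exact: shiftD_indep.
have [h3 [f3 n3]] := other_direction h1.
have [h30 [n32 n321]] := not_multiple c n3.
have f23 : b (h2 + h3) f0 = 0 by rewrite pairD f2 f3 addr0.
have e1 : shift (h1 + (h2 + h3)) = shift h1 + (shift h2 + shift h3).
  by rewrite !shiftD_indep// h2c.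
apply: (addIr (shift h3)); rewrite -[RHS]addrA -e1 (addrA h1).
have [->|h120] := eqVneq (h1 + h2) 0; first by rewrite shift0 !add0r.
rewrite (shiftD_indep _ f3 h120) ?pairD ?f1 ?f2 ?addr0// => -[d e].
by apply: n3; exists (d * (1 + c)); rewrite e h2c -scalerA scalerDl scale1r.
Qed.

Lemma shift_scale h c : b h f0 = 0 -> exists t, shift (c *: h) = t *: shift h.
Proof.
move=> hf; have [->|c0] := eqVneq c 0; first by exists 0; rewrite !scale0r shift0.
have [->|h0] := eqVneq h 0; first by exists 0; rewrite scaler0 shift0 scaler0.
have ch0 : c *: h != 0 by rewrite scaler_eq0 (negbTE c0).
have chf : b (c *: h) f0 = 0 by rewrite pairZ hf mulr0.
have [d [_ e1]] := shift_sigma chf ch0.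
have [d' [d'0 e2]] := shift_sigma hf h0.
have [|k e3] := (span_sigma1 h0 ch0).1; first by exists c.
by exists (d * k / d'); rewrite e1 e2 e3 !scalerA divfK.
Qed.

(** Expanding shift (c (h1 + h2)) in two ways, independence forces the same factor in both
    directions. *)
Lemma scale_transfer h1 h2 c t : b h1 f0 = 0 -> b h2 f0 = 0 ->
  h1 != 0 -> ~ (exists c, h2 = c *: h1) ->
  shift (c *: h1) = t *: shift h1 -> shift (c *: h2) = t *: shift h2.
Proof.
move=> f1 f2 h10 nh e1.
have [t2 e2] := shift_scale c f2.
have f12 : b (h1 + h2) f0 = 0 by rewrite pairD f1 f2 addr0.
have [t3] := shift_scale c f12.
rewrite scalerDr !shiftD ?pairZ ?f1 ?f2 ?mulr0// e1 e2 => e3.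
have [|a d] := @shift_indep h1 h2 (t - t3) (t2 - t3) f1 f2 h10 nh.
  by apply: (eq_of_sub e3); pairing_ring.
by move/eqP: a; move/eqP: d; rewrite !subr_eq0 => /eqP -> /eqP ->.
Qed.

Lemma scale_uniform : exists theta : R[i] -> R[i],
  forall c h, b h f0 = 0 -> shift (c *: h) = theta c *: shift h.
Proof.
have [h1 [f1 n1]] := other_direction 0.
have h10 : h1 != 0 by apply: contra_not_neq n1 => ->; exists 0; rewrite scaler0.
have /choice [theta thetaE] c := shift_scale c f1.
exists theta => c h hf.
have [[d hd]|nh] := pselect (exists d, h = d *: h1); last exact: scale_transfer (thetaE c).
have [h2 [f2 n2]] := other_direction h1.
have e2 := scale_transfer f1 f2 h10 n2 (thetaE c).
have [h20 _] := not_multiple 0 n2.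
have [->|h0] := eqVneq h 0; first by rewrite scaler0 shift0 scaler0.
apply: scale_transfer e2 => // -[k hk]; apply: n2.
have k0 : k != 0 by apply: contra_neq h0 => k0; rewrite hk k0 scale0r.
by exists (k^-1 * d); rewrite -scalerA -hd hk scalerA mulVf// scale1r.
Qed.

Lemma chart_onto y : ev (kappa f0) y = 1 -> exists w, b w f0 = 1 /\ chart w = y.
Proof.
move=> ky; have [w [c [w_0 e]]] := sigma_onto (ev1_neq0r ky).
have c0 : c != 0 by apply: contraTneq (sigma_neq0 w_0) => c0; rewrite e c0 scale0r eqxx.
have kc : ev (kappa f0) (sigma w) = c by rewrite e evZ ky mulr1.
have wf : b w f0 != 0 by apply: contra_neq c0 => /(incidence w_0 f0_neq0); rewrite kc.
have wn : (b w f0)^-1 *: w != 0 by rewrite scaler_eq0 invr_eq0 (negbTE wf).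
exists ((b w f0)^-1 *: w); split; first by rewrite pairZ mulVf.
have [|d ed] := (span_sigma1 w_0 wn).1; first by exists (b w f0)^-1.
have d0 : d != 0 by apply: contraTneq (sigma_neq0 wn) => d0; rewrite ed d0 scale0r eqxx.
rewrite /chart ed evZ kc e !scalerA (_ : _ * _ = 1) ?scale1r//.
by field; rewrite c0 d0.
Qed.

Lemma shift_onto z : ev (kappa f0) z = 0 -> exists h, b h f0 = 0 /\ shift h = z.
Proof.
move=> kz; have w0n : b w0 f0 != 0 by rewrite w0f0 oner_neq0.
have [|w [wf e]] := @chart_onto (chart w0 + z); first by rewrite evD chart1// kz addr0.
exists (w - w0); split; first by rewrite !pairE wf w0f0 subrr.
by rewrite /shift (addrC w0) subrK e addrC addKr.
Qed.

Lemma shift_ideal h : b h f0 = 0 -> ev (kappa f0) (shift h) = 0.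
Proof.
by move=> hf; rewrite evD evN !chart1 ?subrr// ?pairD ?hf ?addr0 w0f0 oner_neq0.
Qed.

Lemma shift_inj h : b h f0 = 0 -> shift h = 0 -> h = 0.
Proof.
move=> hf e; apply/eqP; apply: contraT => h0.
by have := shift_neq0 hf h0; rewrite e eqxx.
Qed.

End chart.

Definition semilinear_for (theta : R[i] -> R[i]) (V : lmodType R[i]) (L : W -> V) : Prop :=
  (forall u w, L (u + w) = L u + L w) /\ (forall c w, L (c *: w) = theta c *: L w).

Lemma fundamental_theorem : exists (theta : R[i] -> R[i]) (T : W -> X),
  [/\ [/\ forall c d, theta (c + d) = theta c + theta d,
          forall c d, theta (c * d) = theta c * theta d, theta 1 = 1,
          forall c, theta c = 0 -> c = 0 & forall d, exists c, theta c = d],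
      semilinear_for theta T /\ (forall w, T w = 0 -> w = 0),
      forall y, exists w, T w = y,
      forall w, w != 0 -> exists c, c != 0 /\ T w = c *: sigma w &
      forall v, v != 0 -> exists d, d != 0 /\
        forall w, ev (kappa v) (T w) = d * theta (b w v)].
Proof.
have [w0 nw0] := Winf [::]; have [v wv] := bnd (introN eqP nw0).
have w0f0 : b w0 ((b w0 v)^-1 *: v) = 1 by rewrite pairZr mulVf.
move: {v wv} (_ *: v) w0f0 => f0 w0f0.
have w0n : b w0 f0 != 0 by rewrite w0f0 oner_neq0.
have [theta thE] := scale_uniform w0f0.
have [h1 [f1 n1]] := other_direction w0f0 0.
have h10 : h1 != 0 by apply: contra_not_neq n1 => ->; exists 0; rewrite scaler0.
have s0 := shift_neq0 w0f0 f1 h10.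
have hZ c h : b h f0 = 0 -> b (c *: h) f0 = 0 by rewrite pairZ => ->; rewrite mulr0.
have thD c d : theta (c + d) = theta c + theta d.
  by apply: (scaler_injl s0); rewrite -thE// scalerDl (shiftD w0f0)// ?hZ// !thE// scalerDl.
have thM c d : theta (c * d) = theta c * theta d.
  by apply: (scaler_injl s0); rewrite -thE// -scalerA !thE ?scalerA// hZ.
have th1 : theta 1 = 1 by apply: (scaler_injl s0); rewrite -thE// !scale1r.
have thI c : theta c = 0 -> c = 0.
  move=> c0; have := thE c _ f1; rewrite c0 scale0r => /(shift_inj w0f0 (hZ c _ f1)) /eqP.
  by rewrite scaler_eq0 (negbTE h10) orbF => /eqP.
have thS d : exists c, theta c = d.
  have kd : ev (kappa f0) (d *: shift w0 f0 h1) = 0 by rewrite evZ shift_ideal// mulr0.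
  have [h [hf he]] := shift_onto w0f0 kd.
  have [[c hc]|nh] := pselect (exists c, h = c *: h1).
    by exists c; apply: (scaler_injl s0); rewrite -thE// -hc.
  have [|_ /eqP] := @shift_indep _ _ w0f0 h1 h (- d) 1 f1 hf h10 nh.
    by rewrite he scale1r scaleNr addNr.
  by rewrite oner_eq0.
(* W splits into the line of w0 and the hyperplane b w f0 = 0; T is theta-semilinear on the first
   and [shift] on the second. *)
pose T w := theta (b w f0) *: chart f0 w0 + shift w0 f0 (w - b w f0 *: w0).
have ker w : b (w - b w f0 *: w0) f0 = 0 by rewrite !pairE w0f0 mulr1 subrr.
have TD u w : T (u + w) = T u + T w.
  have e : u + w - b (u + w) f0 *: w0 = (u - b u f0 *: w0) + (w - b w f0 *: w0).
    by rewrite pairD scalerDl opprD addrACA.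
  by rewrite /T e shiftD// pairD thD scalerDl [RHS]addrACA.
have TZ c w : T (c *: w) = theta c *: T w.
  rewrite /T pairZ thM scalerDr scalerA; congr (_ + _).
  by rewrite -thE//; congr (shift _ _ _); rewrite scalerBr scalerA.
have kT w : ev (kappa f0) (T w) = theta (b w f0).
  by rewrite /T evD evZ (shift_ideal w0f0 (ker w)) (chart1 w0f0 w0n) addr0 mulr1.
have th0 : theta 0 = 0 by apply: (addrI (theta 0)); rewrite -thD !addr0.
have T0 : T 0 = 0 by apply: (addrI (T 0)); rewrite -TD !addr0.
have TI w : T w = 0 -> w = 0.
  move=> e; have := kT w; rewrite e ev0 => /esym/thI b0.
  move: e (ker w); rewrite /T b0 th0 !scale0r subr0 add0r => e _.
  by apply: (shift_inj w0f0).
have TS y : exists w, T w = y.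
   have [|h [hf he]] := @shift_onto _ _ w0f0 (y - ev (kappa f0) y *: chart f0 w0).
    by rewrite evD evN evZ (chart1 w0f0 w0n) mulr1 subrr.
  have [c cE] := thS (ev (kappa f0) y); exists (c *: w0 + h).
  by rewrite /T !pairE w0f0 hf mulr1 addr0 cE (addrC (c *: w0)) addrK he addrC subrK.
have Tsigma w : w != 0 -> exists c, c != 0 /\ T w = c *: sigma w.
  move=> wn; suff [c cE] : exists c, T w = c *: sigma w.
    exists c; split=> //; apply: contra_neq wn => c0.
    by apply: TI; rewrite cE c0 scale0r.
  have [bw|bw] := eqVneq (b w f0) 0.
    rewrite /T bw th0 !scale0r subr0 add0r.
    by have [c [_ e]] := shift_sigma w0f0 bw wn; exists c.
  have [h [hf hE]] : exists h, b h f0 = 0 /\ (b w f0)^-1 *: w = w0 + h.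
    exists ((b w f0)^-1 *: w - w0); rewrite (addrC w0) subrK !pairE w0f0 mulVf//.
    by rewrite subrr.
  have wE : w = b w f0 *: (w0 + h) by rewrite -hE scalerA divff// scale1r.
  have un : w0 + h != 0 by rewrite -hE scaler_eq0 invr_eq0 (negbTE bw).
  have [|d dE] := (span_sigma1 wn un).1; first by exists (b w f0)^-1.
  exists (theta (b w f0) * ((ev (kappa f0) (sigma (w0 + h)))^-1 * d)).
  rewrite {1}wE TZ -!scalerA -dE; congr (_ *: _).
  rewrite /T pairD w0f0 hf addr0 th1 !scale1r (addrAC w0) subrr add0r /shift.
  by rewrite [LHS]addrC subrK.
clearbody T; exists theta, T; split=> // v vn.
have [y vy] := dual_neq0 (kappa_neq0 vn); have [u uE] := TS y.
have Tker w : b w v = 0 <-> ev (kappa v) (T w) = 0.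
  have [->|wn] := eqVneq w 0.
    by rewrite pair0l T0 ev0.
  have [c [c0 ->]] := Tsigma w wn; rewrite incidence// evZ.
  split=> [->|/eqP]; first by rewrite mulr0.
  by rewrite mulf_eq0 (negbTE c0) => /eqP.
have u0 : b u v != 0 by apply: contra_neq vy => /Tker; rewrite uE.
(* [kappa v] composed with T and the pairing with v have the same kernel, so both are determined by
   one vector that pairs to 1 with v. *)
exists (ev (kappa v) (T ((b u v)^-1 *: u))); split.
  by apply: contra_neq (oner_neq0 R[i]) => /Tker; rewrite pairZ mulVf.
move=> w; have /Tker : b (w - b w v *: ((b u v)^-1 *: u)) v = 0.
  by rewrite !pairE mulVf// mulr1 subrr.
have TN x : T (- x) = - T x.
  by apply: (addrI (T x)); rewrite -TD !subrr.
by rewrite TD TN TZ evD evN evZ => /eqP; rewrite subr_eq0 mulrC => /eqP.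
Qed.

End fundamental_theorem.

(** * Continuity of the field automorphism *)

Lemma history_choice (A : Type) (P : seq A -> A -> Prop) :
  (forall s, exists a, P s a) -> exists a : nat -> A, forall n, P (mkseq a n) (a n).
Proof.
move=> /choice [g gP].
pose hist := fix hist n := if n is m.+1 then rcons (hist m) (g (hist m)) else [::].
exists (fun n => g (hist n)) => n; suff -> : mkseq (fun n => g (hist n)) n = hist n by [].
by elim: n => // n ih; rewrite mkseqS ih.
Qed.

Section pair_kernel.
Variables (K : fieldType) (W W' : lmodType K) (b : W -> W' -> K).
Hypothesis bl : forall a u u' v, b (a *: u + u') v = a * b u v + b u' v.
Hypothesis Winf : unspanned W.

(** Avoiding an arbitrary list [t] carries the induction: of two vectors independent modulo [t], a
    combination kills one more functional and still avoids [t]. *)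
Lemma pair_kernel (s : seq W') (t : seq W) :
  exists w, ~ in_span t w /\ forall v, v \in s -> b w v = 0.
Proof.
elim: s t => [|v s ih] t; first by have [x nx] := Winf t; exists x.
have [x [nx xs]] := ih t.
have [xv|xv] := eqVneq (b x v) 0.
  by exists x; split=> // u; rewrite inE => /orP[/eqP -> //|]; exact: xs.
have [y [ny ys]] := ih (x :: t).
exists (- (b y v / b x v) *: x + y); split.
  by move=> h; apply: ny; exists (b y v / b x v); rewrite addrC -scaleNr.
move=> u; rewrite inE bl => /orP[/eqP ->|us]; first by rewrite mulNr divfK// addNr.
by rewrite (xs _ us) (ys _ us) mulr0 addr0.
Qed.

End pair_kernel.

Section automorphism.
Variable R : realType.
Variable theta : R[i] -> R[i].
Implicit Types (c d : R[i]) (t : R).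
Hypothesis thD : forall c d, theta (c + d) = theta c + theta d.
Hypothesis thM : forall c d, theta (c * d) = theta c * theta d.
Hypothesis th1 : theta 1 = 1.
Hypothesis thI : forall c, theta c = 0 -> c = 0.
Hypothesis thS : forall d, exists c, theta c = d.

Lemma theta0 : theta 0 = 0.
Proof. by apply: (addrI (theta 0)); rewrite -thD !addr0. Qed.

Lemma thetaN c : theta (- c) = - theta c.
Proof. by apply: (addrI (theta c)); rewrite -thD !subrr theta0. Qed.

Lemma theta_nat n : theta n%:R = n%:R.
Proof. by elim: n => [|n ih]; rewrite ?theta0// -addn1 !natrD thD ih th1. Qed.

Lemma theta_inj c d : theta c = theta d -> c = d.
Proof.
move=> e; apply/eqP; rewrite -subr_eq0; apply/eqP/thI.
by rewrite thD thetaN e subrr.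
Qed.

Lemma rnorm_nat n : cabs (n%:R : R[i]) = n%:R.
Proof. by rewrite -[X in rnorm X](rmorph_nat (@real_complex R)) rnormR ger0_norm. Qed.

Section bounded_inverse.
Variable M : R.
Hypothesis thB : forall c, cabs (theta c) <= 1 -> cabs c <= M.

(* theta fixes the integers, so n (c - t) stays bounded when theta c = t. *)
Lemma theta_real_ge0 t : 0 <= t -> theta t%:C = t%:C.
Proof.
move=> t0; have [c ct] := thS t%:C.
suff e : t%:C = c by rewrite {1}e ct.
apply/esym/eqP; rewrite -subr_eq0; apply/eqP.
apply: (@rnorm_eq0 _ (R[i]^o)); apply/eqP; rewrite eq_le rnorm_ge0 andbT.
have h n : n%:R * cabs (c - t%:C) <= M + 1.
  have nt : 0 <= n%:R * t by rewrite mulr_ge0.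
  have /andP[k1 k2] := truncn_itv nt; set k := Num.truncn _ in k1 k2.
  have e1 : cabs ((n%:R * t - k%:R)%:C) <= 1.
    by rewrite rnormR ler_norml; move: k1 k2; rewrite -natr1; lra.
  have e2 : cabs (n%:R * c - k%:R) <= M.
    apply: thB; rewrite thD thetaN thM !theta_nat ct.
    by move: e1; rewrite rmorphB rmorphM /= !rmorph_nat.
  have := rnormD (n%:R * c - k%:R : R[i]^o) (- (n%:R * t - k%:R)%:C : R[i]^o).
  rewrite rnormN => /le_trans/(_ (lerD e2 e1)).
  have -> : (n%:R * c - k%:R : R[i]^o) - (n%:R * t - k%:R)%:C = n%:R * (c - t%:C).
    by rewrite rmorphB rmorphM /= !rmorph_nat /=; ring.
  by rewrite rnormM rnorm_nat.
rewrite leNgt; apply/negP => r0.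
have M0 : 0 <= M + 1 by have := h 0%N; rewrite mul0r.
have := archi_boundP (divr_ge0 M0 (ltW r0)); rewrite ltr_pdivrMr//.
by rewrite ltNge h.
Qed.

Lemma theta_real t : theta t%:C = t%:C.
Proof.
have [t0|t0] := leP 0 t; first exact: theta_real_ge0.
by rewrite -[t]opprK rmorphN thetaN theta_real_ge0// oppr_ge0 ltW.
Qed.

Lemma conjcE (a c : R) : Num.conj (a +i* c) = a -i* c :> R[i].
Proof. by []. Qed.

Lemma theta_id_or_conj : (forall c, theta c = c) \/ (forall c, theta c = Num.conj c).
Proof.
have : theta 'i%C * theta 'i%C = -1.
  by rewrite -thM -[_ * _]/('i%C ^+ 2) sqr_i thetaN th1.
have : ('i%C : R[i]) * 'i%C = -1 by rewrite -[_ * _]/('i%C ^+ 2) sqr_i.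
move=> <- /eqP; rewrite -subr_eq0.
have -> : theta 'i%C * theta 'i%C - 'i%C * 'i%C = (theta 'i%C - 'i%C) * (theta 'i%C + 'i%C) by ring.
rewrite mulf_eq0 subr_eq0 addr_eq0 => /orP[] /eqP ti; [left|right] => -[a c].
  by rewrite (complexE (a +i* c)) /= thD thM !theta_real ti.
rewrite conjcE [LHS](congr1 theta (complexE _)) /= thD thM !theta_real ti.
by rewrite [RHS]complexE /= rmorphN mulrN mulNr.
Qed.

End bounded_inverse.

End automorphism.

Section continuity.
Variables (R : realType) (W W' X : normedModType R[i]).
Variable b : W -> W' -> R[i].
Hypothesis bl : forall a u u' v, b (a *: u + u') v = a * b u v + b u' v.
Hypothesis br : forall a u v v', b u (a *: v + v') = a * b u v + b u v'.
Hypothesis bnd : forall u, u != 0 -> exists v, b u v != 0.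
Hypothesis Winf : unspanned W.
Hypothesis bb : forall w v, cabs (b w v) <= rnorm w * rnorm v.
Hypothesis gcX : geometrically_complete X.
Variables (theta : R[i] -> R[i]) (T : W -> X) (kappa : W' -> topdual X).
Hypothesis thD : forall c d, theta (c + d) = theta c + theta d.
Hypothesis thM : forall c d, theta (c * d) = theta c * theta d.
Hypothesis th1 : theta 1 = 1.
Hypothesis thI : forall c, theta c = 0 -> c = 0.
Hypothesis TD : forall u w, T (u + w) = T u + T w.
Hypothesis TZ : forall c w, T (c *: w) = theta c *: T w.
Hypothesis TS : forall y, exists w, T w = y.
Hypothesis kT : forall v, v != 0 -> exists d, d != 0 /\
  forall w, ev (kappa v) (T w) = d * theta (b w v).
Implicit Types (c : R[i]) (w : W) (v : W').

(** [theta] fixes the integers, so dividing c by a large p makes [theta c] small while c stays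
    large. *)
Lemma theta_unbounded :
  ~ (exists M : R, forall c, cabs (theta c) <= 1 -> cabs c <= M) ->
  forall e L : R, 0 < e -> exists c, cabs (theta c) <= e /\ L < cabs c.
Proof.
move=> h e L e0.
have [p pe] : exists p : nat, e^-1 < p%:R.
  by exists (Num.bound e^-1); apply: archi_boundP; rewrite invr_ge0 ltW.
have p0 : 0 < p%:R :> R by apply: lt_trans pe; rewrite invr_gt0.
have pC : p%:R != 0 :> R[i].
  by move: p0; rewrite pnatr_eq0 ltr0n lt0n.
have [c [c1 cL]] : exists c, cabs (theta c) <= 1 /\ L * p%:R < cabs c.
  apply: contrapT => h'; apply: h; exists (L * p%:R) => c c1.
  by rewrite leNgt; apply/negP => cL; apply: h'; exists c.
have cE : c = p%:R * (c / p%:R) by field.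
have cN : cabs c = p%:R * cabs (c / p%:R).
  by rewrite {1}cE rnormM rnorm_nat.
have thE : theta c = p%:R * theta (c / p%:R) by rewrite {1}cE thM theta_nat.
move: c1 cL; rewrite thE rnormM rnorm_nat cN => c1 cL.
exists (c / p%:R); split; last by move: cL; rewrite mulrC ltr_pM2l.
apply: (@le_trans _ _ p%:R^-1); first by rewrite -ler_pdivlMl// mulr1 in c1.
by rewrite -[e]invrK lef_pV2 ?posrE ?invr_gt0// ltW.
Qed.

(* If theta were unbounded, a series y = sum theta(c_n) T w_n, triangular with
   respect to v_n, would converge while T^-1 y pairs with v_n to more than
   n times the norm of v_n. *)
Lemma theta_bounded :
  exists M : R, forall c, cabs (theta c) <= 1 -> cabs c <= M.
Proof.
apply: contrapT => /theta_unbounded big.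
(* A triple (w, v, c) extending the history s: w is killed by the earlier functionals, b w v = 1,
   [theta c] is small enough for convergence, and c is so large that the new partial sum pairs with
   v to more than n |v|, n being the length of s. *)
pose P (s : seq (W * W' * R[i])) (p : W * W' * R[i]) :=
  [/\ forall q, q \in s -> b p.1.1 q.1.2 = 0, b p.1.1 p.1.2 = 1,
      cabs (theta p.2) * rnorm (T p.1.1) <= ratio R (size s) &
      (size s)%:R * rnorm p.1.2 < cabs (p.2 + \sum_(q <- s) q.2 * b q.1.1 p.1.2)].
have [a aP] : exists a : nat -> W * W' * R[i], forall n, P (mkseq a n) (a n).
  apply: history_choice => s.
  have [w [/eqP w0 ws]] := pair_kernel bl Winf (map (fun q => q.1.2) s) [::].
  have [v wv] := bnd w0.
  have wv1 : b w ((b w v)^-1 *: v) = 1.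
    by rewrite (pairZr br) mulVf.
  move: {wv v} (_ *: v) wv1 => v wv1.
  have e0 : 0 < ratio R (size s) / (rnorm (T w) + 1).
    by rewrite divr_gt0 ?ratio_gt0// ltr_wpDl ?rnorm_ge0.
  have [K KE] : exists K, K = \sum_(q <- s) q.2 * b q.1.1 v by eexists.
  have [c [c1 c2]] := big _ ((size s)%:R * rnorm v + cabs K) e0.
  exists (w, v, c); split=> //=.
  - by move=> q qs; apply: ws; apply: map_f.
  - apply: le_trans (ler_wpM2r (rnorm_ge0 _) c1) _.
    rewrite mulrAC ler_pdivrMr ?ltr_wpDl ?rnorm_ge0//.
    by rewrite ler_pM2l ?ratio_gt0// lerDl.
  - rewrite -KE; have := rnormD (c + K : R[i]^o) (- K : R[i]^o).
    by rewrite addrK rnormN; move: c2; lra.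
have u_le n : rnorm (theta (a n).2 *: T (a n).1.1) <= ratio R n.
  by have [_ _ h _] := aP n; rewrite rnormZ; rewrite size_mkseq in h.
have [y hy] := gcX u_le; have [z zE] := TS y.
pose part n := \sum_(k < n) (a k).2 *: (a k).1.1.
have Tpart n : T (part n) = \sum_(k < n) theta (a k).2 *: T (a k).1.1.
  have T0 : T 0 = 0 by apply: (addrI (T 0)); rewrite -TD !addr0.
  elim: n => [|n ih]; first by rewrite /part !big_ord0.
  by rewrite /part !big_ord_recr /= TD TZ -/(part n) ih.
have bpart n v : b (part n) v = \sum_(q <- mkseq a n) q.2 * b q.1.1 v.
  elim: n => [|n ih]; first by rewrite /part big_ord0 big_nil (pair0l bl).
  by rewrite /part big_ord_recr /= (pairD bl) (pairZ bl) -/(part n) ih mkseqS big_rcons.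
have bz m : b z (a m).1.2 = (a m).2 + b (part m) (a m).1.2.
  have [_ wv _ _] := aP m; have v0 : (a m).1.2 != 0.
    by apply: (@pair_neq0r _ _ _ _ br (a m).1.1); rewrite wv oner_neq0.
  have [d [d0 dE]] := kT v0.
  (* All later w pair to 0 with this v, so the pairing is frozen after step m. *)
  have stable j : b (part (m.+1 + j)%N) (a m).1.2 = (a m).2 + b (part m) (a m).1.2.
    elim: j => [|j ih].
      by rewrite addn0 /part big_ord_recr /= (pairD bl) (pairZ bl) wv mulr1 addrC.
    rewrite addnS /part big_ord_recr /= (pairD bl) (pairZ bl) -/(part _) ih.
    have [h _ _ _] := aP (m.+1 + j)%N; rewrite (h (a m)) ?mulr0 ?addr0//.
    by apply: map_f; rewrite mem_iota /= add0n ltn_addr.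
  apply: (theta_inj thD thI); apply: (mulfI d0); rewrite -dE zE.
  apply/eqP; rewrite -subr_eq0; apply/eqP.
  apply: (@rnorm_eq0 _ (R[i]^o)); apply/eqP; rewrite eq_le rnorm_ge0 andbT.
  apply: (@le0_ratio _ _ (rnorm (kappa (a m).1.2) * 4)) => j.
  rewrite -(stable j) -dE Tpart -evN -evD.
  apply: le_trans (ev_rbound _ _) _; rewrite -mulrA ler_wpM2l ?rnorm_ge0//.
  apply: le_trans (hy _) _; rewrite ler_pM2l//.
  by apply: ler_wiXn2l; rewrite ?invr_ge0 ?leq_addl ?invf_le1 ?ler1n ?ltr0n.
have [n zn] : exists n : nat, rnorm z < n%:R.
  by exists (Num.bound (rnorm z)); apply: archi_boundP; exact: rnorm_ge0.
have [_ _ _] := aP n; rewrite -bpart -bz size_mkseq => h.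
have := lt_le_trans h (bb z (a n).1.2).
have := ler_wpM2r (rnorm_ge0 (a n).1.2) (ltW zn); lra.
Qed.

End continuity.

Section weakly_bounded.
Variables (R : realType) (U V Y : normedModType R[i]) (e : V -> Y -> R[i]) (L : U -> V).
Hypothesis gcY : geometrically_complete Y.
Hypothesis er : forall v a y y', e v (a *: y + y') = a * e v y + e v y'.
Hypothesis eb : forall v y, cabs (e v y) <= rnorm v * rnorm y.
Hypothesis enorm : forall v (M : R), 0 <= M ->
  (forall y, cabs (e v y) <= M * rnorm y) -> rnorm v <= M.
Hypothesis LZ : forall (t : R) u, L (t%:C *: u) = t%:C *: L u.

(** Uniform boundedness on Y for the functionals e (L u) with |u| <= 1. Homogeneity over the reals
    covers linear and conjugate-linear maps at once. *)
Lemma weakly_bounded :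
  (forall y, exists M : R, forall u, cabs (e (L u) y) <= M * rnorm u) ->
  bounded_operator L.
Proof.
move=> h.
pose F : set (topdual Y) := [set f | exists u, rnorm u <= 1 /\ forall y, ev f y = e (L u) y].
have [y|M hM] := uniform_boundedness (F := F) gcY.
  have [M hM] := h y; exists `|M| => f [u [u1 ->]].
  apply: le_trans (hM u) _; apply: le_trans (ler_norm _) _.
  by rewrite normrM ler_piMr// ger0_norm ?rnorm_ge0.
have M1 u : rnorm u <= 1 -> rnorm (L u) <= `|M|.
  move=> u1; have [|f fE] := @dual_of _ Y (e (L u)) `|L u| (er (L u)).
    by move=> y; rewrite -!rnormE -rmorphM lecR; exact: eb.
  apply: enorm => // y; rewrite -fE; apply: le_trans (ev_rbound f y) _.
  rewrite ler_wpM2r ?rnorm_ge0//; apply: le_trans (ler_norm M).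
  by apply: hM; exists u.
exists `|M|%:C => u; rewrite -!rnormE -rmorphM lecR.
have [->|u0] := eqVneq u 0.
  by have := LZ 0 0; rewrite scaler0 scale0r => ->; rewrite !rnorm0 mulr0.
have r0 := rnorm_gt0 u0.
have := M1 (((rnorm u)^-1)%:C *: u).
rewrite LZ !rnormZr gtr0_norm ?invr_gt0// mulVf ?gt_eqF// => /(_ (lexx _)).
by rewrite mulrC ler_pdivrMr.
Qed.

End weakly_bounded.

(** * From incidence to semilinear operators *)

Section realization.
Variables (R : realType) (W W' X : normedModType R[i]).
Variable b : W -> W' -> R[i].
Hypothesis bl : forall a u u' v, b (a *: u + u') v = a * b u v + b u' v.
Hypothesis br : forall a u v v', b u (a *: v + v') = a * b u v + b u v'.
Hypothesis bnd : forall u, u != 0 -> exists v, b u v != 0.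
Hypothesis bndr : forall v, v != 0 -> exists u, b u v != 0.
Hypothesis Winf : unspanned W.
Hypothesis bb : forall w v, cabs (b w v) <= rnorm w * rnorm v.
Hypothesis bnorm : forall w (M : R), 0 <= M ->
  (forall v, cabs (b w v) <= M * rnorm v) -> rnorm w <= M.
Hypothesis gcX : geometrically_complete X.
Hypothesis gcW' : geometrically_complete W'.
(** The image under [phi] of the rank one idempotent made of w and v; of these, w is the vector in
    the straight case and the functional in the crossed one. *)
Variable psi : W -> W' -> 'B(X).
Hypothesis psi_isrank1 : forall w v, b w v = 1 -> isrank1 (psi w v).
Hypothesis psi_range : forall w v v', b w v = 1 -> b w v' = 1 ->
  same_range (psi w v) (psi w v').
Hypothesis psi_kernel : forall w w' v, b w v = 1 -> b w' v = 1 ->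
  same_kernel (psi w v) (psi w' v).
Hypothesis psi_onto : forall E, isrank1 E -> exists w v, b w v = 1 /\ psi w v = E.
Hypothesis psi_perp : forall w v w' v', b w v = 1 -> b w' v' = 1 ->
  b w v' = 0 -> b w' v = 0 -> perp (psi w v) (psi w' v').
Hypothesis psi_scale : forall c w v, c != 0 -> psi (c *: w) (c^-1 *: v) = psi w v.

Lemma pair1l w : w != 0 -> exists v, b w v = 1.
Proof.
by move=> /bnd [v wv]; exists ((b w v)^-1 *: v); rewrite (pairZr br) mulVf.
Qed.

Lemma pair1r v : v != 0 -> exists w, b w v = 1.
Proof.
by move=> /bndr [w wv]; exists ((b w v)^-1 *: w); rewrite (pairZ bl) mulVf.
Qed.

Lemma same_range_rank1_inv (x y : X) (f g : topdual X) : ev g y = 1 ->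
  same_range (rank1 x f) (rank1 y g) -> y = ev f y *: x.
Proof. by move=> gy h; have [] := h y; rewrite !rank1E gy scale1r. Qed.

Lemma same_kernel_rank1_inv (x y : X) (f g : topdual X) : ev f x = 1 ->
  same_kernel (rank1 x f) (rank1 y g) -> f = ev f y *: g.
Proof.
move=> fx h; apply: dual_ext => z; have [] := h z; rewrite !rank1E evZ.
by move/(scaler_injl (ev1_neq0r fx)) => <- _; rewrite evZl mulrC.
Qed.

(** The range of psi w v depends only on w and its kernel only on v, so representatives can be
    chosen separately, at the cost of a scalar. *)
Lemma rank1_frames : exists (sigma : W -> X) (kappa : W' -> topdual X),
  [/\ forall w, w != 0 -> sigma w != 0, forall v, v != 0 -> kappa v != 0 &
      forall w v, b w v = 1 -> exists a, psi w v = a *: rank1 (sigma w) (kappa v)].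
Proof.
have /choice [sigma sE] w : exists y, w != 0 ->
    exists v g, [/\ b w v = 1, ev g y = 1 & psi w v = rank1 y g].
  have [->|w0] := eqVneq w 0; first by exists 0.
  have [v wv] := pair1l w0; have [y [g [gy e]]] := psi_isrank1 wv.
  by exists y => _; exists v, g.
have /choice [kappa kE] v : exists g, v != 0 ->
    exists w y, [/\ b w v = 1, ev g y = 1 & psi w v = rank1 y g].
  have [->|v0] := eqVneq v 0; first by exists 0.
  have [w wv] := pair1r v0; have [y [g [gy e]]] := psi_isrank1 wv.
  by exists g => _; exists w, y.
exists sigma, kappa; split.
- by move=> w /sE [v [g [_ gy _]]]; exact: ev1_neq0r gy.
- by move=> v /kE [w [y [_ gy _]]]; exact: ev1_neq0 gy.
move=> w v wv; have wv0 : b w v != 0 by rewrite wv oner_neq0.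
have [v' [g [wv' gy e1]]] := sE w (pair_neq0l bl wv0).
have [w' [y' [wv'' gy' e2]]] := kE v (pair_neq0r br wv0).
have [y [h [hy e]]] := psi_isrank1 wv.
have := psi_range wv' wv; rewrite e1 e => /(same_range_rank1_inv hy) yE.
have := psi_kernel wv wv''; rewrite e2 e => /(same_kernel_rank1_inv hy) hE.
exists (ev g y * ev h y'); apply: bounded_op_ext => z.
rewrite bounded_opZE !rank1E {1}hE {1}yE evZl !scalerA.
by congr (_ *: _); ring.
Qed.

Section frames.
Variables (sigma : W -> X) (kappa : W' -> topdual X).
Hypothesis sigma_neq0 : forall w, w != 0 -> sigma w != 0.
Hypothesis kappa_neq0 : forall v, v != 0 -> kappa v != 0.
Hypothesis psiE : forall w v, b w v = 1 -> exists a, psi w v = a *: rank1 (sigma w) (kappa v).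

(** If b w v = 0, two orthogonal idempotents through w and v have orthogonal images. If b w v <> 0,
    scaling w or v gives the same idempotent; were its image to have ev (kappa v) (sigma w) = 0, its
    square would vanish. *)
Lemma frames_incidence w v : w != 0 -> v != 0 ->
  b w v = 0 <-> ev (kappa v) (sigma w) = 0.
Proof.
move=> w0 v0; split=> [wv|].
  have [v1 wv1] := pair1l w0; have [u uv] := pair1r v0.
  (* Correcting [v1] by a multiple of v makes it vanish at u without changing its value at w. *)
  have [u' u'E] : exists u', u' = - b u v1 *: v + v1 by eexists.
  have wu' : b w u' = 1 by rewrite u'E br wv mulr0 add0r.
  have uu' : b u u' = 0 by rewrite u'E br uv mulr1 addNr.
  have [_ p] := psi_perp wu' uv wv uu'.
  have [a aE] := psiE wu'; have [a' a'E] := psiE uv.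
  have a0 : a != 0.
    by apply: contra_neq (isrank1_neq0 (psi_isrank1 wu')) => a0; rewrite aE a0 scale0r.
  have a'0 : a' != 0.
    by apply: contra_neq (isrank1_neq0 (psi_isrank1 uv)) => a0'; rewrite a'E a0' scale0r.
  have u'0 : u' != 0 by apply: (@pair_neq0r _ _ _ _ br w); rewrite wu' oner_neq0.
  have u0 : u != 0 by apply: (@pair_neq0l _ _ _ _ bl _ v); rewrite uv oner_neq0.
  have [z kz] := dual_neq0 (kappa_neq0 u'0).
  have /eqP := p z; rewrite aE a'E !bounded_opZE !rank1E !evZ !scaler_eq0.
  rewrite (negbTE a'0) (negbTE (sigma_neq0 u0)) orbF (negbTE a0) (negbTE kz) /=.
  by move/eqP.
move=> k0; apply/eqP; apply: contraT => wv0.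
have wv1 : b ((b w v)^-1 *: w) v = 1 by rewrite (pairZ bl) mulVf.
have wv2 : b w ((b w v)^-1 *: v) = 1 by rewrite (pairZr br) mulVf.
have [a aE] := psiE wv1; have [a' a'E] := psiE wv2.
have i0 : (b w v)^-1 != 0 by rewrite invr_eq0.
have e : psi ((b w v)^-1 *: w) v = psi w ((b w v)^-1 *: v).
  by rewrite -(psi_scale w ((b w v)^-1 *: v) i0) invrK scalerA divff// scale1r.
have r1 := psi_isrank1 wv1; have /eqP := isrank1_neq0 r1; case.
apply: bounded_op_ext => z.
have /idempotentsE <- := isrank1_idem r1.
by rewrite {2}e a'E aE !bounded_opZE !rank1E !evZ k0 !mulr0 scale0r scaler0.
Qed.

Lemma frames_onto y : y != 0 -> exists w c, w != 0 /\ sigma w = c *: y.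
Proof.
move=> y0; have [g gy] := dual_separation0 y0.
have [|w [v [wv e]]] := psi_onto (E := rank1 y g); first by exists y, g.
have [a aE] := psiE wv.
have yE : y = (a * ev (kappa v) y) *: sigma w.
  have := congr1 (fun B : 'B(X) => B y) e.
  by rewrite /= aE bounded_opZE !rank1E gy scale1r scalerA.
have c0 : a * ev (kappa v) y != 0.
  by apply: contra_neq y0 => c0; rewrite yE c0 scale0r.
exists w, (a * ev (kappa v) y)^-1; split.
  by apply: (@pair_neq0l _ _ _ _ bl _ v); rewrite wv oner_neq0.
by rewrite {2}yE scalerA mulVf// scale1r.
Qed.

Lemma coframes_onto g : g != 0 -> exists v c, v != 0 /\ kappa v = c *: g.
Proof.
move=> /dual_neq0 [y0 gy0]; have [y gy] : exists y, ev g y = 1.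
  by exists ((ev g y0)^-1 *: y0); rewrite evZ mulVf.
have [|w [v [wv e]]] := psi_onto (E := rank1 y g); first by exists y, g.
have [a aE] := psiE wv.
have gE : g = (a * ev g (sigma w)) *: kappa v.
  apply: dual_ext => z.
  have := congr1 (fun B : 'B(X) => ev g (B z)) e.
  rewrite evZl /= aE bounded_opZE !rank1E evZ (evZ g _ y) gy mulr1 => <-.
  by rewrite evZ; ring.
have c0 : a * ev g (sigma w) != 0.
  by apply: contraTneq (ev1_neq0 gy) => c0; rewrite gE c0 scale0r eqxx.
exists v, (a * ev g (sigma w))^-1; split.
  by apply: (@pair_neq0r _ _ _ _ br w); rewrite wv oner_neq0.
by rewrite {2}gE scalerA mulVf// scale1r.
Qed.

End frames.

Definition id_or_conj (theta : R[i] -> R[i]) : Prop :=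
  (forall c, theta c = c) \/ (forall c, theta c = Num.conj c).

Lemma rnorm_id_or_conj theta c : id_or_conj theta ->
  cabs (theta c) = cabs c.
Proof.
by case=> ->//; apply: complexI; rewrite !rnormE; exact: norm_conjC.
Qed.

(** The last clause says that functionals on X, pulled back by T, are pairings with elements of W'
    up to theta; for W = X' and W' = X this is the source of reflexivity. In the third clause the
    scalar is 1 because psi w v is idempotent. *)
Lemma realization : exists (theta : R[i] -> R[i]) (T : W -> X) (Tinv : X -> W),
  [/\ id_or_conj theta /\ (forall a u w, T (a *: u + w) = theta a *: T u + T w),
      [/\ bounded_operator T, cancel T Tinv, cancel Tinv T & bounded_operator Tinv],
      forall w v u, b w v = 1 -> psi w v (T u) = T (b u v *: w) &
      forall g : topdual X, exists v d, forall u, ev g (T u) = d * theta (b u v)].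
Proof.
have [sigma [kappa [s0 k0 psiE]]] := rank1_frames.
have inc := frames_incidence s0 k0 psiE.
have so := frames_onto psiE; have ko := coframes_onto psiE.
have [theta [T [[thD thM th1 thI thS] [[TD TZ] TI] TS Ts kT]]] :=
  fundamental_theorem bl br bnd Winf s0 k0 inc so ko.
have [M thB] := theta_bounded bl br bnd Winf bb gcX thD thM th1 thI TD TZ TS kT.
have th : id_or_conj theta := theta_id_or_conj thD thM th1 thS thB.
have thR := theta_real thD thM th1 thS thB.
have [Tinv TK] := choice TS.
have Tinj u w : T u = T w -> u = w.
  move=> e; apply/eqP; rewrite -subr_eq0; apply/eqP/TI.
  by rewrite TD -scaleN1r TZ -(rmorphN1 (@real_complex R)) thR rmorphN1 scaleN1r e subrr.
have KT : cancel T Tinv by move=> u; apply: Tinj; rewrite TK.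
have kdual (g : topdual X) : exists v d, forall u, ev g (T u) = d * theta (b u v).
  have [->|g0] := eqVneq g 0; first by exists 0, 0 => u; rewrite mul0r.
  have [v [c [v0 vc]]] := ko _ g0; have [d [d0 dE]] := kT _ v0.
  have c0 : c != 0 by apply: contraTneq (k0 _ v0) => c0; rewrite vc c0 scale0r eqxx.
  exists v, (c^-1 * d) => u; rewrite -mulrA -dE vc evZl.
  by rewrite mulrA mulVf// mul1r.
exists theta, T, Tinv; split=> //; last 1 first.
- move=> w v u wv; have [a aE] := psiE _ _ wv.
  have wv0 : b w v != 0 by rewrite wv oner_neq0.
  have w0 := pair_neq0l bl wv0; have v0 := pair_neq0r br wv0.
  have [c [c0 cE]] := Ts _ w0; have [d [d0 dE]] := kT _ v0.
  have pE z : psi w v (T z) = (a * d / c) *: T (b z v *: w).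
    rewrite aE bounded_opZE rank1E dE TZ cE !scalerA; congr (_ *: _).
    by field.
  have r := psi_isrank1 wv.
  have e1 : a * d / c != 0.
    rewrite !mulf_neq0 ?invr_eq0//.
    by apply: contra_neq (isrank1_neq0 r) => a0; rewrite aE a0 scale0r.
  have /idempotentsE/(_ (T w)) := isrank1_idem r.
  rewrite pE wv scale1r opZ pE wv scale1r.
  have Tw0 : T w != 0 by apply: contra_neq w0; exact: TI.
  move/(scalerI e1); rewrite -[RHS]scale1r => /(scaler_injl Tw0) e.
  by rewrite pE e scale1r.
- by split=> // a u w; rewrite TD TZ.
split=> //.
- apply: (@weakly_bounded _ W X (topdual X) (fun x g => ev g x)).
  + exact: geometrically_complete_dual.
  + by move=> x a f g; rewrite evDl evZl.
  + by move=> x g; rewrite mulrC; exact: ev_rbound.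
  + by move=> x B; exact: rnorm_le_dual.
  + by move=> t u; rewrite TZ thR.
  move=> g; have [v [d dE]] := kdual g.
  exists (cabs d * rnorm v) => u; rewrite dE rnormM rnorm_id_or_conj//.
  by rewrite -mulrA ler_wpM2l ?rnorm_ge0// mulrC.
- apply: (@weakly_bounded _ X W W' b) => //.
  + by move=> t u; apply: Tinj; rewrite TZ thR !TK.
  move=> v; have [->|v0] := eqVneq v 0.
    by exists 0 => u; rewrite (pair0r br) rnorm0 mul0r.
  have [d [d0 dE]] := kT _ v0.
  exists (cabs (d^-1) * rnorm (kappa v)) => y.
  rewrite -(rnorm_id_or_conj _ th).
  have -> : theta (b (Tinv y) v) = d^-1 * ev (kappa v) y.
    by rewrite -{2}(TK y) dE mulrA mulVf// mul1r.
  by rewrite rnormM -mulrA ler_wpM2l ?rnorm_ge0// ev_rbound.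
Qed.

End realization.

(** * Conclusion *)

Section transport.
Variables (R : realType) (U V : normedModType R[i]) (theta : R[i] -> R[i]).
Variables (T : U -> V) (Tinv : V -> U).
Hypothesis th : id_or_conj theta.
Hypothesis TL : forall a u w, T (a *: u + w) = theta a *: T u + T w.
Hypothesis TB : bounded_operator T.
Hypothesis TK : cancel T Tinv.
Hypothesis KT : cancel Tinv T.
Hypothesis KB : bounded_operator Tinv.

Lemma id_or_conj_nat n : theta n%:R = n%:R.
Proof. by case: th => ->//; rewrite conjC_nat. Qed.

Lemma id_or_conjK c : theta (theta c) = c.
Proof. by case: th => h; rewrite !h ?conjCK. Qed.

Lemma semilinearD u w : T (u + w) = T u + T w.
Proof. by have := TL 1 u w; rewrite (id_or_conj_nat 1) !scale1r. Qed.

Lemma semilinear0 : T 0 = 0.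
Proof. by apply: (addrI (T 0)); rewrite -semilinearD !addr0. Qed.

Lemma semilinearZ a u : T (a *: u) = theta a *: T u.
Proof. by rewrite -[a *: u]addr0 TL semilinear0 addr0. Qed.

Lemma semilinearN u : T (- u) = - T u.
Proof. by apply: (addrI (T u)); rewrite -semilinearD !subrr semilinear0. Qed.

Lemma bounded_invertibleP : bounded_invertible T Tinv.
Proof.
split=> //; case: th => h; [left|right] => a u w; rewrite TL h //.
Qed.

(** If T is conjugate-linear, so is its inverse, and T^-1 D T is linear again. *)
Lemma transport_ex (D : 'B(V)) : exists B : 'B(U), forall u, T (B u) = D (T u).
Proof.
have [M M0 TM] := bounded_operator_pos TB.
have [N N0 KN] := bounded_operator_pos KB.
have BP : (fun u => Tinv (D (T u))) \in bounded_linear.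
  apply/bounded_linearP; split.
    move=> a u w; apply: (can_inj TK).
    by rewrite KT !TL !KT opD opZ.
  exists (N * (opnorm D * M)) => u; apply: le_trans (KN _) _.
  rewrite -!mulrA ler_wpM2l//; apply: le_trans (opnorm_bound D _) _.
  by rewrite ler_wpM2l ?opnorm_ge0.
by exists (BoundedOp BP) => u; rewrite /= KT.
Qed.

Lemma transport_sim (B B' : 'B(U)) (D D' : 'B(V)) :
  (forall u, T (B u) = D (T u)) -> (forall u, T (B' u) = D' (T u)) ->
  sim B B' <-> sim D D'.
Proof.
move=> h h'; rewrite !simP.
have E u : T (jd B B' u) = jd D D' (T u) by rewrite /jd semilinearD !(h, h').
split=> e z.
  by rewrite -[z]KT -!E e semilinearZ id_or_conj_nat.
by apply: (can_inj TK); rewrite !E e semilinearZ id_or_conj_nat E.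
Qed.

End transport.

Section dual_facts.
Variables (R : realType) (X : normedModType R[i]).
Implicit Types (x y z : X) (f g h : topdual X) (A B C D : 'B(X)).

Lemma adjoint_sim A B : sim (adjoint A) (adjoint B) <-> sim A B.
Proof.
rewrite !simP; split=> e z.
  apply: ev_inj => f; have := congr1 (fun g => ev g z) (e f).
  by rewrite /jd !evE !(opE, evE) => {}e; apply: (eq_of_sub e); ring.
apply: dual_ext => x; have := congr1 (ev z) (e x).
by rewrite /jd !evE !(opE, evE) => {}e; apply: (eq_of_sub e); ring.
Qed.

Lemma dual_infinite : unspanned X -> unspanned (topdual X).
Proof.
move=> Xinf s.
have bl (a : R[i]) x y f : ev f (a *: x + y) = a * ev f x + ev f y by rewrite evD evZ.
have [x [/eqP x0 xs]] := @pair_kernel _ X (topdual X) (fun x f => ev f x) bl Xinf s [::].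
have [f fx] := dual_separation0 x0; exists f => fs.
have dp (a : R[i]) f' g y : ev (a *: f' + g) y = a * ev f' y + ev g y by rewrite evDl evZl.
have := @pair_in_span _ _ _ (fun (f : topdual X) x => ev f x) dp s f x xs fs.
by rewrite fx => /eqP; rewrite oner_eq0.
Qed.

Lemma reflexive_preadjoint : reflexive_space X ->
  forall D : 'B(topdual X), exists C : 'B(X), forall f, D f = adjoint C f.
Proof.
move=> Xr D.
have /choice [c cE] x : exists y, forall f, ev (D f) x = ev f y.
  have FP : (fun f : topdual X => ev (D f) x : R[i]^o) \in bounded_linear.
    apply/bounded_linearP; split.
      by move=> a f g; rewrite (linearP D).
    exists (opnorm D * `|x|) => f; apply: le_trans (ev_bound _ _) _.
    by rewrite mulrAC ler_wpM2r// opnorm_bound.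
  have [y yE] := Xr (BoundedOp FP : topdual (topdual X)); exists y => f.
  by have := congr1 (fun F : topdual (topdual X) => ev F f) yE.
have cP : c \in bounded_linear.
  apply/bounded_linearP; split.
    by move=> a x y; apply: ev_inj => f; rewrite evD evZ -!cE evD evZ.
  exists (opnorm D) => x; have [f [f1 fx]] := hahn_banach (c x).
  have f1' : `|f| <= 1 by apply: dual_norm_le => // z; rewrite mul1r.
  rewrite -(normr_id (c x)) -fx -cE; apply: le_trans (ev_bound _ _) _.
  rewrite ler_wpM2r//; apply: le_trans (opnorm_bound D f) _.
  by rewrite ler_piMr ?opnorm_ge0.
by exists (BoundedOp cP) => f; apply: dual_ext => x; rewrite ev_adj cE.
Qed.

End dual_facts.

Section normalized.
Variables (R : realType) (X : completeNormedModType R[i]).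
Implicit Types (x y z w : X) (f g h k : topdual X) (A B P Q S : 'B(X)).
Hypothesis Xinf : unspanned X.
Variable phi : 'B(X) -> 'B(X).
Hypothesis hphi : forall A B, sim A B <-> sim (phi A) (phi B).
Hypothesis phi1 : phi 1 = 1.
Hypothesis phim1 : phi (-1) = -1.
Hypothesis hit : pm_idempotents `<=` range phi.

Let pd (a : R[i]) x y f : ev f (a *: x + y) = a * ev f x + ev f y.
Proof. by rewrite evD evZ. Qed.

Let dp (a : R[i]) f g x : ev (a *: f + g) x = a * ev f x + ev g x.
Proof. by rewrite evDl evZl. Qed.

Let isr x f : ev f x = 1 -> isrank1 (rank1 x f).
Proof. by exists x, f. Qed.

Let prk x f : ev f x = 1 -> isrank1 (phi (rank1 x f)).
Proof. by move/isr; exact: (phi_isrank1 Xinf hphi phi1 phim1 hit). Qed.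

Let onto E : isrank1 E -> exists x f, ev f x = 1 /\ phi (rank1 x f) = E.
Proof.
move=> /(phi_rank1_preim Xinf hphi phi1 phim1 hit) [_ [x [f [fx ->]]] <-].
by exists x, f.
Qed.

Let perpx x f y g : ev f x = 1 -> ev g y = 1 -> ev g x = 0 -> ev f y = 0 ->
  perp (phi (rank1 x f)) (phi (rank1 y g)).
Proof.
move=> fx gy gx fy; apply/(phi_perp_rank1 Xinf hphi phi1 phim1 hit (isr fx) (isr gy)).
by split=> z; rewrite !rank1E evZ ?gx ?fy mulr0 scale0r.
Qed.

Let scale x f c : c != 0 -> rank1 (c *: x) (c^-1 *: f) = rank1 x f.
Proof.
move=> c0; apply: bounded_op_ext => z.
by rewrite !rank1E evZl scalerA mulrAC mulVf// mul1r.
Qed.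

Let phiN x f : ev f x = 1 -> phi (- rank1 x f) = - phi (rank1 x f).
Proof. by move/isr; exact: (phi_rank1N Xinf hphi phi1 phim1 hit). Qed.

Lemma straight_form : (forall P, isrank1 P -> straight phi P) ->
  exists (T : X -> X) Tinv, bounded_invertible T Tinv /\
    forall A x, phi A x = T (A (Tinv x)).
Proof.
move=> st.
have [||||||||||||theta [T [Tinv [[th TL] [TB TK KT KB] TE _]]]] :=
  @realization R X (topdual X) X (fun x f => ev f x) pd _ _ _ Xinf _ _ _ _
    (fun x f => phi (rank1 x f)) prk.
- by move=> a f g x; exact: dp.
- by move=> x /ev_neq0.
- by move=> f /dual_neq0.
- by move=> x f; rewrite mulrC; exact: ev_rbound.
- by move=> x B; exact: rnorm_le_dual.
- exact: geometrically_complete_complete.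
- exact: geometrically_complete_dual.
- move=> x f g fx gx; have [h _] := st _ (isr fx) _ (isr gx).
  by apply: h; exact: same_range_rank1.
- move=> x y f fx fy; have [_ h] := st _ (isr fx) _ (isr fy).
  by apply: h; exact: same_kernel_rank1.
- exact: onto.
- by move=> x f y g *; exact: perpx.
- by move=> c x f c0; rewrite scale.
(* [Phi A] is T^-1 (phi A) T; by [TE] it fixes the rank one idempotents. *)
have /choice [Phi PhiE] A := transport_ex TL TB TK KT KB (phi A).
exists T, Tinv; split; first exact: (bounded_invertibleP th).
have PhiI : forall A, Phi A = A.
  apply: (preserver_fixing_rank1_idempotents Xinf).
  - move=> A B; rewrite hphi; apply: iff_sym.
    exact: (transport_sim th TL TK KT (PhiE A) (PhiE B)).
  - move=> x f fx; apply: bounded_op_ext => z; apply: (can_inj TK).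
    by rewrite PhiE TE.
  - move=> x f fx; apply: bounded_op_ext => z; apply: (can_inj TK).
    by rewrite PhiE phiN// !bounded_opNE TE// (semilinearN th TL).
by move=> A x; rewrite -{1}(KT x) -PhiE PhiI.
Qed.

Lemma crossed_form : (forall P, isrank1 P -> crossed phi P) ->
  reflexive_space X /\ exists (T : topdual X -> X) Tinv, bounded_invertible T Tinv /\
    forall A x, phi A x = T (adjoint A (Tinv x)).
Proof.
move=> cr.
have [|||||||||||||theta [T [Tinv [[th TL] [TB TK KT KB] TE Tdual]]]] :=
  @realization R (topdual X) X X (fun f x => ev f x) dp _ _ _ (dual_infinite Xinf) _ _ _ _
    (fun f x => phi (rank1 x f)).
- by move=> f a x y; exact: pd.
- by move=> f /dual_neq0.
- by move=> x /ev_neq0.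
- by move=> f x; exact: ev_rbound.
- by move=> f B B0 h; exact: dual_rnorm_le.
- exact: geometrically_complete_complete.
- exact: geometrically_complete_complete.
- by move=> f x; exact: prk.
- move=> f x y fx fy; have [_ h] := cr _ (isr fx) _ (isr fy).
  by apply: h; exact: same_kernel_rank1.
- move=> f g x fx gx; have [h _] := cr _ (isr fx) _ (isr gx).
  by apply: h; exact: same_range_rank1.
- by move=> E /onto [x [f [fx e]]]; exists f, x.
- by move=> f x g y fx gy fy gx; exact: perpx.
- move=> c f x c0; rewrite -[X in rank1 _ (X *: _)]invrK scale// invr_eq0//.
have Xr : reflexive_space X.
  move=> F.
  have [M M0 KM] := bounded_operator_pos KB.
  (* [F] is carried to X by [Tinv], and [theta] undoes a possible conjugation, so [g] is a linear
     functional; [Tdual] then represents it by a vector. *)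
  have [||g gE] := @dual_of _ X (fun y => theta (ev F (Tinv y))) (`|F| * M).
  - move=> a x y; have -> : Tinv (a *: x + y) = theta a *: Tinv x + Tinv y.
      by apply: (can_inj TK); rewrite KT TL !KT (id_or_conjK th).
    by rewrite evD evZ; case: th => h; rewrite !h// rmorphD rmorphM /= conjCK.
  - move=> x; have -> : `|theta (ev F (Tinv x))| = `|ev F (Tinv x)|.
      by case: th => ->; rewrite ?norm_conjC.
    apply: le_trans (ev_bound _ _) _; rewrite -mulrA ler_wpM2l//; exact: KM.
  have [x [d dE]] := Tdual g; exists (theta d *: x); apply: dual_ext => f.
  rewrite -[RHS](id_or_conjK th) -{2}(TK f) -gE dE.
  have -> : ev (evaluation (theta d *: x)) f = ev f (theta d *: x) by [].
  by rewrite evZ; case: th => h; rewrite !h// rmorphM /= conjCK.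
split=> //.
(* Transport yields an operator on X'; reflexivity makes it the adjoint of an operator on X. *)
have /choice [Phi PhiE] A : exists B : 'B(X), forall f, T (adjoint B f) = phi A (T f).
  have [D DE] := transport_ex TL TB TK KT KB (phi A).
  by have [C CE] := reflexive_preadjoint Xr D; exists C => f; rewrite -CE DE.
exists T, Tinv; split; first exact: (bounded_invertibleP th).
have PhiI : forall A, Phi A = A.
  apply: (preserver_fixing_rank1_idempotents Xinf).
  - move=> A B; rewrite hphi -(adjoint_sim (Phi A)); apply: iff_sym.
    exact: (transport_sim th TL TK KT (PhiE A) (PhiE B)).
  - move=> x f fx; apply: bounded_op_ext => z; apply: ev_inj => k.
    rewrite -ev_adj; have -> : adjoint (Phi (rank1 x f)) k = ev k x *: f.
      by apply: (can_inj TK); rewrite PhiE TE.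
    by rewrite rank1E evZl evZ mulrC.
  - move=> x f fx; apply: bounded_op_ext => z; apply: ev_inj => k.
    rewrite -ev_adj; have -> : adjoint (Phi (- rank1 x f)) k = - (ev k x *: f).
      by apply: (can_inj TK); rewrite PhiE phiN// bounded_opNE TE// (semilinearN th TL).
    by rewrite bounded_opNE rank1E evNl evZl evN evZ mulrC.
by move=> A x; rewrite -{1}(KT x) -PhiE PhiI.
Qed.

Lemma normalized_form :
  (exists (T : X -> X) Tinv, bounded_invertible T Tinv /\
    forall A x, phi A x = T (A (Tinv x))) \/
  (reflexive_space X /\ exists (T : topdual X -> X) Tinv, bounded_invertible T Tinv /\
    forall A x, phi A x = T (adjoint A (Tinv x))).
Proof.
have [/straight_form|/crossed_form] := all_straight_or_crossed Xinf hphi phi1 phim1 hit.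
  by left.
by right.
Qed.

End normalized.

Lemma pm_idempotentsN (R : realType) (X : normedModType R[i]) (P : 'B(X)) :
  pm_idempotents P -> pm_idempotents (- P).
Proof.
case=> -[h P0]; [right|left]; split; rewrite ?oppr_eq0//.
  by rewrite mulrNN opprK.
by rewrite /idempotents /= mulrNN h.
Qed.

Lemma simNN (R : realType) (X : normedModType R[i]) (A B : 'B(X)) :
  sim A B <-> sim (- A) (- B).
Proof. by rewrite /sim /jordan !mulrNN. Qed.

(** The characterization passes to preimages: J ~ B gives phi J ~ phi B, hence phi B ~ phi B, hence
    B ~ B. *)
Lemma phi_unit (R : realType) (X : normedModType R[i]) (phi : 'B(X) -> 'B(X)) J :
  (forall A B, sim A B <-> sim (phi A) (phi B)) ->
  phi J = 1 \/ phi J = -1 -> J = 1 \/ J = -1.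
Proof.
move=> hphi hJ.
have sq (E : 'B(X)) : idempotents E -> sim E E.
  by move=> /idempotentsE EE; apply/sim_self => z; rewrite !EE.
apply: unit_characterization; first apply/hphi.
  have /sq s : idempotents (1 : 'B(X)) by exact: idem1.
  by case: hJ => -> //; rewrite -simNN.
move=> B /hphi h; apply/hphi; case: hJ => e; rewrite e in h.
  by apply: sq; exact/sim1.
by rewrite simNN; apply: sq; exact/simm1.
Qed.

Theorem theorem1 (R : realType) (X : completeNormedModType R[i])
    (phi : 'B(X) -> 'B(X)) :
  infinite_dimensional X ->
  pm_idempotents `<=` range phi ->
  (forall A B : 'B(X),
     idempotents (jordan A B) <-> idempotents (jordan (phi A) (phi B))) ->
  (exists (T Tinv : X -> X) (lambda : R[i]),
     [/\ bounded_invertible T Tinv,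
         lambda = -1 \/ lambda = 1 &
         forall (A : 'B(X)) (x : X), phi A x = lambda *: T (A (Tinv x))])
  \/
  (reflexive_space X /\
   exists (T : topdual X -> X) (Tinv : X -> topdual X) (lambda : R[i]),
     [/\ bounded_invertible T Tinv,
         lambda = -1 \/ lambda = 1 &
         forall (A : 'B(X)) (x : X),
           phi A x = lambda *: T (adjoint A (Tinv x))]).
Proof.
move=> /infinite_dimensionalP Xinf hit hphi.
have [J _ J1] : range phi 1.
  by apply: hit; left; split; [exact: idem1|exact: one_neq0 Xinf].
have [K _ K1] : range phi (-1).
  by apply/hit/pm_idempotentsN; left; split; [exact: idem1|exact: one_neq0 Xinf].
have hJ := phi_unit hphi (or_introl J1); have hK := phi_unit hphi (or_intror K1).
have m1 : (-1 : 'B(X)) <> 1.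
  move=> e; have [x nx] := Xinf [::]; apply: nx.
  have /eqP := congr1 (fun B : 'B(X) => B x) e; rewrite !opE eq_sym -subr_eq0 opprK.
  by rewrite -[x + x]/(x *+ 2) -scaler_nat scaler_eq0 (negbTE (two_neq0 R)) => /eqP.
have [[p1 pm1]|[p1 pm1]] : (phi 1 = 1 /\ phi (-1) = -1) \/ (phi 1 = -1 /\ phi (-1) = 1).
  case: hJ hK => e [] e'; rewrite e in J1; rewrite e' in K1; [|by left|by right|].
    by case: m1; rewrite -K1 J1.
  by case: m1; rewrite -K1 J1.
- have [[T [Tinv [TT h]]]|[Xr [T [Tinv [TT h]]]]] := normalized_form Xinf hphi p1 pm1 hit.
    by left; exists T, Tinv, 1; split=> // [|A x]; [right|rewrite scale1r h].
  by right; split=> //; exists T, Tinv, 1; split=> // [|A x]; [right|rewrite scale1r h].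
(* In the remaining case [- phi] is normalized, and lambda is -1. *)
have hphi' A B : sim A B <-> sim (- phi A) (- phi B).
  by rewrite -simNN; exact: hphi.
have hit' : pm_idempotents `<=` range (fun A => - phi A).
  move=> P /pm_idempotentsN /hit [A _ e]; exists A => //.
  by rewrite e opprK.
have p1' : - phi 1 = 1 by rewrite p1 opprK.
have pm1' : - phi (-1) = -1 by rewrite pm1.
have E A x : phi A x = -1 *: (- phi A) x by rewrite scaleN1r bounded_opNE opprK.
have [[T [Tinv [TT h]]]|[Xr [T [Tinv [TT h]]]]] := normalized_form Xinf hphi' p1' pm1' hit'.
  by left; exists T, Tinv, (-1); split=> // [|A x]; [left|rewrite E h].
by right; split=> //; exists T, Tinv, (-1); split=> // [|A x]; [left|rewrite E h].
Qed.
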